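(* Let $d\ge 3$ and $0<\alpha<2$. Let $(t(n))_{n\ge 1}$ be a non-decreasing sequence of positive real numbers with $\lim_{n\to\infty} t(n)/n=0$, and let $$\mathcal{T}=\{(x',x_d)\in\mathbb{Z}^{d-1}\times\mathbb{Z}:\ \|x'\|\le t(x_d),\ x_d\ge 1\}.$$ Then $\mathcal{T}$ is massive with respect to the $\alpha$-stable random walk $S_\alpha$ on $\mathbb{Z}^d$ if and only if the series $$\sum_{n>0}\Big(\frac{t(2^n)}{2^n}\Big)^{d-\alpha-1}$$ diverges.
   Context: $\|\cdot\|$ is the Euclidean norm. Let $\phi$ be the step distribution of the simple random walk on $\mathbb{Z}^d$ (uniform on the $2d$ vectors $\pm e_1,\dots,\pm e_d$) and let $\phi^{(n)}$ be its $n$-fold convolution power. For $0<\alpha<2$, the $\alpha$-stable random walk $S_\alpha=\{S_\alpha(n)\}_{n\ge 0}$ is the random walk on $\mathbb{Z}^d$ whose i.i.d. increments have law $\Phi_\alpha=\sum_{n\ge1}c(\psi_\alpha,n)\,\phi^{(n)}$, where $c(\psi_\alpha,n)=\frac{\alpha/2}{\Gamma(1-\alpha/2)}\frac{\Gamma(n-\alpha/2)}{\Gamma(n+1)}$; equivalently, if $P$ is the operator of convolution by $\phi$, the transition operator of $S_\alpha$ is $I-(I-P)^{\alpha/2}$. A proper subset $B\subset\mathbb{Z}^d$ is called massive (recurrent) with respect to a transient random walk if, for every starting point $x\in\mathbb{Z}^d$, the walk started at $x$ hits $B$ with probability $1$; otherwise it is non-massive. *)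

(* Defs.v *)
From HB Require Import structures.
From mathcomp Require Import all_boot all_order all_algebra.
From mathcomp Require Import finmap.
From mathcomp Require Import all_classical all_reals all_analysis.

Set Implicit Arguments.
Unset Strict Implicit.
Unset Printing Implicit Defensive.

Import Order.TTheory GRing.Theory Num.Theory.
Import numFieldNormedType.Exports.

Local Open Scope classical_set_scope.
Local Open Scope ring_scope.

(* Z^d with its discrete sigma-algebra. The alias keeps that sigma-algebra from
   being attached to row vectors in general. *)
Definition lattice (d : nat) : Type := 'rV[int]_d.

HB.instance Definition _ d := GRing.Zmodule.on (lattice d).
HB.instance Definition _ d := isPointed.Build (lattice d) 0.
HB.instance Definition _ d := @isMeasurable.Build default_measure_display
  (lattice d) discrete_measurable (@discrete_measurable0 (lattice d))
  (@discrete_measurableC (lattice d)) (@discrete_measurableU (lattice d)).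

Definition coord (d : nat) (x : lattice d) (i : 'I_d) : int :=
  (x : 'rV[int]_d) 0 i.

Definition unit_vector (d : nat) (i : 'I_d) : lattice d :=
  delta_mx 0 i : 'rV[int]_d.

Section step_distribution.
Context {R : realType} {d : nat}.

(* Laws on Z^d are given by their mass functions, with values in \bar R so that
   sums of nonnegative terms over Z^d are library sums. *)
Definition srw_step (x : lattice d) : \bar R :=
  (if [exists i, (x == unit_vector i) || (x == - unit_vector i)]
   then (2 * d)%:R^-1 else 0)%:E.

Definition convolution (f g : lattice d -> \bar R) (x : lattice d) : \bar R :=
  (\esum_(y in [set: lattice d]) (f y * g (x - y)%R))%E.

Definition convolution_power (f : lattice d -> \bar R) (n : nat) :
    lattice d -> \bar R :=
  iter n (convolution f) (fun x => (x == 0)%:R%:E).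

(* Euler's integral; only meaningful for s > 0. *)
Definition Gamma (s : R) : R :=
  \int[lebesgue_measure]_(u in `]0%R, +oo[) (u `^ (s - 1) * expR (- u)).

Definition stable_coef (alpha : R) (n : nat) : R :=
  (alpha / 2) / Gamma (1 - alpha / 2) *
  (Gamma (n%:R - alpha / 2) / Gamma (n%:R + 1)).

Definition stable_step (alpha : R) (x : lattice d) : \bar R :=
  (\sum_(1 <= n <oo)
     (stable_coef alpha n)%:E * convolution_power srw_step n x)%E.

End step_distribution.

Section random_walk.
Context {disp : measure_display} {Omega : measurableType disp} {R : realType}.
Context {d : nat} (P : probability Omega R).

Definition mutually_independent (X : nat -> {RV P >-> lattice d}) : Prop :=
  forall (J : {fset nat}) (A : nat -> set (lattice d)),
    (forall i, measurable (A i)) ->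
    P (\bigcap_(i in [set` J]) X i @^-1` A i) =
    (\prod_(i <- J) P (X i @^-1` A i))%E.

Definition iid_with_law (X : nat -> {RV P >-> lattice d})
    (f : lattice d -> \bar R) : Prop :=
  mutually_independent X /\
  forall n v, distribution P (X n) [set v] = f v.

Definition walk (X : nat -> {RV P >-> lattice d}) (x : lattice d) (n : nat)
    (w : Omega) : lattice d :=
  x + \sum_(k < n) X k w.

Definition massive (X : nat -> {RV P >-> lattice d}) (B : set (lattice d)) :
    Prop :=
  B `<` [set: lattice d] /\
  forall x, P [set w | exists n, B (walk X x n w)] = 1%E.

End random_walk.

(* The condition i.+1 = d singles out the last coordinate. *)
Definition thorn {R : realType} (d : nat) (t : nat -> R) : set (lattice d) :=
  [set x | exists2 i : 'I_d, i.+1 = d :> nat &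
    1 <= coord x i /\
    Num.sqrt (\sum_(j < d | j != i) (coord x j)%:~R ^+ 2) <=
      t `|coord x i|%N].

(* Main.v *)
From mathcomp Require Import all_boot all_order all_algebra.
From mathcomp Require Import finmap.
From mathcomp Require Import all_classical all_reals all_analysis.
From mathcomp Require Import measurable_realfun.
From mathcomp Require Import zify ring lra.
Require Import Defs.

(** The transition operator of the stable walk is I - (I - A)^(alpha/2), with A the
    averaging operator of the simple random walk, so its Green function is the series
    of (I - A)^(-alpha/2) in the kernels of the simple walk. Both directions of the
    theorem only use that this Green function is comparable to |x|^(alpha - d), from
    above and from below (green_bounds).

    These bounds are obtained from the lazy walk, whose Green function differs from
    that of the simple walk by constant factors (lazy_green_le, lazy_green_ge). Given
    how many of the first k steps of the lazy walk fall on each coordinate, the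
    coordinates are independent one-dimensional lazy walks, with binomial laws
    (lazy_kernelE). Explicit bounds on binomial coefficients and on the mean of the
    product of the inverse occupation numbers give a Gaussian upper bound for the
    kernel and a matching lower bound near the diagonal (lazy_kernel_le,
    lazy_kernel_ge); summing over k with the weights k^(alpha/2 - 1) yields the
    Green function.

    Hitting probabilities are compared with potentials of finite charges. A potential
    that is at least c on B dominates c times the probability of hitting B
    (hit_prob_le_green); a potential of a charge on B that is at most M on B is at
    most M times that probability (green_le_hit_prob). Hence a box of height H and
    radius r <= H, seen from distance H, is hit with probability of the order of
    (r/H)^(d-1-alpha): on the box, the uniform charge has potential of order r^alpha,
    and its mass is H r^(d-1) (box_decay_ge, box_decay_le).

    If the series converges, the thorn is a union of one finite box and of dyadic
    boxes with summable hitting probabilities, and a starting point far below the tip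
    misses it with positive probability (nonmassive_thorn). If the series diverges, a
    charge spread over many dyadic boxes shows that the hitting probability is bounded
    below uniformly in the starting point (massive_thorn); a walk that keeps having
    such a chance of success succeeds almost surely (hit_prob_eq1). *)

Set Implicit Arguments.
Unset Strict Implicit.
Unset Printing Implicit Defensive.

Import Order.TTheory GRing.Theory Num.Theory.
Import numFieldNormedType.Exports.

Local Open Scope classical_set_scope.
Local Open Scope ring_scope.
(** * The Gamma function *)

Section gamma_function.
Context {R : realType}.
Implicit Types x u a b : R.
Local Notation mu := (@lebesgue_measure R).

(* The integrand is singular at 0 when x < 1, so the half-line is exhausted by
   compact intervals on which the fundamental theorem of calculus applies. *)
Let F (n : nat) : set R := `[expR (- n%:R), expR n%:R]%classic.

Let bigcupF : \bigcup_n F n = `]0, +oo[%classic :> set R.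
Proof.
apply/seteqP; split => u /=.
  move=> [n _]; rewrite /F/= !in_itv/= andbT => /andP[nu _].
  exact: lt_le_trans (expR_gt0 _) nu.
rewrite in_itv/= andbT => u0.
have [N lnn] : exists N : nat, `|ln u| <= N%:R.
  by exists (Num.bound `|ln u|); exact/ltW/archi_boundP.
exists N => //.
have eu : expR (ln u) = u by apply: lnK; rewrite posrE.
move: lnn; rewrite ler_norml => /andP[lo hi].
by rewrite /F/= in_itv/= -eu !ler_expR lo.
Qed.

Let g x u := u `^ (x - 1) * expR (- u).

Let g_ge0 x u : 0 <= g x u.
Proof. by rewrite mulr_ge0 ?powR_ge0 ?expR_ge0. Qed.

Let g_cont x a b : 0 < a -> {within `[a, b], continuous (g x)}.
Proof.
move=> a0; apply: continuous_in_subspaceT => u; rewrite inE/= in_itv/= => /andP[au _].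
have u0 : 0 < u := lt_le_trans a0 au.
apply: (@continuousM _ _ (fun u => u `^ (x - 1)) (fun u => expR (- u))).
  apply: differentiable_continuous; apply/derivable1_diffP.
  by apply: derivable_powR; rewrite in_itv/= u0.
by apply: (@continuous_comp _ _ _ (@GRing.opp R) expR);
  [exact: opp_continuous|exact: continuous_expR].
Qed.

(* the boundary term of the integration by parts *)
Let H x u := u `^ x * expR (- u).

Let H_derive x u : 0 < u -> is_derive u 1 (H x) (x * g x u - g (x + 1) u).
Proof.
move=> u0.
have d1 := is_derive1_powR x u0.
have d2 : is_derive u 1 (fun u => expR (- u)) (- expR (- u)).
  by apply: is_derive_eq; rewrite mulrN1.
have := is_deriveM d1 d2; rewrite /H /g => d; apply: is_derive_eq.
rewrite addrK /GRing.scale/=; ring.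
Qed.

Let expRn_lt n : (0 < n)%N -> expR (- n%:R) < expR n%:R :> R.
Proof. by move=> n0; rewrite ltr_expR gtrN// ltr0n. Qed.

Let g_integrable x n : mu.-integrable (F n) (EFin \o g x).
Proof.
apply: continuous_compact_integrable; first exact: segment_compact.
exact/g_cont/expR_gt0.
Qed.

Let parts x n : (0 < n)%N ->
  (x%:E * \int[mu]_(u in F n) (g x u)%:E = \int[mu]_(u in F n) (g (x + 1) u)%:E +
    (H x (expR n%:R) - H x (expR (- n%:R)))%:E)%E.
Proof.
move=> n0.
have mF : measurable (F n) by exact: measurable_itv.
have xg : mu.-integrable (F n) (EFin \o (fun u => x * g x u)).
  have -> : EFin \o (fun u => x * g x u) = (fun u => x%:E * (EFin \o g x) u)%E by [].
  exact: integrableZl.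
have : (\int[mu]_(u in F n) (x * g x u - g (x + 1) u)%:E =
    (H x (expR n%:R))%:E - (H x (expR (- n%:R)))%:E)%E.
  apply: continuous_FTC2; first exact: expRn_lt.
  - move=> u; apply: cvgB; last exact/g_cont/expR_gt0.
    by apply: cvgMr; exact/g_cont/expR_gt0.
  - have dH u : 0 < u -> derivable (H x) u 1 by move=> /(H_derive x) [].
    have cH u : 0 < u -> {for u, continuous (H x)}.
      by move=> /dH d; apply: differentiable_continuous; apply/derivable1_diffP.
    split.
    + by move=> u; rewrite in_itv/= => /andP[/(lt_trans (expR_gt0 _)) u0 _]; exact: dH.
    + by apply: cvg_at_right_filter; exact/cH/expR_gt0.
    + by apply: cvg_at_left_filter; exact/cH/expR_gt0.
  - move=> u; rewrite in_itv/= => /andP[/(lt_trans (expR_gt0 _)) u0 _].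
    by rewrite derive1E (derive_val (is_derive := H_derive x u0)).
under eq_integral do rewrite EFinB.
rewrite integralB_EFin//.
rewrite EFinB => <-; rewrite addeC subeK.
  under [RHS]eq_integral do rewrite EFinM.
  by rewrite integralZl//; exact: g_integrable.
exact/integrable_fin_num/g_integrable.
Qed.

Let H_lo x : 0 < x -> H x (expR (- n%:R)) @[n --> \oo] --> 0.
Proof.
move=> x0; apply: (@squeeze_cvgr _ _ _ _ (fun=> 0) (fun n => (expR (- x)) ^+ n)).
- apply: nearW => n; rewrite mulr_ge0 ?powR_ge0 ?expR_ge0//=.
  rewrite /H -expRM -expRM_natl mulNr -mulrN ler_piMr ?expR_ge0// ?expR_le1 ?oppr_le0
    ?expR_ge0//.
- exact: cvg_cst.
- by apply: cvg_expr; rewrite ger0_norm ?expR_ge0// expR_lt1 oppr_lt0.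
Qed.

Let H_hi x : 0 < x -> H x (expR n%:R) @[n --> \oo] --> 0.
Proof.
move=> x0; pose C := (x + 1) ^+ 2 / 2.
apply: (@squeeze_cvgr _ _ _ _ (fun=> 0) (fun n => expR C * (expR (- 1)) ^+ n)).
- apply: nearW => n; rewrite mulr_ge0 ?powR_ge0 ?expR_ge0//=.
  rewrite /H -expRM -expRM_natl -!expRD ler_expR mulrN1.
  have := @expRxDyMexpx R 0 0.
  have := expR_ge1Dxn 1 (ler0n R n); rewrite (_ : 2`! = 2)%N// => h.
  rewrite /C; have : 0 <= (n%:R - (x + 1)) ^+ 2 by exact: sqr_ge0.
  move: h; rewrite !expr2; lra.
- exact: cvg_cst.
- rewrite -[X in _ --> X](mulr0 (expR C)); apply: cvgMr.
  by apply: cvg_expr; rewrite ger0_norm ?expR_ge0// expR_lt1 oppr_lt0.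
Qed.

Let I x := (\int[mu]_(u in `]0%R, +oo[) (g x u)%:E)%E.

Let I_ge0 x : (0 <= I x)%E.
Proof. by apply: integral_ge0 => u _; rewrite lee_fin. Qed.

Let I_lim x : (\int[mu]_(u in F n) (g x u)%:E @[n --> \oo] --> I x)%E.
Proof.
rewrite /I -bigcupF; apply: ge0_nondecreasing_set_cvg_integral => //.
- apply/nondecreasing_seqP => n; rewrite subsetEset; apply: subset_itvScc;
  rewrite bnd_simp ler_expR.
    by rewrite lerN2 ler_nat.
  by rewrite ler_nat.
- by move=> n; exact: measurable_itv.
- by move=> n; have /integrableP[] := g_integrable x n.
- by move=> n u _; rewrite lee_fin.
Qed.

Let I_succ x : 0 < x -> (x%:E * I x = I (x + 1))%E.
Proof.
move=> x0.
have l1 : (x%:E * \int[mu]_(u in F n) (g x u)%:E @[n --> \oo] --> x%:E * I x)%E.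
  by apply: cvgeZl => //; exact: I_lim.
have l2 : ((\int[mu]_(u in F n) (g (x + 1) u)%:E +
    (H x (expR n%:R) - H x (expR (- n%:R)))%:E)%E @[n --> \oo] --> (I (x + 1) +
      0%:E)%E).
  apply: cvgeD; [|exact: I_lim|].
    by rewrite fin_num_adde_defl.
  apply: cvg_EFin; first by apply: nearW.
  rewrite [X in _ --> X](_ : _ = 0 - 0); last by rewrite subrr.
  by apply: cvgB; [exact: H_hi|exact: H_lo].
rewrite -[RHS]adde0; apply: cvg_unique l1 _ => //.
apply: cvg_trans l2; apply: near_eq_cvg; near=> n; rewrite parts//.
near: n; exact: nbhs_infty_gt.
Unshelve. all: by end_near. Qed.

Let I1 : I 1 = 1%E.
Proof.
rewrite -(@integral_exponential_pdf R 1 ltr01).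
transitivity (\int[mu]_(u in `[0%R, +oo[) (expR (- u))%:E)%E.
  rewrite -integral_itv_obnd_cbnd.
    by apply: eq_integral => u _; rewrite /g subrr powRr0 mul1r.
  by apply/measurable_EFinP; apply: measurableT_comp.
rewrite integral_mkcond; apply: eq_integral => u _.
by rewrite /exponential_pdf !patchE; case: ifP => //; rewrite mul1r mulN1r.
Qed.

Let mg (z : R) : @measurable_fun _ _ R (\bar R) `]0%R, +oo[ (EFin \o g z).
Proof.
apply/measurable_EFinP; apply: open_continuous_measurable_fun => // u.
rewrite inE/= in_itv/= andbT => u0.
have := @g_cont z (u / 2) (u + 1); rewrite divr_gt0// => /(_ isT).
rewrite continuous_within_itvP; last by lra.
by move=> [+ _ _]; apply; rewrite in_itv/=; lra.
Qed.

(* I_succ carries finiteness both ways between x and x + 1; on ]1, 2] the power is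
   at most 1 + u, which compares the integral with those at 1 and 2. *)
Let I_fin x : 0 < x -> I x \is a fin_num.
Proof.
have step y : 0 < y -> I (y + 1) \is a fin_num -> I y \is a fin_num.
  move=> y0; rewrite -I_succ// !ge0_fin_numE ?mule_ge0 ?lee_fin ?(ltW y0)// => h.
  by rewrite ltey; apply/eqP => e; move: h; rewrite e gt0_muley ?lte_fin.
have step' y : 0 < y -> I y \is a fin_num -> I (y + 1) \is a fin_num.
  by move=> y0 h; rewrite -I_succ// fin_numM.
have f2 : I (1 + 1) \is a fin_num by apply: step' => //; rewrite I1.
have main y : 0 < y <= 1 -> I y \is a fin_num.
  move=> /andP[y0 y1]; apply: step => //.
  rewrite ge0_fin_numE//; apply: (@le_lt_trans _ _ (I 1 + I (1 + 1))); last first.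
    by rewrite lte_add_pinfty ?ltey_eq ?f2// I1.
  rewrite -ge0_integralD//=; last 4 first.
  - by move=> u _; rewrite lee_fin.
  - exact: mg.
  - by move=> u _; rewrite lee_fin.
  - exact: mg.
  apply: ge0_le_integral => //=.
  - by move=> u _; rewrite lee_fin.
  - exact: mg.
  - by apply: emeasurable_funD; exact: mg.
  move=> u; rewrite in_itv/= andbT => u0.
  rewrite -EFinD lee_fin /g addrK subrr powRr0 addrK powRr1 ?(ltW u0)// -mulrDl.
  rewrite ler_wpM2r ?expR_ge0//.
  have [u1|u1] := leP (u : R) 1.
    apply: (@le_trans _ _ 1); last by rewrite lerDl ltW.
    rewrite -[leRHS](_ : 1 `^ y = 1); last by rewrite powR1.
    by apply: ge0_ler_powR; rewrite ?nnegrE ?(ltW y0) ?(ltW u0) ?ler01.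
  by apply: (@le_trans _ _ u); [exact/ler1_powR/y1/ltW|rewrite lerDr].
have all n y : 0 < y <= n.+1%:R -> I y \is a fin_num.
  elim: n y => [|n IH] y; first exact: main.
  move=> /andP[y0 yn]; have [y1|y1] := leP y 1; first by apply: main; rewrite y0.
  rewrite -[y](subrK 1); apply: step'; first by rewrite subr_gt0.
  by apply: IH; rewrite subr_gt0 y1/= lerBlDr natr1.
move=> x0; apply: (all (Num.bound x)).
by rewrite x0/= ltW// (lt_le_trans (archi_boundP (ltW x0)))// ler_nat.
Qed.

Lemma Gamma_succ x : 0 < x -> Gamma (x + 1) = x * Gamma x.
Proof.
move=> x0; rewrite /Gamma /Rintegral -/(I _) -/(I _) -I_succ//.
by rewrite fineM// I_fin.
Qed.

Lemma Gamma_1 : Gamma (1 : R) = 1.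
Proof. by rewrite /Gamma /Rintegral -/(I _) I1. Qed.

Lemma Gamma_gt0 x : 0 < x -> 0 < Gamma x.
Proof.
move=> x0; rewrite /Gamma /Rintegral -/(I _).
rewrite fine_gt0// -ge0_fin_numE// I_fin// andbT.
apply: (@lt_le_trans _ _ (\int[mu]_(u in `[1%R, 2%R]) (expR (- 2) / 2)%:E)%E).
  rewrite integral_cst//= lebesgue_measure_itv/= lte_fin ltrDr ltr01.
  rewrite -EFinB -EFinM lte_fin addrK mulr1.
  by rewrite divr_gt0// expR_gt0.
apply: (@le_trans _ _ (\int[mu]_(u in `[1%R, 2%R]) (g x u)%:E)%E).
  apply: ge0_le_integral => //=.
  - apply/measurable_EFinP; apply: subspace_continuous_measurable_fun => //.
    exact: g_cont.
  move=> u; rewrite in_itv/= => /andP[u1 u2]; rewrite lee_fin /g mulrC.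
  apply: ler_pM; rewrite ?expR_ge0 ?invr_ge0//; last by rewrite ler_expR lerN2.
  apply: (@le_trans _ _ u^-1); first by rewrite lef_pV2 ?posrE ?(lt_le_trans ltr01 u1).
  rewrite -powR_inv1 ?(le_trans ler01)//.
  by apply: ler_powR => //; rewrite lerDr ltW.
apply: ge0_subset_integral => //=.
- exact: mg.
- by move=> u _; rewrite lee_fin.
- by move=> u /=; rewrite !in_itv/= andbT => /andP[u1 _]; exact: lt_le_trans ltr01 u1.
Qed.

End gamma_function.

(** * The coefficients of the stable walk and of its Green function *)

Section powR_estimates.
Context {R : realType}.
Implicit Types x y q : R.

(** A concave power lies below its tangent at 1; this is Young's inequality with
    one factor equal to 1. *)
Lemma powR_le_tangent x (th : R) : 0 <= x -> 0 < th <= 1 ->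
  x `^ th <= th * x + (1 - th).
Proof.
move=> x0 /andP[th0]; rewrite le_eqVlt => /predU1P[->|th1].
  by rewrite powRr1// mul1r subrr addr0.
have := @conjugate_powR R (x `^ th) 1 th^-1 (1 - th)^-1 (powR_ge0 _ _) ler01.
rewrite !invr_gt0 !invrK th0 subr_gt0 th1 => /(_ isT isT).
rewrite addrC subrK => /(_ erefl).
by rewrite -powRrM divff ?gt_eqF// powRr1// powR1 mulr1 mul1r mulrC.
Qed.

(** A convex power lies above its tangent at 1. *)
Lemma powRN_ge_tangent x q : -1 < x -> 0 <= q -> 1 - q * x <= (1 + x) `^ (- q).
Proof.
move=> x1 q0; have x0 : 0 < 1 + x by rewrite -ltrBlDl sub0r.
rewrite /powR gt_eqF// mulNr; apply: le_trans (expR_ge1Dx _).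
by rewrite lerD2l lerN2 ler_wpM2l// le_ln1Dx.
Qed.

End powR_estimates.

Section green_coefficients.
Context {R : realType}.
Implicit Types (s alpha : R) (n : nat).

(** The coefficients of (1 - z)^(-s). *)
Fixpoint green_coef s n : R :=
  if n is m.+1 then green_coef s m * ((m%:R + s) / m.+1%:R) else 1.

(** The coefficients of 1 - (1 - z)^(alpha / 2). The value 0 at n = 0 allows sums
    over all n. *)
Definition jump_coef alpha n : R := if n is 0 then 0 else stable_coef alpha n.

Lemma green_coef_gt0 s n : 0 < s -> 0 < green_coef s n.
Proof.
move=> s0; elim: n => //= n IH.
by rewrite mulr_gt0// divr_gt0// ltr_wpDl.
Qed.

Lemma green_coef_noninc s m n : 0 < s < 1 -> (m <= n)%N ->
  green_coef s n <= green_coef s m.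
Proof.
move=> /andP[s0 s1]; elim: n => [|n IH]; first by rewrite leqn0 => /eqP ->.
rewrite leq_eqVlt => /predU1P[->//|]; rewrite ltnS => /IH; apply: le_trans => /=.
rewrite ler_piMr ?(ltW (green_coef_gt0 _ _))// ler_pdivrMr// mul1r -natr1.
by rewrite lerD2l ltW.
Qed.

(** The two bounds compare the ratio (n + s) / (n + 1) of consecutive coefficients
    with that of consecutive powers, for which the tangent inequalities go in
    opposite directions. *)
Lemma green_coef_le s n : 0 < s < 1 -> green_coef s n <= n.+1%:R `^ (s - 1).
Proof.
move=> /andP[s0 s1]; elim: n => [|n IH] /=; first by rewrite powR1.
apply: (@le_trans _ _ (n.+1%:R `^ (s - 1) * ((n%:R + s) / n.+1%:R))).
  by rewrite ler_wpM2r// divr_ge0// addr_ge0// ltW.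
have -> : n.+2%:R `^ (s - 1) =
    n.+1%:R `^ (s - 1) * (1 + n.+1%:R^-1) `^ (- (1 - s)) :> R.
  rewrite opprB -powRM//.
  by rewrite mulrDr mulr1 divff// natr1.
rewrite ler_wpM2l ?powR_ge0//; apply: le_trans (powRN_ge_tangent _ _); last first.
- by rewrite subr_ge0 ltW.
- by rewrite (@lt_le_trans _ _ 0)// ?ltrN10 ?invr_ge0.
rewrite ler_pdivrMr// mulrBl mul1r -mulrA mulVf// mulr1 -natr1; lra.
Qed.

Lemma green_coef_ge s n : 0 < s < 1 -> s * n.+1%:R `^ (s - 1) <= green_coef s n.
Proof.
move=> /andP[s0 s1].
have pos : forall m, s * m.+1%:R `^ (s - 1) <= green_coef s m.+1.
  elim=> [|m IH]; first by rewrite /= powR1 !mulr1 divr1 add0r mul1r.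
  rewrite [leRHS]/= -[_ * ((m%:R + s) / _)]/(green_coef s m.+1).
  apply: le_trans (ler_wpM2r _ IH); last by rewrite divr_ge0// addr_ge0// ltW.
  rewrite -mulrA (ler_wpM2l (ltW s0))//.
  (* concavity of x^(1-s) at 1, taken at x = (m+1)/(m+2) *)
  have := @powR_le_tangent R (m.+1%:R / m.+2%:R) (1 - s).
  rewrite divr_ge0// subr_gt0 s1 lerBlDr lerDl (ltW s0) => /(_ isT isT) h.
  have -> : m.+2%:R `^ (s - 1) =
      m.+1%:R `^ (s - 1) * (m.+1%:R / m.+2%:R) `^ (1 - s) :> R.
    rewrite powRM// ?invr_ge0// mulrA -powRD; last by rewrite pnatr_eq0 implybT.
    have -> : s - 1 + (1 - s) = 0 by ring.
    by rewrite powRr0 mul1r -powR_inv1// -powRrM mulN1r opprB.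
  rewrite (ler_wpM2l (powR_ge0 _ _))//; apply: le_trans h _.
  rewrite ler_pdivlMr// mulrDl mulrA divfK// -[m.+2%:R]natr1; lra.
case: n => [|n]; first by rewrite powR1 mulr1 /= ltW.
apply: le_trans (pos n); rewrite (ler_wpM2l (ltW s0))// -opprB !powRN.
rewrite lef_pV2 ?posrE ?powR_gt0//; apply: ge0_ler_powR; rewrite ?nnegrE//.
  by rewrite subr_ge0 ltW.
by rewrite ler_nat.
Qed.

Lemma jump_coefS alpha n : 0 < alpha < 2 ->
  jump_coef alpha n.+2 =
  jump_coef alpha n.+1 * ((n.+1%:R - alpha / 2) / n.+2%:R).
Proof.
move=> /andP[a0 a2] /=; rewrite /stable_coef.
have p0 : 0 < n.+1%:R - alpha / 2.
  by rewrite subr_gt0 (@lt_le_trans _ _ 1) ?ler1n//; lra.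
have -> : n.+2%:R - alpha / 2 = (n.+1%:R - alpha / 2) + 1 by rewrite -natr1 addrAC.
rewrite [in Gamma (n.+2%:R + 1)]natr1 -[n.+3%:R]natr1 [in n.+1%:R + 1]natr1.
rewrite !Gamma_succ// invfM; ring.
Qed.

Lemma jump_coef1 alpha : 0 < alpha < 2 -> jump_coef alpha 1 = alpha / 2.
Proof.
move=> /andP[a0 a2] /=; rewrite /stable_coef Gamma_succ// Gamma_1 mulr1 divr1.
by rewrite divfK// gt_eqF// Gamma_gt0; lra.
Qed.

Lemma jump_coef_ge0 alpha n : 0 < alpha < 2 -> 0 <= jump_coef alpha n.
Proof.
move=> ha; case: n => //; elim => [|n IH].
  by rewrite jump_coef1//; case/andP: ha => a0 _; rewrite divr_ge0// ltW.
rewrite jump_coefS// mulr_ge0// divr_ge0// subr_ge0.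
by case/andP: ha => a0 a2; rewrite (@le_trans _ _ 1) ?ler1n//; lra.
Qed.

(** Coefficientwise form of (1 - z)^s (1 - z)^(-s) = 1, with s = alpha / 2; the
    coefficients T n of the left-hand side satisfy (n + 1) T (n + 1) = n T n by
    the two-term recurrences of both factors. *)
Lemma green_coef_renewal alpha n : 0 < alpha < 2 ->
  \sum_(k < n.+2) jump_coef alpha k * green_coef (alpha / 2) (n.+1 - k) =
  green_coef (alpha / 2) n.+1.
Proof.
move=> ha; set s := alpha / 2; pose b := green_coef s.
pose e k : R := if k is 0 then 1 else - jump_coef alpha k.
have eS k : k.+1%:R * e k.+1 = (k%:R - s) * e k.
  case: k => [|k]; first by rewrite /e jump_coef1// -/s; ring.
  by rewrite /e jump_coefS// mulrN mulrCA [k.+2%:R * _]mulrC divfK// mulrN mulrC.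
have bS k : k.+1%:R * b k.+1 = (k%:R + s) * b k.
  by rewrite /b/= mulrCA [k.+1%:R * _]mulrC divfK// mulrC.
pose T m := \sum_(k < m.+1) e k * b (m - k)%N.
have TS m : m.+1%:R * T m.+1 = m%:R * T m.
  have -> : m.+1%:R * T m.+1 = \sum_(k < m.+2) k%:R * e k * b (m.+1 - k)%N +
      \sum_(k < m.+2) e k * ((m.+1 - k)%N%:R * b (m.+1 - k)%N).
    rewrite /T mulr_sumr -big_split/=; apply: eq_bigr => k _.
    by rewrite natrB -1?ltnS//; ring.
  rewrite big_ord_recl/= mul0r mul0r add0r.
  rewrite [X in _ + X]big_ord_recr/= subnn mul0r mulr0 addr0.
  rewrite -big_split/= /T mulr_sumr; apply: eq_bigr => k _.
  rewrite /bump/= add1n subSS eS subSn -1?ltnS// bS natrB -1?ltnS//; ring.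
have T0 m : T m.+1 = 0.
  apply/eqP; have : m.+1%:R * T m.+1 == 0.
    elim: m => [|m IH]; first by rewrite TS mul0r.
    by rewrite TS.
  by rewrite mulf_eq0 pnatr_eq0.
have := T0 n; rewrite /T big_ord_recl/= mul1r subn0 => /eqP.
rewrite addr_eq0 => /eqP bn; rewrite -[RHS]/(b n.+1) bn big_ord_recl/= mul0r add0r.
by rewrite -sumrN; apply: eq_bigr => k _; rewrite /bump/= add1n mulNr opprK.
Qed.

End green_coefficients.

(** * Sums of nonnegative families *)

Section esum_complements.
Local Open Scope ereal_scope.
Context {R : realType}.

(** Tonelli's theorem for families indexed by arbitrary types. *)
Lemma esum_exchange (T1 T2 : choiceType) (a : T1 -> T2 -> \bar R) :
  (forall i j, 0 <= a i j) ->
  \esum_(i in [set: T1]) \esum_(j in [set: T2]) a i j =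
  \esum_(j in [set: T2]) \esum_(i in [set: T1]) a i j.
Proof.
move=> a0; rewrite !esum_esum//.
rewrite (reindex_esum ([set: T2] `*`` (fun=> [set: T1])) _ (fun p => (p.2, p.1)))//.
split => [[i j]//| [i j] [i' j'] _ _ [-> ->]//|[i j] _].
by exists (j, i).
Qed.

Lemma esumZl (T : choiceType) (c : \bar R) (a : T -> \bar R) :
  0 <= c -> (forall i, 0 <= a i) ->
  \esum_(i in [set: T]) (c * a i) = c * \esum_(i in [set: T]) a i.
Proof.
move=> c0 a0.
have fin (b : R) : (0 < b)%R -> forall f : T -> \bar R, (forall i, 0 <= f i) ->
    \esum_(i in [set: T]) (b%:E * f i) <= b%:E * \esum_(i in [set: T]) f i.
  move=> b0 f f0; apply: ge_ereal_sup => _ [X [finX _]] <-.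
  rewrite -ge0_mule_fsumr//; apply: lee_wpmul2l; first by rewrite lee_fin ltW.
  by apply: esum_ge; exists X.
case: c c0 => [c||]//; last first.
  move=> _; have [z|/existsNP[i ai]] := pselect (forall i, a i = 0).
    by rewrite !esum1// ?mule0// => i _; rewrite z mule0.
  have {}ai : 0 < a i by rewrite lt0e a0 andbT; apply/eqP.
  have pt (f : T -> \bar R) : (forall i, 0 <= f i) -> f i <= \esum_(i in [set: T]) f i.
    move=> f0; apply: esum_ge; exists [set i]; last by rewrite fsbig_set1.
    by split => //; exact: finite_set1.
  rewrite gt0_mulye; last exact: lt_le_trans ai (pt _ a0).
  apply/eqP; rewrite eq_le leey/= -[leLHS](gt0_mulye ai).
  by have := pt (fun i => +oo * a i) (fun j => mule_ge0 (leey 0) (a0 j)).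
rewrite lee_fin le_eqVlt => /predU1P[<-|c0].
  by rewrite mul0e esum1// => i _; rewrite mul0e.
apply/eqP; rewrite eq_le fin//=.
have := fin c^-1%R; rewrite invr_gt0 => /(_ c0 (fun i => c%:E * a i)).
under eq_esum do rewrite muleA -EFinM mulVf ?gt_eqF// mul1e.
move=> h; rewrite muleC -lee_pdivlMr// muleC; apply: h => i.
by rewrite mule_ge0// lee_fin ltW.
Qed.

Lemma esumZr (T : choiceType) (c : \bar R) (a : T -> \bar R) :
  0 <= c -> (forall i, 0 <= a i) ->
  \esum_(i in [set: T]) (a i * c) = (\esum_(i in [set: T]) a i) * c.
Proof.
by move=> c0 a0; rewrite muleC -esumZl//; apply: eq_esum => i _; rewrite muleC.
Qed.

Lemma esum_point (T : choiceType) (z : T) (c : \bar R) : 0 <= c ->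
  \esum_(y in [set: T]) (if y == z then c else 0) = c.
Proof.
move=> c0; rewrite -[RHS](@esum_set1 R T z (fun=> c))// [RHS]esum_mkcond.
apply: eq_esum => y _; case: eqP => [->|/eqP yz]; first by rewrite mem_set.
by rewrite memNset//; apply/eqP.
Qed.

Lemma esum_mul_delta (T : choiceType) (z : T) (f : T -> \bar R) : 0 <= f z ->
  \esum_(y in [set: T]) ((y == z)%:R%:E * f y) = f z.
Proof.
move=> fz; rewrite -[RHS](esum_point z fz); apply: eq_esum => y _.
by case: eqP => [->|_]; rewrite ?mul1e ?mul0e.
Qed.

Lemma esum_translate (V : zmodType) (z : V) (f : V -> \bar R) :
  \esum_(y in [set: V]) f (y + z)%R = \esum_(y in [set: V]) f y.
Proof.
rewrite [RHS](reindex_esum [set: V] _ (fun y => y + z)%R)//.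
split => // [y y' _ _ /addIr//|y _]; exists (y - z)%R => //; exact: subrK.
Qed.

Lemma esum_finite_support n (f : nat -> \bar R) : (forall k, 0 <= f k)%E ->
  (forall k, (n <= k)%N -> f k = 0%E) ->
  (\esum_(k in [set: nat]) f k = \sum_(k < n) f k)%E.
Proof.
move=> f0 fn; transitivity (\esum_(k in [set: nat]) \sum_(i < n)
    (if k == i then f i else 0))%E.
  apply: eq_esum => k _; have [kn|nk] := ltnP k n.
    rewrite (bigD1 (Ordinal kn))//= eqxx big1 ?adde0// => i.
    by rewrite -val_eqE/= eq_sym => /negPf ->.
  rewrite fn// big1// => i _; case: eqP => // ki.
  by move: nk; rewrite ki leqNgt ltn_ord.
rewrite esum_sum; last by move=> k i _ _; case: ifP.
by apply: eq_bigr => i _; exact: esum_point.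
Qed.

Lemma esum_recl (f : nat -> \bar R) : (forall k, 0 <= f k)%E ->
  (\esum_(k in [set: nat]) f k = f 0%N + \esum_(k in [set: nat]) f k.+1)%E.
Proof.
move=> f0; rewrite -!nneseries_esumT// nneseries_recl//; congr (_ + _)%E.
by rewrite -nneseries_addn//; apply: eq_eseriesr => k _; rewrite addn1.
Qed.

Lemma esum_le_partial (f : nat -> \bar R) (c : \bar R) : (forall k, 0 <= f k)%E ->
  (forall n, \sum_(0 <= k < n) f k <= c)%E -> (\esum_(k in [set: nat]) f k <= c)%E.
Proof.
move=> f0 fc; rewrite -nneseries_esumT//; apply: lime_le.
  exact: is_cvg_nneseries.
exact: nearW.
Qed.

Lemma esum_ge_partial (f : nat -> \bar R) m n : (forall k, 0 <= f k)%E ->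
  (\sum_(m <= k < n) f k <= \esum_(k in [set: nat]) f k)%E.
Proof.
move=> f0; rewrite -nneseries_esumT//.
have [nm|mn] := leqP n m; first by rewrite big_geq// nneseries_ge0.
apply: le_trans (nneseries_lim_ge n _) => //.
by rewrite [leRHS](big_cat_nat _ (ltnW mn))//= leeDr// sume_ge0.
Qed.

(** Cauchy products of nonnegative double series. *)
Lemma esum_diagonal (F : nat -> nat -> \bar R) : (forall i j, 0 <= F i j) ->
  \esum_(i in [set: nat]) \esum_(j in [set: nat]) F i j =
  \esum_(m in [set: nat]) \sum_(i < m.+1) F i (m - i)%N.
Proof.
move=> F0.
transitivity (\esum_(i in [set: nat]) \esum_(m in [set: nat])
    (if m \in [set m | (i <= m)%N] then F i (m - i)%N else 0)).
  apply: eq_esum => i _; rewrite -[RHS](esum_mkcond [set m | (i <= m)%N]).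
  rewrite (reindex_esum [set: nat] [set m | (i <= m)%N] (addn i)); last first.
    split => [j _|j j' _ _ /addnI//|m/= im]; first exact: leq_addr.
    by exists (m - i)%N => //; exact: subnKC.
  by apply: eq_esum => j _; rewrite addKn.
rewrite esum_exchange; last by move=> i j; case: ifP.
apply: eq_esum => m _; rewrite (@esum_finite_support m.+1).
- by apply: eq_bigr => i _; rewrite mem_set//= -ltnS.
- by move=> i; case: ifP.
- by move=> i mi; rewrite memNset//= leqNgt mi.
Qed.

End esum_complements.

(** * The averaging operator of the simple random walk *)

Section averaging.
Context {R : realType} {d : nat}.
Implicit Types (u v f : lattice d -> R) (x y z : lattice d).

Definition avg u x : R := (2 * d)%:R^-1 *
  \sum_(i < d) (u (x + unit_vector i) + u (x - unit_vector i)).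

Definition delta x : R := (x == 0)%:R.

(** The n-step transition probability of the simple random walk. *)
Definition srw_kernel n x : R := iter n avg delta x.

Lemma avg_ge0 u : (forall x, 0 <= u x) -> forall x, 0 <= avg u x.
Proof.
move=> u0 x; rewrite mulr_ge0 ?invr_ge0// sumr_ge0// => i _.
by rewrite addr_ge0.
Qed.

Lemma iter_avg_ge0 n u : (forall x, 0 <= u x) -> forall x, 0 <= iter n avg u x.
Proof. by move=> u0; elim: n => //= n IH; exact: avg_ge0. Qed.

Lemma srw_kernel_ge0 n x : 0 <= srw_kernel n x.
Proof. by apply: iter_avg_ge0 => y; rewrite /delta ler0n. Qed.

Lemma srw_kernelS n x : srw_kernel n.+1 x = avg (srw_kernel n) x.
Proof. by []. Qed.

Lemma unit_vector_inj : injective (@unit_vector d).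
Proof.
move=> i j /rowP/(_ i); rewrite !mxE !eqxx/=.
by case: eqP.
Qed.

Lemma unit_vector_neqN (i j : 'I_d) : unit_vector i != - unit_vector j.
Proof.
apply/eqP => /rowP/(_ i); rewrite !mxE !eqxx/=.
by case: eqP.
Qed.

(** The 2d steps are pairwise distinct, so the indicator of their set is the sum of
    their indicators. *)
Lemma srw_stepE y : srw_step y = ((2 * d)%:R^-1 * \sum_(i < d)
  ((y == unit_vector i)%:R + (y == - unit_vector i)%:R))%:E :> \bar R.
Proof.
rewrite /srw_step; congr EFin; case: ifPn => [/existsP[i]|/existsPn ne]; last first.
  by rewrite big1 ?mulr0// => i _; have := ne i;
    rewrite negb_or => /andP[/negPf -> /negPf ->]; rewrite addr0.
move=> yi; rewrite (bigD1 i)//= big1 ?addr0; last first.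
  move=> j ji; case/orP: yi => /eqP ->.
    by rewrite (inj_eq unit_vector_inj) eq_sym (negPf ji)
      (negPf (unit_vector_neqN _ _)) addr0.
  rewrite eq_sym (negPf (unit_vector_neqN _ _)) (inj_eq oppr_inj).
  by rewrite (inj_eq unit_vector_inj) eq_sym (negPf ji) addr0.
case/orP: yi => /eqP ->; rewrite eqxx.
  by rewrite (negPf (unit_vector_neqN _ _)) addr0 mulr1.
by rewrite eq_sym (negPf (unit_vector_neqN _ _)) add0r mulr1.
Qed.

Lemma avg_sum (I : finType) (a : I -> R) (u_ : I -> lattice d -> R) x :
  avg (fun y => \sum_i a i * u_ i y) x = \sum_i a i * avg (u_ i) x.
Proof.
rewrite /avg; under [RHS]eq_bigr do rewrite mulrCA.
rewrite -mulr_sumr; congr (_ * _); under [RHS]eq_bigr do rewrite mulr_sumr.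
rewrite exchange_big/=; apply: eq_bigr => i _.
by rewrite -big_split/=; apply: eq_bigr => j _; rewrite mulrDr.
Qed.

Lemma convolution_srw_step u x : (forall y, 0 <= u y) ->
  convolution srw_step (EFin \o u) x = (avg u x)%:E.
Proof.
move=> u0; rewrite /convolution.
transitivity (\esum_(y in [set: lattice d]) ((2 * d)%:R^-1%:E * \sum_(i < d)
    ((y == unit_vector i)%:R%:E * (u (x - y))%:E +
     (y == - unit_vector i)%:R%:E * (u (x - y))%:E)))%E.
  apply: eq_esum => y _; rewrite srw_stepE EFinM -muleA; congr (_ * _)%E.
  rewrite -EFinM mulr_suml -sumEFin; apply: eq_bigr => i _.
  by rewrite mulrDl EFinD !EFinM.
have nn (b : bool) (w : R) : 0 <= w -> (0 <= b%:R%:E * w%:E)%E.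
  by move=> w0; rewrite mule_ge0 ?lee_fin.
rewrite esumZl ?lee_fin ?invr_ge0//; last first.
  by move=> y; apply: sume_ge0 => i _; rewrite adde_ge0// nn.
rewrite /avg EFinM -sumEFin; congr (_ * _)%E.
rewrite esum_sum; last by move=> y i _ _; rewrite adde_ge0// nn.
apply: eq_bigr => i _; rewrite esumD; last 2 first.
- by move=> y _; exact: nn.
- by move=> y _; exact: nn.
rewrite addeC EFinD; congr (_ + _)%E.
  by rewrite (@esum_mul_delta R _ _ (fun y => (u (x - y))%:E))// ?opprK ?lee_fin.
by rewrite (@esum_mul_delta R _ _ (fun y => (u (x - y))%:E))// ?lee_fin.
Qed.

Lemma convolution_power_srw n :
  convolution_power srw_step n = (fun x : lattice d => (srw_kernel n x)%:E).
Proof.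
elim: n => [//|n IH]; apply/funext => x.
rewrite /convolution_power iterS -/(convolution_power _ n) IH.
exact/convolution_srw_step/srw_kernel_ge0.
Qed.

(** Averaging n times is integration against the n-step kernel, so that laws built
    from the kernels act as series in one operator. *)
Lemma esum_srw_kernel n v x : (forall y, 0 <= v y) ->
  (\esum_(y in [set: lattice d]) (srw_kernel n y * v (x + y)%R)%:E)%E =
  (iter n avg v x)%:E.
Proof.
move=> v0; elim: n x => [|n IH] x.
  rewrite /=; under eq_esum do rewrite EFinM.
  by rewrite (@esum_mul_delta R _ _ (fun y => (v (x + y))%:E)) ?lee_fin// addr0.
transitivity (\esum_(y in [set: lattice d]) ((2 * d)%:R^-1%:E * \sum_(i < d)
    ((srw_kernel n (y + unit_vector i) * v (x + y))%:E +
     (srw_kernel n (y - unit_vector i) * v (x + y))%:E)))%E.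
  apply: eq_esum => y _; rewrite srw_kernelS /avg -mulrA EFinM; congr (_ * _)%E.
  rewrite mulr_suml -sumEFin; apply: eq_bigr => i _.
  by rewrite -EFinD mulrDl.
have nn y z : (0 <= (srw_kernel n y * v z)%:E)%E.
  by rewrite lee_fin mulr_ge0// srw_kernel_ge0.
rewrite esumZl ?lee_fin ?invr_ge0//; last first.
  by move=> y; apply: sume_ge0 => i _; rewrite adde_ge0.
rewrite iterS /avg EFinM -sumEFin; congr (_ * _)%E.
rewrite esum_sum; last by move=> y i _ _; rewrite adde_ge0.
apply: eq_bigr => i _; rewrite esumD//.
rewrite -(esum_translate (- unit_vector i))
  -[in X in (_ + X)%E](esum_translate (unit_vector i)).
rewrite addeC EFinD -!IH; congr (_ + _)%E; apply: eq_esum => y _.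
  by rewrite addrK addrA addrAC.
by rewrite subrK addrA addrAC.
Qed.

End averaging.

(** * The transition operator of the stable walk *)

Section stable_operator.
Context {R : realType} {d : nat}.
Variable alpha : R.
Hypothesis ha : 0 < alpha < 2.
Local Notation s := (alpha / 2).
Implicit Types (f : lattice d -> R) (a : nat -> R) (x y : lattice d).
Implicit Types (u v : lattice d -> \bar R).

Lemma half_alpha_itv : 0 < s < 1.
Proof. by case/andP: ha => a0 a2; lra. Qed.

Lemma stable_stepE x : stable_step alpha x =
  (\esum_(n in [set: nat]) (jump_coef alpha n * srw_kernel n x)%:E)%E.
Proof.
have nn n : (0 <= (jump_coef alpha n * srw_kernel n x)%:E)%E.
  by rewrite lee_fin mulr_ge0 ?jump_coef_ge0 ?srw_kernel_ge0.
rewrite -nneseries_esumT// nneseries_recl//= mul0r add0e /stable_step.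
apply: congr_lim; apply/funext => n.
rewrite !big_nat; apply: eq_bigr => -[//|k] _.
by rewrite convolution_power_srw EFinM.
Qed.

Lemma stable_step_ge0 x : (0 <= stable_step alpha x)%E.
Proof.
rewrite stable_stepE esum_ge0// => n _.
by rewrite lee_fin mulr_ge0 ?jump_coef_ge0 ?srw_kernel_ge0.
Qed.

Definition step_op u x : \bar R :=
  (\esum_(y in [set: lattice d]) (stable_step alpha y * u (x + y)%R))%E.

(** The value at x of the power series with coefficients a in the averaging
    operator, applied to f. *)
Definition avg_series a f x : \bar R :=
  (\esum_(n in [set: nat]) (a n * iter n avg f x)%:E)%E.

Lemma step_op_ge0 u : (forall x, 0 <= u x)%E -> forall x, (0 <= step_op u x)%E.
Proof.
by move=> u0 x; apply: esum_ge0 => y _; rewrite mule_ge0 ?stable_step_ge0.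
Qed.

Lemma le_step_op u v x : (forall x, 0 <= u x)%E -> (forall x, u x <= v x)%E ->
  (step_op u x <= step_op v x)%E.
Proof.
by move=> u0 uv; apply: le_esum => y _; rewrite lee_wpmul2l ?stable_step_ge0.
Qed.

Lemma step_opD u v x : (forall x, 0 <= u x)%E -> (forall x, 0 <= v x)%E ->
  step_op (fun y => u y + v y)%E x = (step_op u x + step_op v x)%E.
Proof.
move=> u0 v0; rewrite /step_op -esumD; last 2 first.
- by move=> y _; rewrite mule_ge0 ?stable_step_ge0.
- by move=> y _; rewrite mule_ge0 ?stable_step_ge0.
by apply: eq_esum => y _; rewrite ge0_muleDr.
Qed.

Lemma step_opZ (c : R) u x : 0 <= c -> (forall x, 0 <= u x)%E ->
  step_op (fun y => c%:E * u y)%E x = (c%:E * step_op u x)%E.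
Proof.
move=> c0 u0; rewrite /step_op -esumZl ?lee_fin//; last first.
  by move=> y; rewrite mule_ge0 ?stable_step_ge0.
by apply: eq_esum => y _; rewrite muleCA.
Qed.

Lemma avg_series_ge0 a f x : (forall n, 0 <= a n) -> (forall y, 0 <= f y) ->
  (0 <= avg_series a f x)%E.
Proof.
move=> a0 f0; apply: esum_ge0 => n _.
by rewrite lee_fin mulr_ge0// iter_avg_ge0.
Qed.

Lemma le_avg_series a a' f x : (forall n, a n <= a' n) -> (forall y, 0 <= f y) ->
  (avg_series a f x <= avg_series a' f x)%E.
Proof.
move=> aa' f0; apply: le_esum => n _.
by rewrite lee_fin ler_wpM2r// iter_avg_ge0.
Qed.

(** Since the law of the stable walk is itself a power series in the averaging
    operator, its action on such a series is a Cauchy product. *)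
Lemma step_op_avg_series a f x : (forall n, 0 <= a n) -> (forall y, 0 <= f y) ->
  step_op (avg_series a f) x =
  avg_series (fun m => \sum_(k < m.+1) jump_coef alpha k * a (m - k)%N) f x.
Proof.
move=> a0 f0.
have c0 n : 0 <= jump_coef alpha n by exact: jump_coef_ge0.
have F0 n k y : (0 <= (jump_coef alpha n * srw_kernel n y)%:E *
    (a k * iter k avg f (x + y)%R)%:E)%E.
  by rewrite mule_ge0// lee_fin mulr_ge0// ?srw_kernel_ge0// iter_avg_ge0.
transitivity (\esum_(y in [set: lattice d]) \esum_(n in [set: nat])
    \esum_(k in [set: nat]) ((jump_coef alpha n * srw_kernel n y)%:E *
    (a k * iter k avg f (x + y)%R)%:E))%E.
  apply: eq_esum => y _; rewrite stable_stepE -esumZr; last 2 first.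
  - exact: avg_series_ge0.
  - by move=> n; rewrite lee_fin mulr_ge0// srw_kernel_ge0.
  apply: eq_esum => n _; rewrite -esumZl//.
    by rewrite lee_fin mulr_ge0// srw_kernel_ge0.
  by move=> k; rewrite lee_fin mulr_ge0// iter_avg_ge0.
rewrite esum_exchange; last by move=> y n; exact: esum_ge0.
transitivity (\esum_(n in [set: nat]) \esum_(k in [set: nat])
    (jump_coef alpha n * a k * iter (n + k) avg f x)%:E)%E.
  apply: eq_esum => n _; rewrite esum_exchange//; apply: eq_esum => k _.
  transitivity (\esum_(y in [set: lattice d]) ((jump_coef alpha n * a k)%:E *
      (srw_kernel n y * iter k avg f (x + y)%R)%:E))%E.
    by apply: eq_esum => y _; rewrite -!EFinM; congr EFin; ring.
  rewrite esumZl ?lee_fin ?mulr_ge0//; last first.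
    by move=> y; rewrite lee_fin mulr_ge0 ?srw_kernel_ge0// iter_avg_ge0.
  by rewrite esum_srw_kernel ?iterD// => y; exact: iter_avg_ge0.
rewrite esum_diagonal; last first.
  by move=> n k; rewrite lee_fin !mulr_ge0// iter_avg_ge0.
apply: eq_esum => m _; rewrite sumEFin mulr_suml; congr EFin.
by apply: eq_bigr => k _; rewrite subnKC// -ltnS.
Qed.

(** The potential of the charge f: the series of (I - A)^(-alpha/2), with A the
    averaging operator, inverts I minus the transition operator. *)
Definition green f x : \bar R := avg_series (green_coef s) f x.

Let b0 n : 0 <= green_coef s n.
Proof. by rewrite ltW// green_coef_gt0//; case/andP: half_alpha_itv. Qed.

Lemma green_ge0 f x : (forall y, 0 <= f y) -> (0 <= green f x)%E.
Proof. by move=> f0; exact: avg_series_ge0. Qed.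

(** By the renewal identity of the coefficients, the walk reproduces a potential up to
    its own charge. *)
Lemma green_eq f x : (forall y, 0 <= f y) ->
  green f x = ((f x)%:E + step_op (green f) x)%E.
Proof.
move=> f0; rewrite step_op_avg_series//.
have point0 : (f x)%:E = (\esum_(n in [set: nat])
    (if n == 0%N then (f x)%:E else 0))%E by rewrite esum_point ?lee_fin.
rewrite {1}point0 -esumD; last 2 first.
- by move=> n _; case: ifP => //; rewrite lee_fin.
- move=> n _; rewrite lee_fin mulr_ge0 ?iter_avg_ge0// sumr_ge0// => k _.
  by rewrite mulr_ge0// jump_coef_ge0.
apply: eq_esum => -[|n] _ /=.
  by rewrite big_ord_recl big_ord0/= mul0r add0r mul0r adde0 mul1r.
by rewrite add0e green_coef_renewal.
Qed.

(** Every application of the step operator removes at least one term from the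
    head of the Green series, so the iterates decay like its tails. *)
Lemma iter_step_op_green_cvg f x : (forall y, 0 <= f y) ->
  (green f x < +oo)%E -> iter n step_op (green f) x @[n --> \oo] --> 0%E.
Proof.
move=> f0 gfin.
pose tail n k := if (n <= k)%N then green_coef s k else 0.
have tail0 n k : 0 <= tail n k by rewrite /tail; case: ifP.
have iter_le n y : (iter n step_op (green f) y <= avg_series (tail n) f y)%E.
  elim: n y => [|n IH] y; first exact: le_avg_series.
  rewrite iterS; apply: (@le_trans _ _ (step_op (avg_series (tail n) f) y)).
    apply: le_step_op => // z.
    by elim: (n) z => [|m IHm] z; [exact: green_ge0|exact: step_op_ge0].
  rewrite step_op_avg_series//; apply: le_avg_series => // m.
  rewrite /tail; case: ifPn => [nm|]; last first.
    rewrite -leqNgt => mn; rewrite big1// => -[[|k] km] _/=; first by rewrite mul0r.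
    by rewrite ifF ?mulr0//; apply/negbTE; lia.
  case: m nm => // m _; rewrite -green_coef_renewal//; apply: ler_sum => k _.
  by rewrite ler_wpM2l ?jump_coef_ge0//; case: ifP.
have g0 n : (0 <= (green_coef s n * iter n avg f x)%:E)%E.
  by rewrite lee_fin mulr_ge0// iter_avg_ge0.
apply: (@squeeze_cvge _ _ _ _ (fun=> 0%E) _
  (fun n => \sum_(n <= k <oo) (green_coef s k * iter k avg f x)%:E)%E).
- apply: nearW => n; apply/andP; split.
    by elim: n x {gfin g0} => [|n IH] y; [exact: green_ge0|exact: step_op_ge0].
  apply: le_trans (iter_le n x) _; rewrite /avg_series.
  rewrite -nneseries_esumT; last by move=> k; rewrite lee_fin mulr_ge0// iter_avg_ge0.
  rewrite (nneseries_split 0 n)//; last first.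
    by move=> k _; rewrite lee_fin mulr_ge0// iter_avg_ge0.
  rewrite add0n big_nat big1 ?add0e; last first.
    by move=> k /andP[_ kn]; rewrite /tail leqNgt kn mul0r.
  apply: lee_nneseries => [k _ _|k _].
    by rewrite lee_fin mulr_ge0// iter_avg_ge0.
  rewrite lee_fin ler_wpM2r ?iter_avg_ge0// /tail; case: ifP => // _.
- exact: cvg_cst.
- by apply: nneseries_tail_cvg => //; rewrite nneseries_esumT.
Qed.

End stable_operator.

(** * Hitting probabilities *)

Section countable_sum.
Local Open Scope ereal_scope.

Lemma measure_countable_bigcup {disp : measure_display} {Omega : measurableType disp}
    {R : realType} (P : probability Omega R) (T : countType)
    (D : T -> set Omega) :
  (forall y, measurable (D y)) -> trivIset [set: T] D ->
  P (\bigcup_y D y) = \esum_(y in [set: T]) P (D y).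
Proof.
move=> mD tD; pose G n := oapp D set0 (pickle_inv n).
have GE y : G (choice.pickle y) = D y by rewrite /G pickleK_inv.
have GP n w : G n w -> exists2 y, choice.pickle y = n & D y w.
  rewrite /G; have := @pickle_invK T n; case: pickle_inv => //= y <- Dy.
  by exists y.
have mG n : measurable (G n) by rewrite /G; case: pickle_inv => [y|];
  [exact: mD|exact: measurable0].
have tG : trivIset [set: nat] G.
  move=> i j _ _ [w [/GP[y <- Dy] /GP[z <- Dz]]].
  by rewrite (tD y z)//; exists w.
have -> : \bigcup_y D y = \bigcup_n G n.
  apply/seteqP; split => [w [y _ Dy]|w [n _]].
    by exists (choice.pickle y) => //; rewrite GE.
  by move=> /GP[y _ Dy]; exists y.
rewrite measure_bigcup//; transitivity (\sum_(0 <= i <oo) P (G i)).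
  by apply: eq_eseriesl => i; rewrite in_setT.
rewrite nneseries_esumT//.
transitivity (\esum_(n in [set choice.pickle y | y in [set: T]]) P (G n)); last first.
  rewrite esum_image; last by move=> y z _ _; apply: (pcan_inj choice.pickleK).
  by apply: eq_esum => y _; rewrite GE.
rewrite [RHS]esum_mkcond; apply: eq_esum => n _; case: ifPn => //.
rewrite notin_setE => nimg; rewrite (_ : G n = set0) ?measure0//.
by rewrite -subset0 => w /GP[y yn _]; apply: nimg; exists y.
Qed.

End countable_sum.

Section hitting.
Context {R : realType} {d : nat}.
Variable alpha : R.
Hypothesis ha : 0 < alpha < 2.
Context {disp : measure_display} {Omega : measurableType disp}.
Variable P : probability Omega R.
Variable X : nat -> {RV P >-> lattice d}.
Hypothesis hX : iid_with_law X (stable_step alpha).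
Variable B : set (lattice d).
Local Notation step_op := (@step_op R d alpha).
Implicit Types (x y : lattice d) (v : nat -> lattice d) (n m : nat).

(** The probability of visiting B within n steps, defined through the transition
    operator alone. *)
Fixpoint hit n x : \bar R :=
  if x \in B then 1%E else if n is m.+1 then step_op (hit m) x else 0%E.

Lemma hit_ge0 n x : (0 <= hit n x)%E.
Proof.
elim: n x => [|n IH] x /=; case: ifP => // _.
by apply: step_op_ge0.
Qed.

(** The event that the walk with increments X m, X (m + 1), and so on, started at
    x, visits B within n steps. *)
Fixpoint hit_event n m x : set Omega :=
  if n is k.+1 then [set w | B x \/ hit_event k m.+1 (x + X m w) w]
  else [set w | B x].

(** Prescribing an initial segment of the increments is the form of conditioning
    on the past to which mutual independence applies directly. *)
Let prefix m v : set Omega := [set w | forall i, (i < m)%N -> X i w = v i].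

Let mX i y : measurable (X i @^-1` [set y]).
Proof. by rewrite -[X in measurable X]setTI; exact: measurable_funPT. Qed.

Let PX i y : P (X i @^-1` [set y]) = stable_step alpha y.
Proof. by case: hX => _ /(_ i y). Qed.

Let prefixE m v : prefix m v =
  \bigcap_(i in [set` [fset i in iota 0 m]%fset]) X i @^-1` [set v i].
Proof.
apply/seteqP; split => w /= h i; [move=> /= im; apply: h|move=> im; apply: h].
  by move: im; rewrite !inE/= mem_iota.
by rewrite /= !inE/= mem_iota.
Qed.

Let P_prefix m v : P (prefix m v) = (\prod_(i < m) stable_step alpha (v i))%E.
Proof.
rewrite prefixE; case: hX => indep _; rewrite (indep _ (fun i => [set v i]))//.
rewrite -(big_mkord xpredT (fun i => stable_step alpha (v i))).
rewrite (perm_big (index_iota 0 m))/=; last first.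
  apply: uniq_perm; rewrite ?fset_uniq ?iota_uniq// => i.
  by rewrite !inE/= /index_iota subn0.
by apply: eq_bigr => i _; exact: PX.
Qed.

Let P_prefixS m v : P (prefix m.+1 v) = (P (prefix m v) * stable_step alpha (v m))%E.
Proof. by rewrite !P_prefix big_ord_recr. Qed.

Let m_prefix m v : measurable (prefix m v).
Proof. by rewrite prefixE; apply: fin_bigcap_measurable => //; exact: finite_fset. Qed.

Let hit_eventS n m x : ~ B x ->
  hit_event n.+1 m x = \bigcup_y (X m @^-1` [set y] `&` hit_event n m.+1 (x + y)).
Proof.
move=> nBx; apply/seteqP; split => w /=; first by case=> // h; exists (X m w).
by move=> [y _ [/= <- h]]; right.
Qed.

Let m_hit_event n m x : measurable (hit_event n m x).
Proof.
elim: n m x => [|n IH] m x.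
  have [Bx|nBx] := pselect (B x).
    by rewrite (_ : hit_event _ _ _ = setT)//; apply/seteqP; split.
  by rewrite (_ : hit_event _ _ _ = set0)//; apply/seteqP; split.
have [Bx|nBx] := pselect (B x).
  by rewrite (_ : hit_event _ _ _ = setT)//; apply/seteqP; split => // w _; left.
rewrite hit_eventS//; apply: countable_bigcupT_measurable.
  exact: (@countableP 'rV[int]_d).
by move=> y; exact: measurableI.
Qed.

(* Conditioning on the first increment: given any past, the walk restarted at time m
   has the same hitting probabilities as at time 0. *)
Let P_prefix_hit n m x v :
  P (prefix m v `&` hit_event n m x) = (P (prefix m v) * hit n x)%E.
Proof.
elim: n m x v => [|n IH] m x v.
  rewrite /=; case: ifPn => [/set_mem Bx|/negP nBx].
    by rewrite mule1 (_ : [set w | B x] = setT) ?setIT//; apply/seteqP; split.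
  rewrite mule0 (_ : [set w | B x] = set0) ?setI0//.
  by apply/seteqP; split => // w Bx; apply: nBx; exact: mem_set.
have [Bx|nBx] := pselect (B x).
  rewrite (_ : hit_event _ _ _ = setT); last by apply/seteqP; split => // w _; left.
  by rewrite setIT /= (mem_set Bx) mule1.
rewrite hit_eventS// setI_bigcupr [hit _ _]/= memNset//.
pose v_ y i := if i == m then y else v i.
have pv y : prefix m (v_ y) = prefix m v.
  by apply/seteqP; split => w h i im; rewrite h// /v_ (ltn_eqF im).
have split_y y : prefix m v `&` (X m @^-1` [set y] `&` hit_event n m.+1 (x + y)) =
    prefix m.+1 (v_ y) `&` hit_event n m.+1 (x + y).
  rewrite setIA; congr (_ `&` _); apply/seteqP; split => w /=.
    move=> [h Xm] i; rewrite ltnS leq_eqVlt /v_.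
    by case: eqP => [->//|_ /=]; exact: h.
  move=> h; split; last by rewrite h// /v_ eqxx.
  by move=> i im; rewrite h ?(ltn_trans im)// /v_ (ltn_eqF im).
under eq_bigcupr do rewrite split_y.
rewrite (@measure_countable_bigcup _ _ _ P 'rV[int]_d); last 2 first.
- by move=> y; exact: measurableI.
- move=> y z _ _ [w [[h _] [h' _]]].
  by have := h m (ltnSn _); have := h' m (ltnSn _); rewrite /v_ eqxx => <- <-.
rewrite /step_op -esumZl//; last first.
  by move=> y; rewrite mule_ge0 ?stable_step_ge0// hit_ge0.
apply: eq_esum => y _; rewrite IH P_prefixS pv muleA.
by rewrite /v_ eqxx.
Qed.

Definition hit_prob x : \bar R := P [set w | exists n, B (walk X x n w)].

Let hit_eventP n m x w : hit_event n m x w <->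
  exists2 k, (k <= n)%N & B (x + \sum_(i < k) X (m + i)%N w).
Proof.
elim: n m x => [|n IH] m x /=.
  split => [Bx|[k]]; first by exists 0%N => //; rewrite big_ord0 addr0.
  by rewrite leqn0 => /eqP ->; rewrite big_ord0 addr0.
have shift k : x + X m w + \sum_(i < k) X (m.+1 + i)%N w = x + \sum_(i < k.+1) X
  (m + i)%N w.
  rewrite big_ord_recl addn0 addrA; congr (_ + _); apply: eq_bigr => i _.
  by congr (X _ w); rewrite lift0 addnS.
split => [[Bx|/IH[k kn]]|[[_|k kn]]].
- by exists 0%N => //; rewrite big_ord0 addr0.
- by rewrite shift => Bk; exists k.+1.
- by rewrite big_ord0 addr0; left.
- by rewrite -shift => Bk; right; apply/IH; exists k.
Qed.

Let walk_event x : [set w | exists n, B (walk X x n w)] = \bigcup_n hit_event n 0 x.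
Proof.
apply/seteqP; split => w /=.
  by move=> [n Bn]; exists n => //; apply/hit_eventP; exists n.
by move=> [n _ /hit_eventP[k _ Bk]]; exists k.
Qed.

Lemma measurable_walk_event x : measurable [set w | exists n, B (walk X x n w)].
Proof. by rewrite walk_event; exact: bigcupT_measurable. Qed.

Lemma hit_cvg x : hit n x @[n --> \oo] --> hit_prob x.
Proof.
have -> : hit ^~ x = P \o (fun n => hit_event n 0 x).
  apply/funext => n /=; have := P_prefix_hit n 0 x (fun=> 0).
  rewrite (_ : prefix 0 _ = setT); last by apply/seteqP; split.
  by rewrite setTI probability_setT mul1e.
rewrite /hit_prob walk_event; apply: nondecreasing_cvg_mu => //.
  exact: bigcupT_measurable.
move=> i j ij; rewrite subsetEset => w /hit_eventP[k ki Bk].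
by apply/hit_eventP; exists k => //; exact: leq_trans ki ij.
Qed.

Let hit_le1 n x : (hit n x <= 1)%E.
Proof.
have := P_prefix_hit n 0 x (fun=> 0).
rewrite (_ : prefix 0 _ = setT); last by apply/seteqP; split.
rewrite setTI probability_setT mul1e => <-; exact: probability_le1.
Qed.

Lemma hit_nondecreasing x : nondecreasing_seq (hit ^~ x).
Proof.
apply/nondecreasing_seqP => n; elim: n x => [|n IH] x.
  rewrite /=; case: ifP => // _.
  by apply: step_op_ge0 => // y; case: ifP.
rewrite [hit n.+2 _]/= [hit n.+1 _]/=; case: ifP => // _.
by apply: le_step_op => // y; exact: hit_ge0.
Qed.

Lemma hit_le_hit_prob n x : (hit n x <= hit_prob x)%E.
Proof.
rewrite -(cvg_lim _ (@hit_cvg x))//; apply: lime_ge.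
  by apply/cvg_ex; exists (hit_prob x); exact: hit_cvg.
by near=> m; apply: hit_nondecreasing; near: m; exact: nbhs_infty_ge.
Unshelve. all: by end_near. Qed.

Lemma hit_prob_le1 x : (hit_prob x <= 1)%E.
Proof. exact/probability_le1/measurable_walk_event. Qed.

Lemma hit_prob_ge0 x : (0 <= hit_prob x)%E.
Proof. exact: measure_ge0. Qed.

Lemma hit_prob_in x : B x -> hit_prob x = 1%E.
Proof.
move=> Bx; apply/eqP; rewrite eq_le hit_prob_le1/=.
by apply: le_trans (hit_le_hit_prob 0 x); rewrite /= mem_set.
Qed.

Lemma stable_step_fin y : stable_step alpha y \is a fin_num.
Proof. by rewrite -(PX 0); apply: fin_num_measure. Qed.

Lemma stable_step_mass : (\esum_(y in [set: lattice d]) stable_step alpha y = 1)%E.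
Proof.
transitivity (\esum_(y in [set: 'rV[int]_d]) P (X 0 @^-1` [set y]))%E.
  by apply: eq_esum => y _; rewrite PX.
rewrite -(@measure_countable_bigcup _ _ _ P 'rV[int]_d)//.
  rewrite (_ : \bigcup_y _ = setT) ?probability_setT//.
  by apply/seteqP; split => // w _; exists (X 0 w).
by move=> y z _ _ [w [/= <- <-]].
Qed.

(** Potentials are superharmonic, so they dominate a multiple of the hitting
    probability of any set on which they are bounded below. *)
Lemma hit_prob_le_green (f : lattice d -> R) (c : R) x :
  (forall y, 0 <= f y) -> 0 <= c ->
  (forall y, B y -> c%:E <= green alpha f y)%E ->
  (c%:E * hit_prob x <= green alpha f x)%E.
Proof.
move=> f0 c0 cB.
have main n y : (c%:E * hit n y <= green alpha f y)%E.
  have bd z : z \in B -> (c%:E * 1 <= green alpha f z)%E.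
    by move=> /set_mem Bz; rewrite mule1; exact: cB.
  elim: n y => [|n IH] y; rewrite /=; case: ifP => [/bd//|_].
    by rewrite mule0; exact: green_ge0.
  rewrite -step_opZ//; last exact: hit_ge0.
  apply: (@le_trans _ _ (step_op (green alpha f) y)).
    by apply: le_step_op => // z; rewrite mule_ge0 ?lee_fin// hit_ge0.
  by rewrite (green_eq _ y f0)// leeDr// lee_fin.
have cv : (c%:E * hit n x @[n --> \oo] --> c%:E * hit_prob x)%E.
  by apply: cvgeZl => //; exact: hit_cvg.
by apply: (cvge_le _ cv); apply: nearW => n; exact: main.
Qed.

(** A potential whose charge sits on B is harmonic off B; as its iterates under
    the walk vanish, it is dominated by its maximum on B times the hitting
    probability. *)
Lemma green_le_hit_prob (f : lattice d -> R) (M : R) x :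
  (forall y, 0 <= f y) -> (forall y, ~ B y -> f y = 0) -> 0 <= M ->
  (forall y, B y -> green alpha f y <= M%:E)%E ->
  (green alpha f x < +oo)%E ->
  (green alpha f x <= M%:E * hit_prob x)%E.
Proof.
move=> f0 fB M0 gM gx.
have it0 n y : (0 <= iter n step_op (green alpha f) y)%E.
  by elim: n y => [|n IH] y; [exact: green_ge0|exact: step_op_ge0].
have main n y : (green alpha f y <= M%:E * hit n y + iter n step_op (green alpha f)
  y)%E.
  have bd k z : z \in B ->
      (green alpha f z <= M%:E * 1 + iter k step_op (green alpha f) z)%E.
    by move=> /set_mem Bz; rewrite mule1 (le_trans (gM _ Bz))// leeDl.
  elim: n y => [|n IH] y; rewrite [hit _ _]/=; case: ifP => [/bd//|yB].
    by rewrite mule0 add0e.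
  rewrite (green_eq _ y f0)// fB ?add0e; last by move/mem_set; rewrite yB.
  rewrite iterS -step_opZ//; last exact: hit_ge0.
  rewrite -step_opD//; last by move=> z; rewrite mule_ge0 ?lee_fin// hit_ge0.
  by apply: le_step_op => // z; exact: green_ge0.
have cv : (M%:E * hit n x + iter n step_op (green alpha f) x @[n --> \oo] -->
    M%:E * hit_prob x + 0)%E.
  apply: cvgeD; [by rewrite fin_num_adde_defl| |exact: iter_step_op_green_cvg].
  by apply: cvgeZl => //; exact: hit_cvg.
rewrite -[leRHS]adde0; apply: (cvge_ge _ cv).
by apply: nearW => n; exact: main.
Qed.

(* Superharmonicity survives the limit in n because it can be tested on finite
   partial sums of the transition operator. *)
Let step_hit_prob x : ~ B x -> (step_op hit_prob x <= hit_prob x)%E.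
Proof.
move=> nBx; apply: ge_ereal_sup => _ [Y [finY _] <-].
rewrite fsbig_finite//=.
have cv : (\sum_(y <- fset_set Y) (stable_step alpha y * hit n (x + y)%R) @[n -->
  \oo] -->
    \sum_(y <- fset_set Y) (stable_step alpha y * hit_prob (x + y)%R))%E.
  apply: cvg_nnesum => y _.
    by apply: nearW => n; rewrite mule_ge0 ?stable_step_ge0// hit_ge0.
  by apply: cvgeZl; [exact: stable_step_fin|exact: hit_cvg].
apply: (cvge_le _ cv); apply: nearW => n.
apply: le_trans (hit_le_hit_prob n.+1 x); rewrite /= memNset//.
by apply: esum_ge; exists Y => //; rewrite fsbig_finite.
Qed.

(** If the hitting probability is bounded below uniformly in the starting point,
    then each return to the complement of B gives a fresh chance of success, and
    B is hit almost surely. *)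
Lemma hit_prob_eq1 (delta : R) : 0 < delta ->
  (forall x, delta%:E <= hit_prob x)%E -> forall x, hit_prob x = 1%E.
Proof.
move=> delta0 low x.
have delta1 : delta <= 1 by rewrite -lee_fin (le_trans (low x))// hit_prob_le1.
(* failing to hit within n steps still leaves a chance of at least delta *)
have main n y : ((1 - delta)%:E * hit n y + delta%:E <= hit_prob y)%E.
  have bd z : z \in B -> ((1 - delta)%:E * 1 + delta%:E <= hit_prob z)%E.
    by move=> /set_mem Bz; rewrite hit_prob_in// mule1 -EFinD subrK.
  elim: n y => [|n IH] y; rewrite /=; case: ifP => [/bd//|yB].
    by rewrite mule0 add0e.
  apply: le_trans (step_hit_prob _); last by move/mem_set; rewrite yB.
  rewrite -step_opZ ?subr_ge0//; last exact: hit_ge0.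
  have -> : delta%:E = step_op (fun=> delta%:E) y.
    by rewrite /step_op esumZr ?stable_step_mass ?mul1e ?lee_fin ?ltW// => z;
      exact: stable_step_ge0.
  rewrite -step_opD//; last 2 first.
  - by move=> z; rewrite mule_ge0 ?hit_ge0// lee_fin subr_ge0.
  - by move=> z; rewrite lee_fin ltW.
  apply: le_step_op => // z; rewrite adde_ge0 ?mule_ge0 ?hit_ge0 ?lee_fin ?subr_ge0//.
  exact: ltW.
have cv : ((1 - delta)%:E * hit n x + delta%:E @[n --> \oo] -->
    (1 - delta)%:E * hit_prob x + delta%:E)%E.
  apply: cvgeD; [by rewrite fin_num_adde_defl| |exact: cvg_cst].
  by apply: cvgeZl => //; exact: hit_cvg.
have : ((1 - delta)%:E * hit_prob x + delta%:E <= hit_prob x)%E.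
  by apply: (cvge_le _ cv); apply: nearW => n; exact: main.
have := hit_prob_le1 x; have := hit_prob_ge0 x.
case: (hit_prob x) => [h||]//; rewrite !lee_fin => h0 h1 hh; congr EFin; apply/eqP;
  rewrite eq_le h1/=.
rewrite -subr_ge0 -(pmulr_rge0 _ delta0); lra.
Qed.

End hitting.

(** * The one-dimensional lazy walk *)

Section lazy_line.
Context {R : realType}.
Implicit Types (n a : nat) (j : int).

(** The probability that a lazy walk on the integers is at a after n steps. *)
Definition line_kernel n a : R := 4^-1 ^+ n * 'C(2 * n, n + a)%:R.

Lemma line_kernel_ge0 n a : 0 <= line_kernel n a.
Proof. by rewrite mulr_ge0// exprn_ge0// invr_ge0. Qed.

Let line_kernelS0 n : line_kernel n.+1 0 =
  4^-1 * (line_kernel n 1 + 2 * line_kernel n 0 + line_kernel n 1).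
Proof.
rewrite /line_kernel exprS.
have -> : 'C(2 * n.+1, n.+1 + 0) = (2 * 'C(2 * n, n + 1) + 2 * 'C(2 * n, n + 0))%N.
  rewrite mulnS addn0 addn1 add2n !binS.
  case: n => [|n]; first by rewrite !bin0.
  have sym : 'C(2 * n.+1, n) = 'C(2 * n.+1, n.+2).
    by rewrite -bin_sub; [congr 'C(_, _); lia|lia].
  by rewrite binS sym addn0; lia.
rewrite (natrD _ (2 * _)%N) !(natrM _ 2); ring.
Qed.

Let line_kernelSS n a : line_kernel n.+1 a.+1 =
  4^-1 * (line_kernel n a + 2 * line_kernel n a.+1 + line_kernel n a.+2).
Proof.
rewrite /line_kernel exprS.
have -> : 'C(2 * n.+1, n.+1 + a.+1) =
    ('C(2 * n, n + a) + 2 * 'C(2 * n, n + a.+1) + 'C(2 * n, n + a.+2))%N.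
  by rewrite mulnS add2n addSn addnS !binS !addnS; lia.
rewrite (natrD _ (_ + _)%N) (natrD _ 'C(_, _)) (natrM _ 2); ring.
Qed.

Lemma line_kernelS n j : line_kernel n.+1 (absz (j)) =
  4^-1 * (line_kernel n (absz (j - 1)) + 2 * line_kernel n (absz (j)) +
          line_kernel n (absz (j + 1))).
Proof.
case: (intP j) => [|m|m].
- by rewrite line_kernelS0 sub0r add0r.
- have -> : (absz (m.+1%:Z - 1)) = m by lia.
  have -> : (absz (m.+1%:Z + 1)) = m.+2 by lia.
  by rewrite -line_kernelSS.
- have -> : (absz (- m.+1%:Z - 1)) = m.+2 by lia.
  have -> : (absz (- m.+1%:Z + 1)) = m by lia.
  rewrite abszN absz_nat line_kernelSS; ring.
Qed.

Let line_kernel_next n a :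
  (n + a).+1%:R * line_kernel n a.+1 = (n - a)%N%:R * line_kernel n a.
Proof.
rewrite /line_kernel !(mulrCA _ (_ ^+ _)) -!natrM; congr (_ * _%:R).
by rewrite addnS mul_bin_left; congr (_ * _)%N; lia.
Qed.

Let line_kernel_ratio n a : (a < n)%N ->
  line_kernel n a.+1 = line_kernel n a * (1 - (2 * a).+1%:R / (n + a).+1%:R).
Proof.
move=> an.
have -> : 1 - (2 * a).+1%:R / (n + a).+1%:R = (n - a)%N%:R / (n + a).+1%:R :> R.
  apply: (@mulIf _ (n + a).+1%:R); first by rewrite pnatr_eq0.
  rewrite mulrBl mul1r !divfK ?pnatr_eq0// -natrB; last by lia.
  by congr _%:R; lia.
rewrite mulrA [_ * (n - a)%N%:R]mulrC -line_kernel_next.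
by rewrite mulrAC mulfV ?mul1r// pnatr_eq0.
Qed.

Lemma line_kernel0S n :
  (2 * n.+1)%:R * line_kernel n.+1 0 = (2 * n).+1%:R * line_kernel n 0.
Proof.
have h := line_kernel_next n 0; move: h; rewrite addn0 subn0 => h.
rewrite line_kernelS0 natrM -[(2 * n).+1%:R]natr1 natrM.
move: h; rewrite -[n.+1%:R]natr1; lra.
Qed.

(** Both bounds on the central value follow from the ratio (2n + 1) / (2n + 2) of
    consecutive values: their squares decay like 1 / n. *)
Lemma line_kernel0_sqr_le n : line_kernel n 0 ^+ 2 <= n.+1%:R^-1.
Proof.
rewrite -div1r ler_pdivlMr//; elim: n => [|n IH].
  by rewrite /line_kernel expr0 bin0 !mulr1.
have rec : line_kernel n.+1 0 = (2 * n).+1%:R / (2 * n.+1)%:R * line_kernel n 0.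
  by rewrite mulrAC -line_kernel0S mulrAC mulfV ?mul1r// pnatr_eq0.
apply: le_trans IH; rewrite rec exprMn mulrAC [leRHS]mulrC ler_wpM2r ?sqr_ge0//.
rewrite expr_div_n mulrAC ler_pdivrMr ?exprn_gt0// -!natrX -!natrM ler_nat; nia.
Qed.

Lemma line_kernel0_sqr_ge n : (4 * n.+1%:R)^-1 <= line_kernel n 0 ^+ 2.
Proof.
case: n => [|n]; first by rewrite /line_kernel expr0 bin0; lra.
apply: (@le_trans _ _ (4 * n.+1%:R)^-1).
  by rewrite lef_pV2 ?posrE// ler_pM2l// ler_nat.
rewrite -div1r ler_pdivrMr//; elim: n => [|n IH].
  by rewrite /line_kernel expr1 (_ : 'C(_, _) = 2%N)//; lra.
have rec : line_kernel n.+2 0 = (2 * n.+1).+1%:R / (2 * n.+2)%:R * line_kernel n.+1 0.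
  by rewrite mulrAC -line_kernel0S mulrAC mulfV ?mul1r// pnatr_eq0.
apply: le_trans IH _;
  rewrite rec [(_ / _ * _) ^+ 2]exprMn [leRHS]mulrAC [leLHS]mulrC ler_wpM2r ?sqr_ge0//.
rewrite expr_div_n mulrAC ler_pdivlMr ?exprn_gt0//.
rewrite -[4]/(4%:R) -!natrX -!natrM ler_nat; nia.
Qed.

(** Off the centre the kernel is a product of factors 1 - (2i + 1) / (n + i + 1),
    each at most exp(- (2i + 1) / (2n + 1)); the exponents add up to a square. *)
Lemma line_kernel_le n a :
  line_kernel n a <= line_kernel n 0 * expR (- (a%:R ^+ 2 / (2 * n).+1%:R)).
Proof.
have [na|an] := ltnP n a.
  rewrite {1}/line_kernel bin_small ?mulr0; last by lia.
  by rewrite mulr_ge0 ?line_kernel_ge0 ?expR_ge0.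
elim: a an => [|a IH] an; first by rewrite expr0n mul0r oppr0 expR0 mulr1.
rewrite line_kernel_ratio//;
  apply: (@le_trans _ _ (line_kernel n a * expR (- ((2 * a).+1%:R / (2 * n).+1%:R)))).
  rewrite ler_wpM2l ?line_kernel_ge0//; apply: le_trans (expR_ge1Dx _).
  rewrite lerD2l lerN2 ler_wpM2l// lef_pV2 ?posrE// ler_nat; lia.
apply: le_trans (ler_wpM2r (expR_ge0 _) (IH (ltnW an))) _.
rewrite -mulrA -expRD ler_wpM2l ?line_kernel_ge0// ler_expR.
rewrite -opprD -mulrDl lerN2 ler_wpM2r ?invr_ge0//.
by rewrite -!natrX -natrD ler_nat; lia.
Qed.

(** The same factors bound the product from below, by Bernoulli's inequality. *)
Lemma line_kernel_ge n a :
  line_kernel n 0 * (1 - a%:R ^+ 2 / n.+1%:R) <= line_kernel n a.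
Proof.
have [na|an] := ltnP n a.
  apply: le_trans (line_kernel_ge0 _ _).
  rewrite mulr_ge0_le0 ?line_kernel_ge0// subr_le0 ler_pdivlMr// mul1r -natrX ler_nat.
  nia.
elim: a an => [|a IH] an; first by rewrite expr0n mul0r subr0 mulr1.
have step0 : 0 <= 1 - (2 * a).+1%:R / (n + a).+1%:R :> R.
  by rewrite subr_ge0 ler_pdivrMr// mul1r ler_nat; lia.
rewrite line_kernel_ratio//; apply: le_trans (ler_wpM2r step0 (IH (ltnW an))).
rewrite -[leRHS]mulrA ler_wpM2l ?line_kernel_ge0//.
have h1 : (2 * a).+1%:R / (n + a).+1%:R <= (2 * a).+1%:R / n.+1%:R :> R.
  by rewrite ler_wpM2l// lef_pV2 ?posrE// ler_nat; lia.
have h2 : a.+1%:R ^+ 2 / n.+1%:R = a%:R ^+ 2 / n.+1%:R + (2 * a).+1%:R / n.+1%:R :> R.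
  by rewrite -mulrDl -!natrX -natrD; congr (_%:R / _); lia.
have h3 : 0 <= a%:R ^+ 2 / n.+1%:R :> R by rewrite divr_ge0// sqr_ge0.
have h4 : 0 <= (2 * a).+1%:R / (n + a).+1%:R :> R by rewrite divr_ge0.
have gen (A C D : R) : D <= C -> 0 <= A -> 0 <= D -> 1 - (A + C) <= (1 - A) * (1 - D).
  by move=> DC A0 D0; have := mulr_ge0 A0 D0; lra.
by rewrite h2; exact: gen.
Qed.

End lazy_line.

(** * Occupation numbers of uniform draws *)

Section occupation.
Context {R : realType} {d : nat}.
Hypothesis d0 : (0 < d)%N.
Implicit Types (F G H : ('I_d -> nat) -> R) (n : 'I_d -> nat) (i j : 'I_d).

Definition add_draw i n : 'I_d -> nat := fun j => (n j + (j == i))%N.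

(** The mean of F over the vector counting how often each of the d indices occurs
    among k independent uniform draws. *)
Fixpoint occ_mean k F : R :=
  if k is l.+1 then d%:R^-1 * \sum_i occ_mean l (fun n => F (add_draw i n))
  else F (fun=> 0%N).

Arguments occ_mean : simpl never.

Lemma occ_meanS k F :
  occ_mean k.+1 F = d%:R^-1 * \sum_i occ_mean k (fun n => F (add_draw i n)).
Proof. by []. Qed.

Let dR0 : d%:R != 0 :> R. Proof. by rewrite pnatr_eq0 -lt0n. Qed.

Lemma occ_meanD k F G :
  occ_mean k (fun n => F n + G n) = occ_mean k F + occ_mean k G.
Proof.
elim: k F G => [//|k IH] F G; rewrite !occ_meanS.
by rewrite -mulrDr -big_split/=; congr (_ * _); apply: eq_bigr => i _; rewrite IH.
Qed.

Lemma occ_meanZ k c F : occ_mean k (fun n => c * F n) = c * occ_mean k F.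
Proof.
elim: k F => [//|k IH] F; rewrite !occ_meanS mulrCA; congr (_ * _).
by rewrite mulr_sumr; apply: eq_bigr => i _; rewrite IH.
Qed.

Lemma occ_mean_sum k (F_ : 'I_d -> ('I_d -> nat) -> R) :
  occ_mean k (fun n => \sum_i F_ i n) = \sum_i occ_mean k (F_ i).
Proof.
elim: k F_ => [//|k IH] F_; rewrite occ_meanS.
under [RHS]eq_bigr do rewrite occ_meanS.
rewrite -mulr_sumr exchange_big/=; congr (_ * _).
by apply: eq_bigr => i _; rewrite IH.
Qed.

Lemma occ_mean_cst k c : occ_mean k (fun=> c) = c.
Proof.
elim: k => [//|k IH];
  rewrite occ_meanS IH sumr_const card_ord -[c *+ d]mulr_natl mulKf//.
Qed.

Lemma le_occ_mean k F G :
  (forall n, (\sum_i n i = k)%N -> F n <= G n) -> occ_mean k F <= occ_mean k G.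
Proof.
elim: k F G => [|k IH] F G FG; first by apply: FG; rewrite big1.
rewrite !occ_meanS ler_wpM2l ?invr_ge0//; apply: ler_sum => i _; apply: IH => n nk.
apply: FG; rewrite big_split/= nk (bigD1 i)//= eqxx big1 ?addn0 ?addn1// => j /negPf ->.
by [].
Qed.

Lemma eq_occ_mean k F G : (forall n, F n = G n) -> occ_mean k F = occ_mean k G.
Proof. by move=> /funext ->. Qed.

Lemma add_drawC i j n : add_draw i (add_draw j n) = add_draw j (add_draw i n).
Proof. by apply/funext => l; rewrite /add_draw addnAC. Qed.

(** Size biasing: marking one of the k.+1 draws and requiring it to be i leaves k
    uniform draws. *)
Lemma occ_mean_size_bias k i H :
  occ_mean k.+1 (fun n => (n i)%:R * H n) =
  k.+1%:R / d%:R * occ_mean k (fun n => H (add_draw i n)).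
Proof.
elim: k H => [|k IH] H.
  rewrite occ_meanS /occ_mean (bigD1 i)//= big1 ?addr0;
    first by rewrite {1}/add_draw eqxx add0n mulr1n !mul1r.
  by move=> j /negPf; rewrite {1}/add_draw eq_sym => ->; rewrite mul0r.
have step j : occ_mean k.+1 (fun n => (add_draw j n i)%:R * H (add_draw j n)) =
    k.+1%:R / d%:R * occ_mean k (fun n => H (add_draw i (add_draw j n))) +
    (i == j)%:R * occ_mean k.+1 (fun n => H (add_draw j n)).
  rewrite (@eq_occ_mean _ _ (fun n => (n i)%:R * H (add_draw j n) +
      (i == j)%:R * H (add_draw j n))); last by move=> n;
        rewrite /add_draw natrD mulrDl.
  rewrite occ_meanD occ_meanZ IH; congr (_ * _ + _).
  by apply: eq_occ_mean => n; rewrite add_drawC.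
rewrite occ_meanS.
have -> : \sum_j occ_mean k.+1 (fun n => (add_draw j n i)%:R * H (add_draw j n)) =
    k.+1%:R / d%:R * (d%:R * occ_mean k.+1 (fun n => H (add_draw i n))) +
    occ_mean k.+1 (fun n => H (add_draw i n)).
  rewrite (eq_bigr _ (fun j _ => step j)) big_split/= -mulr_sumr; congr (_ * _ + _).
    by rewrite mulrA mulfV// mul1r; apply: eq_bigr => j _; apply: eq_occ_mean => n;
      rewrite add_drawC.
  rewrite (bigD1 i)//= eqxx mul1r big1 ?addr0// => j /negPf; rewrite eq_sym => ->.
  by rewrite mul0r.
rewrite -[k.+2%:R]natr1; field.
exact: dR0.
Qed.

(** Inverse occupation numbers are removed by size biasing backwards: 1 / (n i + 1)
    is 1 / n i seen after adding the draw i. *)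
Lemma occ_mean_biased_le k i H F :
  (forall n, (n i)%:R * H n <= F n) ->
  occ_mean k (fun n => H (add_draw i n)) <= d%:R / k.+1%:R * occ_mean k.+1 F.
Proof.
move=> HF; apply: (@le_trans _ _ (d%:R / k.+1%:R *
    occ_mean k.+1 (fun n => (n i)%:R * H n))).
  by rewrite occ_mean_size_bias mulrA mulrA divfK ?pnatr_eq0// mulfV// mul1r.
by rewrite ler_wpM2l ?divr_ge0//; apply: le_occ_mean.
Qed.

(** On average the product of the 1 / (n i + 1) is as small as if the k draws were
    spread evenly over the d indices. *)
Lemma occ_mean_prod_inv_le k (J : {set 'I_d}) :
  occ_mean k (fun n => \prod_(i in J) (n i).+1%:R^-1) <= (d%:R / k.+1%:R) ^+ #|J|.
Proof.
move Jm : #|J| => m; elim: m J k Jm => [|m IH] J k.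
  move/eqP; rewrite cards_eq0 => /eqP ->; rewrite expr0.
  rewrite (@eq_occ_mean _ _ (fun=> 1)) ?occ_mean_cst// => n.
  by rewrite big_set0.
move=> Jm; have /card_gt0P[i iJ] : (0 < #|J|)%N by rewrite Jm.
have Jim : #|J :\ i| = m by move: Jm; rewrite (cardsD1 i) iJ add1n => -[].
pose H n := (n i)%:R^-1 * \prod_(j in J :\ i) (n j).+1%:R^-1 : R.
rewrite (@eq_occ_mean _ _ (fun n => H (add_draw i n))); last first.
  move=> n; rewrite (big_setD1 i)//= /H /add_draw eqxx addn1; congr (_ * _).
  by apply: eq_bigr => j; rewrite !inE => /andP[/negPf -> _]; rewrite addn0.
apply: le_trans (@occ_mean_biased_le _ i _
    (fun n => \prod_(j in J :\ i) (n j).+1%:R^-1) _) _.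
  move=> n; rewrite /H mulrA; have [->|ni] := eqVneq (n i) 0%N.
    by rewrite !mul0r prodr_ge0// => j _; rewrite invr_ge0.
  by rewrite mulfV ?mul1r// pnatr_eq0.
rewrite exprS ler_wpM2l ?divr_ge0//; apply: le_trans (IH _ _ Jim) _.
rewrite lerXn2r ?nnegrE ?divr_ge0// ler_wpM2l// lef_pV2 ?posrE//.
by rewrite ler_nat.
Qed.

Lemma occ_mean_inv_sqr_le k i :
  occ_mean k (fun n => (n i).+1%:R^-1 ^+ 2) <= 2 * (d%:R / k.+1%:R) ^+ 2.
Proof.
pose H n := 2 * ((n i)%:R^-1 * (n i).+1%:R^-1) : R.
apply: (@le_trans _ _ (occ_mean k (fun n => H (add_draw i n)))).
  apply: le_occ_mean => n _; rewrite /H /add_draw eqxx addn1 expr2 mulrCA.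
  rewrite ler_wpM2l ?invr_ge0// ler_pdivlMr// mulrC ler_pdivrMr// -natrM ler_nat; lia.
apply: le_trans (@occ_mean_biased_le _ i _
    (fun n => 2 * \prod_(j in [set i]%SET) (n j).+1%:R^-1) _) _.
  move=> n; rewrite big_set1 /H; have [->|ni] := eqVneq (n i) 0%N.
    by rewrite mul0r mulr_ge0// invr_ge0.
  by rewrite mulrCA ler_pM2l// mulrA mulfV ?mul1r// pnatr_eq0.
rewrite occ_meanZ mulrCA ler_wpM2l// expr2 ler_wpM2l ?divr_ge0//.
apply: le_trans (occ_mean_prod_inv_le _ _) _; rewrite cards1 expr1.
by rewrite ler_wpM2l// lef_pV2 ?posrE// ler_nat.
Qed.

End occupation.

(** * Gaussian bounds for the lazy walk *)

Section lazy_walk.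
Context {R : realType} {d : nat}.
Hypothesis d0 : (0 < d)%N.
Implicit Types (u : lattice d -> R) (x y : lattice d) (n : 'I_d -> nat).

(** The lazy walk is free of the parity obstruction of the simple walk, and its
    coordinates move like one-dimensional lazy walks. *)
Definition lazy u x : R := 2^-1 * (u x + avg u x).

Definition lazy_kernel k x : R := iter k lazy delta x.

Definition snorm x : nat := (\max_(i < d) absz (coord x i))%N.

Let line_product n x : R := \prod_(i < d) line_kernel (n i) (absz (coord x i)).

Let dR0 : d%:R != 0 :> R. Proof. by rewrite pnatr_eq0 -lt0n. Qed.

Lemma coordD x y i : coord (x + y) i = coord x i + coord y i.
Proof. by rewrite /coord mxE. Qed.

Lemma coordN x i : coord (- x) i = - coord x i.
Proof. by rewrite /coord mxE. Qed.

Lemma coord_unit (i j : 'I_d) : coord (unit_vector i) j = (j == i)%:R :> int.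
Proof. by rewrite /coord mxE. Qed.

Lemma coord_le_snorm x i : (absz (coord x i) <= snorm x)%N.
Proof. exact: (@leq_bigmax _ (fun i => absz (coord x i))). Qed.

Let lazyE u x : lazy u x = d%:R^-1 *
  \sum_i 4^-1 * (u (x - unit_vector i) + 2 * u x + u (x + unit_vector i)).
Proof.
have -> : \sum_i 4^-1 * (u (x - unit_vector i) + 2 * u x + u (x + unit_vector i)) =
    d%:R * (2^-1 * u x) +
    4^-1 * \sum_i (u (x + unit_vector i) + u (x - unit_vector i)).
  have -> : d%:R * (2^-1 * u x) = \sum_(i < d) 2^-1 * u x.
    by rewrite sumr_const card_ord mulr_natl.
  rewrite mulr_sumr -big_split/=.
  by apply: eq_bigr => i _; lra.
rewrite /lazy /avg natrM; field; exact: dR0.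
Qed.

Let line_product_draw i n x : line_product (add_draw i n) x =
  4^-1 * (line_product n (x - unit_vector i) + 2 * line_product n x +
          line_product n (x + unit_vector i)).
Proof.
have D1 y : (forall j, j != i -> coord y j = coord x j) -> line_product n y =
    line_kernel (n i) (absz (coord y i)) *
    \prod_(j < d | j != i) line_kernel (n j) (absz (coord x j)).
  by move=> yx; rewrite /line_product (bigD1 i)//=; congr (_ * _);
    apply: eq_bigr => j /yx ->.
rewrite !D1//; last 2 first.
- by move=> j /negPf ji; rewrite coordD coord_unit ji addr0.
- by move=> j /negPf ji; rewrite coordD coordN coord_unit ji subr0.
rewrite /line_product (bigD1 i)//= /add_draw eqxx addn1 line_kernelS.
rewrite !coordD coordN coord_unit eqxx.
rewrite (eq_bigr (fun j => line_kernel (n j) (absz (coord x j)))); first by ring.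
by move=> j /negPf ->; rewrite addn0.
Qed.

(** A lazy step picks a coordinate uniformly and moves it by a one-dimensional lazy
    step, so given the occupation numbers the coordinates are independent. *)
Lemma lazy_kernelE k x : lazy_kernel k x =
  occ_mean k (fun n => \prod_(i < d) line_kernel (n i) (absz (coord x i))).
Proof.
rewrite -[RHS]/(occ_mean k (line_product ^~ x)).
elim: k x => [|k IH] x.
  rewrite /lazy_kernel /occ_mean /= /delta /line_product.
  have [->|x0] := eqVneq x 0.
    by rewrite big1// => i _; rewrite /coord mxE /line_kernel expr0 mul1r bin0.
  have [i xi] : exists i, coord x i != 0.
    apply/existsP; apply: contraNT x0; rewrite negb_exists => /forallP h.
    by apply/eqP/rowP => i; rewrite [RHS]mxE; have := h i; rewrite negbK => /eqP.
  rewrite (bigD1 i)//= /line_kernel bin_small ?mulr0 ?mul0r//.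
  by rewrite muln0 add0n absz_gt0.
rewrite occ_meanS -[LHS]/(lazy (lazy_kernel k) x) lazyE; congr (_ * _).
apply: eq_bigr => i _; rewrite !IH -!occ_meanZ -!occ_meanD -!occ_meanZ.
by apply: eq_occ_mean => n; rewrite line_product_draw.
Qed.

Lemma lazy_kernel_ge0 k x : 0 <= lazy_kernel k x.
Proof.
rewrite lazy_kernelE -(@occ_mean_cst R d d0 k 0); apply: le_occ_mean => // n _.
by apply: prodr_ge0 => i _; exact: line_kernel_ge0.
Qed.

(** The on-diagonal decay of the kernel. *)
Definition diag_decay k : R := k.+1%:R `^ (- (d%:R / 2)).

Lemma diag_decay_gt0 k : 0 < diag_decay k.
Proof. by rewrite powR_gt0. Qed.

(** The constant in front of the diagonal decay, of order d^(d/2) because each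
    coordinate only receives a share 1/d of the steps. *)
Definition dim_const : R := d%:R `^ (d%:R / 2).

Lemma dim_const_gt0 : 0 < dim_const.
Proof. by rewrite powR_gt0// ltr0n. Qed.

Let sqr_half_power (a : R) : 0 <= a -> (a `^ (d%:R / 2)) ^+ 2 = a ^+ d.
Proof.
by move=> a0; rewrite -powR_mulrn ?powR_ge0// -powRrM divfK// powR_mulrn.
Qed.

Let diag_decay_sqr k : diag_decay k ^+ 2 = (k.+1%:R ^+ d)^-1.
Proof. by rewrite /diag_decay powRN exprVn sqr_half_power. Qed.

Let scale k := dim_const * diag_decay k.

Let scale_gt0 k : 0 < scale k.
Proof. by rewrite mulr_gt0 ?dim_const_gt0 ?diag_decay_gt0. Qed.

Let scale_sqr k : scale k ^+ 2 = (d%:R / k.+1%:R) ^+ d.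
Proof. by rewrite exprMn diag_decay_sqr sqr_half_power// expr_div_n. Qed.

Let central n : R := \prod_(i < d) line_kernel (n i) 0.

Let central_ge0 n : 0 <= central n.
Proof. by apply: prodr_ge0 => i _; exact: line_kernel_ge0. Qed.

Let central_sqr_le n : central n ^+ 2 <= \prod_(i < d) (n i).+1%:R^-1.
Proof.
rewrite /central -prodrXl; apply: ler_prod => i _.
by rewrite sqr_ge0 line_kernel0_sqr_le.
Qed.

Let mean_inv k : occ_mean k (fun n => \prod_(i < d) (n i).+1%:R^-1) <= scale k ^+ 2.
Proof.
rewrite scale_sqr; have := @occ_mean_prod_inv_le R d d0 k [set: 'I_d]%SET.
rewrite cardsT card_ord; apply: le_trans; apply: le_occ_mean => // n _.
by rewrite le_eqVlt; apply/orP; left; apply/eqP; apply: eq_bigl => i; rewrite inE.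
Qed.

Let amgm_le (c z m Y : R) : 0 < m -> c ^+ 2 <= Y ->
  c * z <= (2 * m)^-1 * Y + m / 2 * z ^+ 2.
Proof.
move=> m0 cY; have m1 : m != 0 by rewrite gt_eqF.
have -> : c * z = (2 * m)^-1 * (2 * (c * (m * z))) by field.
have -> : m / 2 * z ^+ 2 = (2 * m)^-1 * (m * z) ^+ 2 by field.
rewrite -mulrDr ler_wpM2l ?invr_ge0 ?mulr_ge0 ?(ltW m0)//.
by have := sqr_ge0 (c - m * z); rewrite sqrrB mulr2n; lra.
Qed.

(* the bound on the second moment turns into one on the first by the inequality
   between arithmetic and geometric means *)
Let mean_central_le k : occ_mean k central <= scale k.
Proof.
have sk := scale_gt0 k; have sn : scale k != 0 by rewrite gt_eqF.
apply: (@le_trans _ _ (occ_mean k (fun n => (2 * scale k)^-1 *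
    \prod_(i < d) (n i).+1%:R^-1 + scale k / 2))).
  apply: le_occ_mean => // n _.
  by have := amgm_le 1 sk (central_sqr_le n); rewrite expr1n !mulr1.
rewrite occ_meanD occ_mean_cst// occ_meanZ.
have i0 : 0 <= (2 * scale k)^-1 by rewrite invr_ge0 mulr_ge0// ltW.
have h := ler_wpM2l i0 (mean_inv k).
apply: le_trans (lerD h (lexx _)) _.
have -> // : (2 * scale k)^-1 * scale k ^+ 2 + scale k / 2 = scale k by field.
Qed.

(** Given the occupation numbers, the coordinate realizing the maximum norm gives
    the Gaussian factor and all coordinates together the diagonal decay. *)
Lemma lazy_kernel_le k x : lazy_kernel k x <=
  dim_const * diag_decay k * expR (- ((snorm x)%:R ^+ 2 / (2 * k.+1)%:R)).
Proof.
have [|i xi] := @bigop.eq_bigmax 'I_d (fun i => absz (coord x i)).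
  by rewrite card_ord.
rewrite -/(snorm x) in xi.
rewrite lazy_kernelE -/(scale k).
apply: (@le_trans _ _ (expR (- ((snorm x)%:R ^+ 2 / (2 * k.+1)%:R)) * occ_mean k
  central)).
  rewrite -occ_meanZ; apply: le_occ_mean => // n nk.
  have nik : (n i <= k)%N by rewrite -nk (bigD1 i)//= leq_addr.
  rewrite /central (bigD1 i)//= [in leRHS](bigD1 i)//= mulrA; apply: ler_pM.
  - exact: line_kernel_ge0.
  - by apply: prodr_ge0 => j _; exact: line_kernel_ge0.
  - rewrite [leRHS]mulrC xi; apply: le_trans (line_kernel_le _ _) _.
    rewrite ler_wpM2l ?line_kernel_ge0// ler_expR lerN2 ler_wpM2l ?sqr_ge0//.
    by rewrite lef_pV2 ?posrE// ler_nat; lia.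
  - apply: ler_prod => j _; rewrite line_kernel_ge0/=.
    apply: le_trans (line_kernel_le _ _) _.
    by rewrite ler_piMr ?line_kernel_ge0// expR_le1 oppr_le0 divr_ge0 ?sqr_ge0.
by rewrite mulrC (ler_wpM2r (expR_ge0 _) (mean_central_le k)).
Qed.

Let mean_central_ge k : 2 ^- d * diag_decay k <= occ_mean k central.
Proof.
rewrite -(@occ_mean_cst R d d0 k (2 ^- d * _)); apply: le_occ_mean => // n nk.
rewrite -(@ler_pXn2r _ 2)// ?nnegrE; last 2 first.
- by rewrite mulr_ge0 ?invr_ge0 ?exprn_ge0// ltW// diag_decay_gt0.
- exact: central_ge0.
rewrite exprMn diag_decay_sqr.
have -> : 2 ^- d ^+ 2 * (k.+1%:R ^+ d)^-1 = \prod_(i < d) (4 * k.+1%:R)^-1 :> R.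
  rewrite prodr_const card_ord [RHS]exprVn exprMn invfM; congr (_ * _).
  rewrite exprVn; congr (_^-1); rewrite -exprM mulnC exprM; congr (_ ^+ _).
  by rewrite expr2; lra.
rewrite /central -prodrXl; apply: ler_prod => i _.
rewrite invr_ge0 mulr_ge0//=; apply: le_trans (line_kernel0_sqr_ge _).
rewrite lef_pV2 ?posrE ?mulr_gt0// ler_pM2l// ler_nat ltnS.
by rewrite -nk (bigD1 i)//= leq_addr.
Qed.

Let mean_central_inv_le k i :
  occ_mean k (fun n => central n * (n i).+1%:R^-1) <=
  2 * d%:R * scale k / k.+1%:R.
Proof.
pose t := scale k * k.+1%:R / d%:R.
have t0 : 0 < t by rewrite divr_gt0 ?ltr0n// mulr_gt0 ?scale_gt0.
apply: (@le_trans _ _ (occ_mean k (fun n => (2 * t)^-1 *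
    \prod_(i < d) (n i).+1%:R^-1 + t / 2 * (n i).+1%:R^-1 ^+ 2))).
  by apply: le_occ_mean => // n _; apply: amgm_le => //; exact: central_sqr_le.
rewrite occ_meanD !occ_meanZ.
have i1 : 0 <= (2 * t)^-1 by rewrite invr_ge0 mulr_ge0// ltW.
have i2 : 0 <= t / 2 by rewrite divr_ge0// ltW.
have h1 := ler_wpM2l i1 (mean_inv k).
have h2 := ler_wpM2l i2 (@occ_mean_inv_sqr_le R d d0 k i).
apply: le_trans (lerD h1 h2) _.
have sn : scale k != 0 by rewrite gt_eqF.
have kn : k.+1%:R != 0 :> R by rewrite pnatr_eq0.
have -> : (2 * t)^-1 * scale k ^+ 2 + t / 2 * (2 * (d%:R / k.+1%:R) ^+ 2) =
    3 / 2 * (d%:R * scale k / k.+1%:R).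
  by rewrite /t; field; rewrite ?dR0 ?sn ?andbT; rewrite -natr1 in kn.
have : 0 <= d%:R * scale k / k.+1%:R.
  by apply: divr_ge0 => //; apply: mulr_ge0 => //; exact: ltW.
have -> : 2 * d%:R * scale k / k.+1%:R = 2 * (d%:R * scale k / k.+1%:R).
  by rewrite !mulrA.
by set w := d%:R * _ / _; lra.
Qed.

Let prod1B_ge (a : 'I_d -> R) : (forall i, 0 <= a i <= 1) ->
  1 - \sum_i a i <= \prod_i (1 - a i).
Proof.
move=> a01.
suff /and4P[] : [&& 0 <= \sum_i a i, 0 <= \prod_i (1 - a i),
    \prod_i (1 - a i) <= 1 & 1 - \sum_i a i <= \prod_i (1 - a i)] by [].
apply: (big_rec2 (fun p q => [&& 0 <= q, 0 <= p, p <= 1 & 1 - q <= p])).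
  by rewrite subr0 lexx ler01 lexx.
move=> i p q _ /and4P[q0 p0 p1 pq]; have /andP[ai0 ai1] := a01 i.
have h := mulr_ge0 ai0 p0; have h' : a i * p <= a i by rewrite ler_piMr.
by apply/and4P; split; [rewrite addr_ge0|rewrite mulr_ge0 ?subr_ge0|lra|lra].
Qed.

Let line_product_ge n x : central n - (snorm x)%:R ^+ 2 *
  \sum_i central n * (n i).+1%:R^-1 <= line_product n x.
Proof.
pose a i : R := (absz (coord x i))%:R ^+ 2 / (n i).+1%:R.
have a0 i : 0 <= a i by rewrite divr_ge0 ?sqr_ge0.
have lp0 : 0 <= line_product n x.
  by apply: prodr_ge0 => i _; exact: line_kernel_ge0.
apply: (@le_trans _ _ (central n * (1 - \sum_i a i))).
  rewrite mulrBr mulr1 lerD2l lerN2 -mulr_sumr mulrCA.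
  apply: ler_wpM2l; first exact: central_ge0.
  rewrite mulr_sumr; apply: ler_sum => i _.
  rewrite ler_wpM2r ?invr_ge0// lerXn2r ?nnegrE// ler_nat.
  exact: coord_le_snorm.
have [/forallP a1|/forallPn[i]] := boolP [forall i, a i <= 1]; last first.
  rewrite -ltNge => ai1; apply: le_trans lp0; apply: mulr_ge0_le0;
    first exact: central_ge0.
  rewrite subr_le0 (bigD1 i)//=; apply: (le_trans (ltW ai1)).
  by rewrite lerDl sumr_ge0.
apply: (@le_trans _ _ (\prod_i (line_kernel (n i) 0 * (1 - a i)))).
  rewrite big_split/=; apply: ler_wpM2l; first exact: central_ge0.
  by apply: prod1B_ge => i; rewrite a0 a1.
apply: ler_prod => i _; rewrite mulr_ge0 ?line_kernel_ge0 ?subr_ge0//=.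
exact: line_kernel_ge.
Qed.

(** The error made by replacing each coordinate by its central value is of relative
    size |x|^2 / k, hence harmless as soon as k exceeds a multiple of |x|^2. *)
Lemma lazy_kernel_ge : exists2 A : nat, (0 < A)%N & forall k x,
  (A * snorm x ^ 2 <= k.+1)%N -> 2 ^- d.+1 * diag_decay k <= lazy_kernel k x.
Proof.
pose c : R := 2 ^+ d.+1 * (2 * d%:R ^+ 2 * dim_const).
have c0 : 0 <= c by rewrite !mulr_ge0 ?exprn_ge0// ltW// dim_const_gt0.
exists (Num.bound c) => // k x Ak.
have cA : c * (snorm x)%:R ^+ 2 <= k.+1%:R.
  apply: (@le_trans _ _ ((Num.bound c)%:R * (snorm x)%:R ^+ 2)).
    by rewrite ler_wpM2r ?sqr_ge0// ltW// archi_boundP.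
  by rewrite -natrX -natrM ler_nat.
rewrite lazy_kernelE.
apply: (@le_trans _ _ (occ_mean k (fun n => central n +
    (- (snorm x)%:R ^+ 2) * \sum_i central n * (n i).+1%:R^-1))); last first.
  by apply: le_occ_mean => // n _; rewrite mulNr; exact: line_product_ge.
rewrite occ_meanD occ_meanZ occ_mean_sum mulNr.
have sum_le : \sum_i occ_mean k (fun n => central n * (n i).+1%:R^-1) <=
    d%:R * (2 * d%:R * scale k / k.+1%:R).
  apply: (@le_trans _ _ (\sum_(i < d) 2 * d%:R * scale k / k.+1%:R)).
    by apply: ler_sum => i _; exact: mean_central_inv_le.
  by rewrite sumr_const card_ord [leRHS]mulr_natl.
have main : (snorm x)%:R ^+ 2 * (d%:R * (2 * d%:R * scale k / k.+1%:R)) <=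
    2 ^- d.+1 * diag_decay k.
  have -> : (snorm x)%:R ^+ 2 * (d%:R * (2 * d%:R * scale k / k.+1%:R)) =
      2 ^- d.+1 * diag_decay k * (c * (snorm x)%:R ^+ 2 / k.+1%:R).
    have kn : k.+1%:R != 0 :> R by rewrite pnatr_eq0.
    have en : 2 ^+ d.+1 != 0 :> R by rewrite expf_neq0.
    rewrite /c /scale; move: kn en.
    by move: (k.+1%:R : R) (2 ^+ d.+1 : R) => K E K0 E0; field; rewrite K0.
  rewrite ler_piMr//.
    by rewrite mulr_ge0 ?invr_ge0 ?exprn_ge0// ltW// diag_decay_gt0.
  by rewrite ler_pdivrMr// mul1r.
have two : 2 ^- d * diag_decay k = 2 ^- d.+1 * diag_decay k + 2 ^- d.+1 * diag_decay k.
  have en : 2 ^+ d != 0 :> R by rewrite expf_neq0.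
  by rewrite exprS; move: en; move: (2 ^+ d : R) => E E0; field.
have := mean_central_ge k; have := ler_wpM2l (sqr_ge0 (snorm x)%:R) sum_le.
rewrite two; move: main.
have gen (p q r m : R) : p <= q -> r <= p -> q + q <= m -> q <= m - r by lra.
exact: gen.
Qed.

End lazy_walk.

(** * Comparison of the Green functions of the simple and of the lazy walk *)

Section lazy_comparison.
Context {R : realType}.

(** The probability that, among k fair coin tosses, j succeed. *)
Let coin j k : R := 2 ^- k * 'C(k, j)%:R.

Let coin_ge0 j k : 0 <= coin j k.
Proof. by rewrite mulr_ge0 ?invr_ge0 ?exprn_ge0. Qed.

Let coin_ge0E j k : (0 <= (coin j k)%:E)%E.
Proof. by rewrite lee_fin. Qed.

Let coin0 j : coin j 0 = (j == 0)%:R.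
Proof. by rewrite /coin expr0 invr1 mul1r bin0n eq_sym. Qed.

Let coin0S k : coin 0 k.+1 = 2^-1 * coin 0 k.
Proof. by rewrite /coin !bin0 !mulr1 exprS invfM. Qed.

Let coinSS j k : coin j.+1 k.+1 = 2^-1 * coin j.+1 k + 2^-1 * coin j k.
Proof. by rewrite /coin binS natrD exprS invfM; ring. Qed.

(** In an unbounded sequence of fair tosses, the number of successes stays equal to
    j during two tosses on average. *)
Let coin_mass j : (\esum_(k in [set: nat]) (coin j k)%:E = 2%:E)%E.
Proof.
have partial n i : \sum_(0 <= k < n) coin i k <= 2.
  elim: n i => [|n IH] [|i]; rewrite ?big_nil// big_nat_recl// coin0/=.
    under eq_bigr do rewrite coin0S; rewrite -mulr_sumr; have := IH 0%N; lra.
  under eq_bigr do rewrite coinSS; rewrite big_split/= -!mulr_sumr.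
  by have := IH i; have := IH i.+1; lra.
have fin i : \esum_(k in [set: nat]) (coin i k)%:E \is a fin_num.
  rewrite ge0_fin_numE ?esum_ge0//; apply: (@le_lt_trans _ _ 2%:E); last exact: ltry.
  by apply: esum_le_partial => // n; rewrite sumEFin lee_fin.
have half (a : \bar R) : (0 <= a)%E -> a \is a fin_num -> forall b : R,
    (a = b%:E + (2^-1)%:E * a)%E -> a = (2 * b)%:E.
  by case: a => // a _ _ b [] ab; congr EFin; lra.
elim: j => [|j IH].
  rewrite -(mulr1 2); apply: half => //; first exact: esum_ge0.
  rewrite {1}esum_recl// coin0/= -esumZl// ?lee_fin ?invr_ge0//.
  by congr (_ + _)%E; apply: eq_esum => k _; rewrite coin0S EFinM.
rewrite -(mulr1 2); apply: half => //; first exact: esum_ge0.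
rewrite {1}esum_recl// coin0/= add0e.
under eq_esum do rewrite coinSS EFinD !EFinM.
rewrite esumD; last 2 first.
- by move=> k _; rewrite mule_ge0 ?lee_fin ?invr_ge0.
- by move=> k _; rewrite mule_ge0 ?lee_fin ?invr_ge0.
rewrite !esumZl ?lee_fin ?invr_ge0// IH addeC; congr (_ + _)%E.
by rewrite -EFinM mulVf.
Qed.

Variable s : R.
Hypothesis hs : 0 < s < 1.

Let b0 k : 0 <= green_coef s k.
Proof. by rewrite ltW// green_coef_gt0//; case/andP: hs. Qed.

(** The coefficient of the j-step kernel of the simple walk in the Green series of
    the lazy walk. *)
Let thinned_coef j : \bar R :=
  (\esum_(k in [set: nat]) (green_coef s k * coin j k)%:E)%E.

Let thinned_coef_ge0 j : (0 <= thinned_coef j)%E.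
Proof. by apply: esum_ge0 => k _; rewrite lee_fin mulr_ge0. Qed.

Let thinned_coef_le j : (thinned_coef j <= (2 * green_coef s j)%:E)%E.
Proof.
rewrite mulrC EFinM -(coin_mass j) -esumZl ?lee_fin//.
apply: le_esum => k _; rewrite -EFinM lee_fin.
have [jk|kj] := leqP j k; first by rewrite ler_wpM2r// green_coef_noninc.
by rewrite /coin bin_small// !mulr0.
Qed.

(* b_k is at least of order k^s / k, where k^s only gets smaller when k is replaced
   by j, and the weight 1 / k is summed by k binom(k - 1, j - 1) = j binom(k, j) *)
Let thinned_coef_ge j : ((s / 2 * green_coef s j)%:E <= thinned_coef j)%E.
Proof.
case/andP: (hs) => s0 s1; case: j => [|j].
  rewrite /thinned_coef esum_recl; last by move=> k; rewrite lee_fin mulr_ge0.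
  rewrite coin0 [green_coef s 0]/= !mulr1; apply: (@le_trans _ _ 1%:E).
    by rewrite lee_fin; lra.
  by rewrite leeDl// esum_ge0// => k _; rewrite lee_fin mulr_ge0.
pose c : R := s / 4 * j.+2%:R `^ s / j.+1%:R.
have c0 : 0 <= c by rewrite /c divr_ge0// mulr_ge0 ?powR_ge0//; lra.
apply: (@le_trans _ _ (c%:E * 2%:E)%E).
  rewrite -EFinM lee_fin; apply: (@le_trans _ _ (s / 2 * j.+2%:R `^ (s - 1))).
    by apply: ler_wpM2l; [lra|exact: green_coef_le].
  have -> : c * 2 = s / 2 * (j.+2%:R `^ s / j.+1%:R).
    by rewrite /c; move: (j.+2%:R `^ s) (j.+1%:R^-1) => p z; field.
  rewrite ler_wpM2l//; first by lra.
  rewrite powRB ?pnatr_eq0 ?implybT// powRr1// ler_wpM2l ?powR_ge0//.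
  by rewrite lef_pV2 ?posrE// ler_nat.
rewrite -(coin_mass j) -esumZl ?lee_fin// /thinned_coef esum_recl; last first.
  by move=> k; rewrite lee_fin mulr_ge0.
rewrite coin0 mulr0 add0e; apply: le_esum => k _; rewrite -EFinM lee_fin.
have [kj|jk] := ltnP k j; first by rewrite {1}/coin bin_small// !mulr0 mulr_ge0.
have bin_id : 'C(k.+1, j.+1)%:R = k.+1%:R / j.+1%:R * 'C(k, j)%:R :> R.
  apply: (@mulfI _ j.+1%:R); first by rewrite pnatr_eq0.
  by rewrite mulrA [_ * (_ / _)]mulrC divfK ?pnatr_eq0// -!natrM -mul_bin_diag.
have bk : s * j.+2%:R `^ s / k.+2%:R <= green_coef s k.+1.
  apply: le_trans (green_coef_ge _ hs).
  rewrite powRB ?pnatr_eq0 ?implybT// powRr1// -mulrA ler_wpM2l ?(ltW s0)//.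
  rewrite ler_wpM2r ?invr_ge0//; apply: ge0_ler_powR; rewrite ?nnegrE ?(ltW s0)//.
  by rewrite ler_nat.
have -> : coin j.+1 k.+1 = k.+1%:R / 2 / j.+1%:R * coin j k.
  by rewrite /coin bin_id exprS invfM; ring.
rewrite [leRHS]mulrA; apply: ler_wpM2r => //.
have q0 : 0 <= k.+1%:R / 2 / j.+1%:R :> R by rewrite !divr_ge0.
apply: le_trans (ler_wpM2r q0 bk).
have -> : s * j.+2%:R `^ s / k.+2%:R * (k.+1%:R / 2 / j.+1%:R) =
    c * (2 * k.+1%:R / k.+2%:R).
  rewrite /c; move: (j.+2%:R `^ s) (j.+1%:R^-1) (k.+2%:R^-1) (k.+1%:R : R) => p z w v.
  by field.
by rewrite ler_peMr// ler_pdivlMr// mul1r -natrM ler_nat; lia.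
Qed.

Section kernels.
Context {d : nat}.
Hypothesis d0 : (0 < d)%N.
Implicit Types x : lattice d.

Let lazy_kernel_binomial k x :
  lazy_kernel k x = \sum_(j < k.+1) coin j k * srw_kernel j x :> R.
Proof.
elim: k x => [|k IH] x.
  by rewrite big_ord1 coin0 mul1r.
rewrite -[LHS]/(lazy (lazy_kernel k) x) (funext IH) /lazy avg_sum.
rewrite [RHS]big_ord_recl/=.
under [X in _ = _ + X]eq_bigr do rewrite coinSS -mulrDr -mulrA mulrDl.
rewrite -mulr_sumr coin0S -[X in _ = X + _]mulrA -mulrDr.
congr (_ * _); rewrite big_split/= [RHS]addrA; congr (_ + _).
rewrite [LHS]big_ord_recl [in RHS]big_ord_recr/= [coin k.+1 k]/coin bin_small//.
by rewrite mulr0 mul0r addr0.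
Qed.

Definition lazy_green x : \bar R :=
  (\esum_(k in [set: nat]) (green_coef s k * lazy_kernel k x)%:E)%E.

Let lazy_greenE x :
  lazy_green x = (\esum_(j in [set: nat]) (thinned_coef j * (srw_kernel j x)%:E))%E.
Proof.
transitivity (\esum_(k in [set: nat]) \esum_(j in [set: nat])
    ((green_coef s k * coin j k)%:E * (srw_kernel j x)%:E))%E.
  apply: eq_esum => k _; rewrite (@esum_finite_support R k.+1); last 2 first.
  - by move=> j; rewrite -EFinM lee_fin !mulr_ge0// srw_kernel_ge0.
  - by move=> j kj; rewrite /coin bin_small// !mulr0 mul0e.
  rewrite lazy_kernel_binomial mulr_sumr -sumEFin; apply: eq_bigr => j _.
  by rewrite -EFinM mulrA.
rewrite esum_exchange; last first.
  by move=> k j; rewrite -EFinM lee_fin !mulr_ge0// srw_kernel_ge0.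
apply: eq_esum => j _; rewrite esumZr// ?lee_fin ?srw_kernel_ge0// => k.
by rewrite lee_fin mulr_ge0.
Qed.

(** The lazy walk makes a simple step at every success of a coin, which changes the
    Green function by constant factors only. *)
Lemma lazy_green_le x :
  (lazy_green x <= 2%:E * avg_series (green_coef s) delta x)%E.
Proof.
rewrite lazy_greenE -esumZl ?lee_fin//; last first.
  by move=> n; rewrite lee_fin mulr_ge0// srw_kernel_ge0.
apply: le_esum => j _; rewrite -EFinM mulrA EFinM lee_wpmul2r//.
by rewrite lee_fin srw_kernel_ge0.
Qed.

Lemma lazy_green_ge x :
  ((s / 2)%:E * avg_series (green_coef s) delta x <= lazy_green x)%E.
Proof.
case/andP: (hs) => s0 _; have s20 : 0 <= s / 2 by rewrite divr_ge0// ltW.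
rewrite lazy_greenE -esumZl ?lee_fin//; last first.
  by move=> n; rewrite lee_fin mulr_ge0// srw_kernel_ge0.
apply: le_esum => j _; rewrite -EFinM mulrA EFinM lee_wpmul2r//.
by rewrite lee_fin srw_kernel_ge0.
Qed.

End kernels.
End lazy_comparison.

(** * Two-sided bounds for the Green function *)

Section power_sums.
Context {R : realType}.

(** Telescoping forms of the integral test, for exponents beyond and below 1. *)
Lemma sum_powR_tail (q : R) m n : 0 < q -> (0 < m)%N ->
  \sum_(m <= k < m + n) k.+1%:R `^ (- 1 - q) <= q^-1 * m%:R `^ (- q).
Proof.
move=> q0 m0.
have step k : (0 < k)%N ->
    k.+1%:R `^ (- 1 - q) <= q^-1 * (k%:R `^ (- q) - k.+1%:R `^ (- q)).
  move=> k0; rewrite ler_pdivlMl// lerBrDr.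
  have := @powRN_ge_tangent R (- k.+1%:R^-1) q.
  rewrite ltrN2 invf_lt1// ltr1n ltnS k0 (ltW q0) => /(_ isT isT) h.
  have -> : k%:R = k.+1%:R * (1 - k.+1%:R^-1) :> R.
    by rewrite mulrBr mulfV ?pnatr_eq0// mulr1 -natr1 addrK.
  rewrite powRM ?subr_ge0 ?invf_le1 ?ler1n//.
  apply: le_trans (ler_wpM2l (powR_ge0 _ _) h).
  rewrite powRD ?pnatr_eq0 ?implybT// powR_inv1//.
  by rewrite mulrN opprK mulrDr mulr1 addrC lerD2l mulrA mulrC mulrA.
suff : \sum_(m <= k < m + n) k.+1%:R `^ (- 1 - q) <=
    q^-1 * (m%:R `^ (- q) - (m + n)%:R `^ (- q)).
  move/le_trans; apply; rewrite ler_wpM2l ?invr_ge0 ?(ltW q0)//.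
  by rewrite gerBl powR_ge0.
elim: n => [|n IH]; first by rewrite addn0 big_geq// subrr mulr0.
rewrite addnS big_nat_recr ?leq_addr//=.
apply: le_trans (lerD IH (step _ _)) _; first by rewrite addn_gt0 m0.
by rewrite -mulrDr addrA subrK.
Qed.

Lemma sum_powR_head (g : R) m : 0 <= g < 1 ->
  \sum_(0 <= k < m) k.+1%:R `^ (- g) <= (1 - g)^-1 * m%:R `^ (1 - g).
Proof.
move=> /andP[g0 g1]; have g10 : 0 < 1 - g by rewrite subr_gt0.
elim: m => [|m IH]; first by rewrite big_geq// mulr_ge0 ?invr_ge0 ?powR_ge0// ltW.
rewrite big_nat_recr//=; apply: le_trans (lerD IH (lexx _)) _.
rewrite -(ler_pM2l g10) mulrDr !mulrA mulfV ?gt_eqF// !mul1r.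
have := @powR_le_tangent R (m%:R / m.+1%:R) (1 - g).
rewrite divr_ge0// g10 gerBl g0 => /(_ isT isT) h.
have mE : m%:R `^ (1 - g) = m.+1%:R `^ (1 - g) * (m%:R / m.+1%:R) `^ (1 - g) :> R.
  by rewrite -powRM ?divr_ge0// mulrC divfK ?pnatr_eq0.
have -> : m.+1%:R `^ (- g) = m.+1%:R `^ (1 - g) / m.+1%:R :> R.
  by rewrite [in RHS]powRD ?pnatr_eq0 ?implybT// powRr1// mulrC mulKf ?pnatr_eq0.
rewrite mE mulrCA -mulrDr ler_piMr ?powR_ge0//.
apply: le_trans (lerD h (lexx _)) _.
have -> : m%:R / m.+1%:R = 1 - m.+1%:R^-1 :> R.
  by apply: (@mulIf _ m.+1%:R);
    rewrite ?pnatr_eq0// divfK ?pnatr_eq0// mulrBl mulVf ?pnatr_eq0// mul1r -natr1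
      addrK.
by rewrite [leLHS](_ : _ = 1)//; ring.
Qed.

End power_sums.

Section green_bounds.
Context {R : realType} {d : nat}.
Hypothesis d3 : (3 <= d)%N.
Variable alpha : R.
Hypothesis ha : 0 < alpha < 2.
Local Notation s := (alpha / 2).
Local Notation beta := (d%:R - alpha).
Implicit Types x : lattice d.

Let d0 : (0 < d)%N. Proof. exact: leq_trans d3. Qed.

Let hs : 0 < s < 1. Proof. exact: half_alpha_itv. Qed.

Let q : R := d%:R / 2 - s.

Let q0 : 0 < q.
Proof.
have : 3 <= d%:R :> R by rewrite ler_nat.
by rewrite /q; case/andP: ha => *; lra.
Qed.

Let b0 k : 0 <= green_coef s k.
Proof. by rewrite ltW// green_coef_gt0//; case/andP: hs. Qed.

(** The order of magnitude of the Green function. *)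
Definition green_decay x : R := (snorm x).+1%:R `^ (- beta).

Lemma green_decay_gt0 x : 0 < green_decay x.
Proof. by rewrite powR_gt0. Qed.

Let decayE x : green_decay x = ((snorm x).+1 ^ 2)%:R `^ (- q).
Proof.
by rewrite natrX -powR_mulrn// -powRrM /green_decay; congr (_ `^ _); rewrite /q; lra.
Qed.

Let coef_decay k : k.+1%:R `^ (s - 1) * diag_decay (d := d) k = k.+1%:R `^ (- 1 - q).
Proof.
rewrite /diag_decay -powRD ?pnatr_eq0 ?implybT//; congr (_ `^ _).
by rewrite /q; lra.
Qed.

Let term_le k x : green_coef s k * lazy_kernel k x <= dim_const (d := d) *
  (k.+1%:R `^ (- 1 - q) * expR (- ((snorm x)%:R ^+ 2 / (2 * k.+1)%:R))).
Proof.
apply: le_trans (ler_pM (b0 k) (lazy_kernel_ge0 d0 _ _) (green_coef_le _ hs)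
  (lazy_kernel_le d0 _ _)) _.
by rewrite -coef_decay; rewrite le_eqVlt; apply/orP; left; apply/eqP; ring.
Qed.

(* the Gaussian factor makes up for the growth of the power towards small times *)
Let gauss_le r k : expR (- (r%:R ^+ 2 / (2 * k.+1)%:R)) <=
  ((8 * d)%:R * k.+1%:R / (r.+1 ^ 2)%:R) ^+ d :> R.
Proof.
pose y : R := r%:R ^+ 2 / (2 * k.+1)%:R.
have y0 : 0 <= y by rewrite divr_ge0 ?sqr_ge0.
have dn : d%:R != 0 :> R by rewrite pnatr_eq0 -lt0n.
have -> : - (r%:R ^+ 2 / (2 * k.+1)%:R) = d%:R * (- (y / d%:R)).
  by rewrite mulrN [_ * (_ / _)]mulrC divfK.
rewrite expRM_natl; apply: lerXn2r; rewrite ?nnegrE ?expR_ge0 ?divr_ge0 ?mulr_ge0//.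
have base0 : 0 < (8 * d)%:R * k.+1%:R / (r.+1 ^ 2)%:R :> R.
  by rewrite divr_gt0 ?mulr_gt0 ?ltr0n ?muln_gt0 ?expn_gt0.
rewrite expRN -[leRHS]invrK lef_pV2 ?posrE ?expR_gt0 ?invr_gt0//.
apply: le_trans (expR_ge1Dx _); rewrite invf_div.
rewrite ler_pdivrMr ?mulr_gt0 ?ltr0n ?muln_gt0// mulrDl mul1r.
have -> : y / d%:R * ((8 * d)%:R * k.+1%:R) = (4 * r ^ 2)%:R.
  rewrite /y !natrM.
  have kn : k.+1%:R != 0 :> R by rewrite pnatr_eq0.
  by move: (k.+1%:R : R) kn => K K0; field; rewrite ?K0 ?dn.
by rewrite -natrM -natrD ler_nat; nia.
Qed.

(** Up to time R^2, with R the distance, the Gaussian factor keeps every term below a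
    multiple of its value at time R^2; the later terms form the tail of a convergent
    sum of powers. *)
Lemma lazy_green_upper : exists2 C : R, 0 < C &
  forall x, (lazy_green s x <= (C * green_decay x)%:E)%E.
Proof.
pose C0 : R := (8 * d)%:R ^+ d + q^-1.
have C00 : 0 < C0 by rewrite ltr_wpDl ?exprn_ge0 ?invr_gt0.
exists (dim_const (d := d) * C0); first by rewrite mulr_gt0 ?dim_const_gt0.
move=> x; set r := snorm x; set T := (r.+1 ^ 2)%N.
have T0 : (0 < T)%N by rewrite expn_gt0.
have nn k : (0 <= (green_coef s k * lazy_kernel k x)%:E)%E.
  by rewrite lee_fin mulr_ge0// lazy_kernel_ge0.
apply: esum_le_partial => // n.
apply: (@le_trans _ _ (\sum_(0 <= k < T + n) (green_coef s k * lazy_kernel k x)%:E)%E).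
  by rewrite [leRHS](big_cat_nat _ (leq_addl T n))//= leeDl// sume_ge0.
rewrite sumEFin lee_fin.
apply: le_trans (ler_sum _ (fun k _ => term_le k x)) _.
rewrite -mulr_sumr -mulrA ler_wpM2l ?(ltW (dim_const_gt0 d0))// decayE -/r -/T.
rewrite (big_cat_nat _ (leq_addr n T))//= mulrDl; apply: lerD; last first.
  apply: le_trans (sum_powR_tail n q0 T0); apply: ler_sum => k _.
  by rewrite ler_piMr ?powR_ge0// expR_le1 oppr_le0 divr_ge0 ?sqr_ge0.
apply: (@le_trans _ _ (\sum_(0 <= k < T) ((8 * d)%:R ^+ d * T%:R `^ (- 1 - q)))).
  rewrite !big_nat; apply: ler_sum => k /andP[_ kT].
  apply: le_trans (ler_wpM2l (powR_ge0 _ _) (gauss_le r k)) _; rewrite -/T.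
  have e (a : R) : 0 < a -> a `^ (d%:R - 1 - q) = a `^ (- 1 - q) * a ^+ d.
    move=> a0; rewrite -powR_mulrn ?(ltW a0)// -powRD;
      last by rewrite (gt_eqF a0) implybT.
    by congr (_ `^ _); lra.
  have -> : k.+1%:R `^ (- 1 - q) * ((8 * d)%:R * k.+1%:R / T%:R) ^+ d =
      (8 * d)%:R ^+ d * (k.+1%:R `^ (d%:R - 1 - q) / T%:R ^+ d).
    by rewrite e// expr_div_n exprMn; ring.
  rewrite ler_wpM2l ?exprn_ge0// ler_pdivrMr ?exprn_gt0 ?ltr0n// -e ?ltr0n//.
  apply: ge0_ler_powR; rewrite ?nnegrE ?ler_nat//.
  have : 3 <= d%:R :> R by rewrite ler_nat.
  by rewrite /q; case/andP: ha => *; lra.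
rewrite sumr_const_nat subn0 -mulrnAr ler_wpM2l ?exprn_ge0//.
rewrite -mulr_natl powRD ?pnatr_eq0 -?lt0n ?T0 ?implybT//.
by rewrite powR_inv1// mulrA mulfV ?mul1r// pnatr_eq0 -lt0n.
Qed.

(** A window of times of order R^2, where the kernel is at its diagonal size,
    already gives the right order. *)
Lemma lazy_green_lower : exists2 c : R, 0 < c &
  forall x, ((c * green_decay x)%:E <= lazy_green s x)%E.
Proof.
have [A A0 lower] := @lazy_kernel_ge R d d0.
have s0 : 0 < s by case/andP: hs.
pose c0 : R := s * 2 ^- d.+1.
have c00 : 0 < c0 by rewrite mulr_gt0 ?invr_gt0 ?exprn_gt0.
pose c : R := c0 * (A%:R * (2 * A)%:R `^ (- 1 - q)).
exists c; first by rewrite /c mulr_gt0// mulr_gt0 ?powR_gt0 ?ltr0n ?muln_gt0 ?A0.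
move=> x; set r := snorm x; pose T := (r.+1 ^ 2)%N.
have T0 : (0 < T)%N by rewrite expn_gt0.
have nn k : (0 <= (green_coef s k * lazy_kernel k x)%:E)%E.
  by rewrite lee_fin mulr_ge0// lazy_kernel_ge0.
apply: le_trans (esum_ge_partial (A * T) (2 * A * T) nn).
rewrite sumEFin lee_fin.
apply: (@le_trans _ _ (\sum_(A * T <= k < 2 * A * T)
    c0 * ((2 * A * T)%:R `^ (- 1 - q)))).
  rewrite sumr_const_nat -mulnA mul2n -addnn addnK addnn -mul2n mulnA.
  rewrite decayE -/r -/T (natrM _ (2 * A)) powRM//.
  rewrite [T%:R `^ (- 1 - q)]powRD ?pnatr_eq0 -?lt0n ?T0 ?implybT// powR_inv1//.
  rewrite -[leRHS]mulr_natl (natrM _ A) /c le_eqVlt; apply/orP; left; apply/eqP.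
  have Tn : T%:R != 0 :> R by rewrite pnatr_eq0 -lt0n.
  by set p := (2 * A)%:R `^ _; set w := _ `^ (- q); move: (T%:R : R) Tn => v Tn; field.
rewrite !big_nat; apply: ler_sum => k /andP[kA kT].
have lk : 2 ^- d.+1 * diag_decay (d := d) k <= lazy_kernel k x :> R.
  by apply: lower; rewrite -/r; move: kA; rewrite /T; nia.
apply: le_trans (ler_pM _ _ (green_coef_ge _ hs) lk); last 2 first.
- by rewrite mulr_ge0 ?powR_ge0// ltW.
- by rewrite mulr_ge0 ?invr_ge0 ?exprn_ge0// ltW// diag_decay_gt0.
rewrite mulrACA coef_decay ler_wpM2l ?(ltW c00)//.
have q1 : - 1 - q = - (1 + q) by lra.
rewrite q1 !powRN lef_pV2 ?posrE ?powR_gt0 ?ltr0n ?muln_gt0 ?A0//.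
apply: ge0_ler_powR; rewrite ?nnegrE// ?ler_nat//.
by rewrite addr_ge0// ltW.
Qed.

Theorem green_bounds : exists c C : R, [/\ 0 < c, 0 < C &
  forall x, ((c * green_decay x)%:E <= green alpha delta x <=
    (C * green_decay x)%:E)%E].
Proof.
have [C C0 up] := lazy_green_upper; have [c c0 low] := lazy_green_lower.
have s0 : 0 < s by case/andP: hs.
exists (2^-1 * c), ((s / 2)^-1 * C).
split; [by rewrite mulr_gt0|by rewrite mulr_gt0// invr_gt0 divr_gt0|move=> x].
have s2 : 0 < s / 2 by rewrite divr_gt0.
apply/andP; split.
  rewrite -mulrA EFinM lee_pdivrMl//.
  exact: le_trans (low x) (lazy_green_le hs x).
rewrite -[X in X%:E]mulrA [X in (_ <= X)%E]EFinM lee_pdivlMl//.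
exact: le_trans (lazy_green_ge hs x) (up x).
Qed.

End green_bounds.

(** * Potentials of boxes *)

Section potentials.
Context {R : realType} {d : nat}.
Variable alpha : R.
Hypothesis ha : 0 < alpha < 2.
Implicit Types (f : lattice d -> R) (x y z : lattice d).

Let b0 k : 0 <= green_coef (alpha / 2) k.
Proof. by rewrite ltW// green_coef_gt0//; case/andP: ha => *; lra. Qed.

Lemma iter_avg_sum (I : finType) (a : I -> R) (f_ : I -> lattice d -> R) k x :
  iter k avg (fun y => \sum_i a i * f_ i y) x = \sum_i a i * iter k avg (f_ i) x.
Proof.
elim: k x => [//|k IH] x; rewrite iterS (funext IH) avg_sum.
by apply: eq_bigr => i _; rewrite iterS.
Qed.

Lemma green_sum (I : finType) (a : I -> R) (f_ : I -> lattice d -> R) x :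
  (forall i, 0 <= a i) -> (forall i y, 0 <= f_ i y) ->
  green alpha (fun y => \sum_i a i * f_ i y) x =
  (\sum_i (a i)%:E * green alpha (f_ i) x)%E.
Proof.
move=> a0 f0.
transitivity (\esum_(k in [set: nat]) \sum_i
    ((a i)%:E * (green_coef (alpha / 2) k * iter k avg (f_ i) x)%:E))%E.
  apply: eq_esum => k _; rewrite iter_avg_sum mulr_sumr -sumEFin.
  by apply: eq_bigr => i _; rewrite -EFinM mulrCA.
have nn i k : (0 <= (green_coef (alpha / 2) k * iter k avg (f_ i) x)%:E)%E.
  by rewrite lee_fin mulr_ge0// iter_avg_ge0.
rewrite esum_sum; last by move=> k i _ _; apply: mule_ge0 => //; rewrite lee_fin.
by apply: eq_bigr => i _; rewrite esumZl ?lee_fin.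
Qed.

Lemma green_translate f z x : green alpha (fun y => f (y - z)) x = green alpha f
  (x - z).
Proof.
apply: eq_esum => k _; congr (_ * _)%:E.
elim: k x => [//|k IH] x; rewrite !iterS (funext IH) /avg; congr (_ * _).
by apply: eq_bigr => i _; rewrite ![_ - z + _]addrAC.
Qed.

(** The unit charges placed at the points of a finite family. *)
Definition charge_of (I : finType) (z : I -> lattice d) y : R := \sum_i delta (y - z i).

Lemma charge_of_ge0 (I : finType) (z : I -> lattice d) y : 0 <= charge_of z y.
Proof. by apply: sumr_ge0 => i _; rewrite /delta ler0n. Qed.

Lemma green_charge_of (I : finType) (z : I -> lattice d) x :
  green alpha (charge_of z) x = (\sum_i green alpha delta (x - z i)%R)%E.
Proof.
transitivity (green alpha (fun y => \sum_i 1 * delta (y - z i)) x).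
  congr (green _ _ _); apply/funext => y; apply: eq_bigr => i _.
  by rewrite mul1r.
rewrite (green_sum (a := fun=> 1) (f_ := fun i y => delta (y - z i)))//.
by apply: eq_bigr => i _; rewrite mul1e green_translate.
Qed.

End potentials.

Section sums_of_distances.
Context {R : realType}.

(** Each distance from a is attained at most twice. *)
Lemma sum_distance_le (F : nat -> R) a H : (forall m, 0 <= F m) -> (a < H)%N ->
  \sum_(h < H) F (absz (a%:Z - h%:Z)) <= 2 * \sum_(0 <= m < H) F m.
Proof.
move=> F0 aH; rewrite -(big_mkord xpredT (fun h : nat => F (absz (a%:Z - h%:Z)))).
have mono m : (m <= H)%N -> \sum_(0 <= k < m) F k <= \sum_(0 <= k < H) F k.
  by move=> mH; rewrite [leRHS](big_cat_nat _ mH)//= lerDl sumr_ge0.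
rewrite (big_cat_nat _ (ltnW aH))//= mulr2n mulrDl mul1r; apply: lerD.
  rewrite big_nat_rev/= add0n; apply: (@le_trans _ _ (\sum_(0 <= m < a) F m.+1)).
    rewrite !big_nat le_eqVlt; apply/orP; left; apply/eqP; apply: eq_bigr => i ia.
    by congr F; lia.
  apply: le_trans (mono _ aH); rewrite big_nat_recl//.
  by rewrite lerDr.
rewrite -{1}(add0n a) big_addn; apply: le_trans (mono _ (leq_subr a H)).
rewrite le_eqVlt; apply/orP; left; apply/eqP; apply: eq_bigr => i _.
by congr F; lia.
Qed.

Lemma ler_sum_inj (I J : finType) (phi : I -> J) (F : J -> R) :
  injective phi -> (forall j, 0 <= F j) -> \sum_i F (phi i) <= \sum_j F j.
Proof.
move=> phi_inj F0; have -> : \sum_i F (phi i) = \sum_(j in [set phi i | i : I]%SET) F j.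
  by rewrite big_imset// => i i' _ _; exact: phi_inj.
by rewrite [leRHS](bigID (fun j => j \in [set phi i | i : I]%SET))/= lerDl sumr_ge0.
Qed.

End sums_of_distances.

Section box_geometry.
Context {n : nat}.
Local Notation d := n.+1.
Implicit Types (x y : lattice d) (L H r : nat).

Definition in_box L H r x : Prop :=
  (forall j : 'I_n, (absz (coord x (lift ord_max j)) <= r)%N) /\
  L%:Z <= coord x ord_max < (L + H)%:Z.

Definition box_index H r : finType := ({ffun 'I_n -> 'I_(2 * r).+1} * 'I_H)%type.

Definition box_point L H r (g : box_index H r) : lattice d :=
  (\row_j (if unlift ord_max j is Some k then (g.1 k)%:Z - r%:Z
           else (L + g.2)%:Z) : 'rV[int]_d).

Lemma card_box_index H r : #|{: box_index H r}| = ((2 * r).+1 ^ n * H)%N.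
Proof. by rewrite card_prod card_ffun !card_ord. Qed.

Lemma coord_box_lift L H r (g : box_index H r) j :
  coord (box_point L g) (lift ord_max j) = (g.1 j)%:Z - r%:Z.
Proof. by rewrite /coord mxE liftK. Qed.

Lemma coord_box_max L H r (g : box_index H r) :
  coord (box_point L g) ord_max = (L + g.2)%:Z.
Proof. by rewrite /coord mxE unlift_none. Qed.

Lemma in_box_point L H r (g : box_index H r) : in_box L H r (box_point L g).
Proof.
split => [j|]; first by rewrite coord_box_lift; have := ltn_ord (g.1 j); lia.
by rewrite coord_box_max; have := ltn_ord g.2; lia.
Qed.

Lemma coordP x y : (forall j, coord x (lift ord_max j) = coord y (lift ord_max j)) ->
  coord x ord_max = coord y ord_max -> x = y.
Proof.
move=> h hm; apply/rowP => j; case: (unliftP ord_max j) => [k|] ->; last exact: hm.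
exact: h.
Qed.

Lemma box_pointP L H r x : in_box L H r x -> exists g : box_index H r, box_point L g
  = x.
Proof.
move=> [h1 /andP[h2 h3]].
have lt1 j : (absz (coord x (lift ord_max j) + r%:Z)%R < (2 * r).+1)%N.
  by have := h1 j; lia.
have lt2 : (absz (coord x ord_max - L%:Z)%R < H)%N by lia.
exists ([ffun j => Ordinal (lt1 j)], Ordinal lt2); apply: coordP => [j|].
  by rewrite coord_box_lift ffunE/=; have := h1 j; lia.
by rewrite coord_box_max/=; lia.
Qed.

(** Coordinates of a point relative to the corner of the box. *)
Lemma box_offsets L H r x : in_box L H r x -> exists (a : 'I_n -> nat) (b : nat),
  [/\ forall j, (a j < (2 * r).+1)%N, (b < H)%N,
      forall j, (a j)%:Z = coord x (lift ord_max j) + r%:Z &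
      b%:Z = coord x ord_max - L%:Z].
Proof.
move=> /box_pointP[g <-]; exists (fun j => g.1 j : nat), (g.2 : nat).
split => [j||j|]; rewrite ?ltn_ord// ?coord_box_lift ?subrK//.
by rewrite coord_box_max PoszD addrAC subrr add0r.
Qed.

Lemma snorm_coord x i m : (m <= absz (coord x i))%N -> (m <= snorm x)%N.
Proof. by move/leq_trans; apply; exact: coord_le_snorm. Qed.

Lemma snorm_le x m : (forall i, (absz (coord x i) <= m)%N) -> (snorm x <= m)%N.
Proof. by move=> h; apply/bigmax_leqP => i _. Qed.

End box_geometry.

Section boxes.
Context {R : realType} {n : nat}.
Local Notation d := n.+1.
Hypothesis d3 : (3 <= d)%N.
Variable alpha : R.
Hypothesis ha : 0 < alpha < 2.
Local Notation beta := (d%:R - alpha).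
Implicit Types (x y : lattice d) (L H r : nat).

Let beta1 : 1 < beta.
Proof.
have : 3 <= d%:R :> R by rewrite ler_nat.
by case/andP: ha => *; lra.
Qed.

Definition box_charge L H r : lattice d -> R := charge_of (@box_point n L H r).

Lemma box_charge0 L H r x : ~ in_box L H r x -> box_charge L H r x = 0.
Proof.
move=> nx; apply: big1 => g _; rewrite /delta subr_eq0.
by case: eqP => // xg; case: nx; rewrite xg; exact: in_box_point.
Qed.

(** Since the box is at least as tall as it is wide, each of its points is a vertex
    of a cube of side r inside the box; the (r+1)^d points of that cube suffice. *)
Lemma box_decay_ge L H r y : (2 * r <= H)%N -> (0 < H)%N -> in_box L H r y ->
  r.+1%:R `^ alpha <= \sum_(g : box_index H r) green_decay alpha (y - box_point L g).
Proof.
move=> rH H0 /box_offsets[a1 [a2 [a1lt a2lt a1E a2E]]].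
pose refl (a e : nat) := if (r <= a)%N then (a - e)%N else (a + e)%N.
(* refl a e is at distance e from a, on the side that keeps it inside any range of
   length at least 2r *)
have refl_inj a : {in [pred e | (e <= r)%N] &, injective (refl a)}.
  by move=> e e'; rewrite !inE /refl; case: ifP => ? ? ?; lia.
have refl_dist a e : (e <= r)%N -> (absz (a%:Z - (refl a e)%:Z) <= r)%N.
  by rewrite /refl; case: ifP => ? ?; lia.
have refl_lt a e M : (e <= r)%N -> (a < M)%N -> (2 * r <= M)%N -> (refl a e < M)%N.
  by rewrite /refl; case: ifP => ? ? ? ?; lia.
have er (e : 'I_r.+1) : (e <= r)%N by rewrite -ltnS.
have lt1 j (e : 'I_r.+1) : (refl (a1 j) e < (2 * r).+1)%N by apply: refl_lt.
have lt2 (e : 'I_r.+1) : (refl a2 e < H)%N by apply: refl_lt.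
pose phi (e : {ffun 'I_n -> 'I_r.+1} * 'I_r.+1) : box_index H r :=
  ([ffun j => Ordinal (lt1 j (e.1 j))], Ordinal (lt2 e.2)).
have phi_inj : injective phi.
  move=> [e1 e2] [e1' e2'] [/ffunP p1 p2]; congr (_, _).
    apply/ffunP => j; apply: val_inj; have := p1 j; rewrite !ffunE/= => -[].
    by apply: refl_inj; rewrite inE.
  by apply: val_inj; apply: (refl_inj a2); rewrite ?inE ?er.
apply: le_trans (ler_sum_inj (F := fun g => green_decay alpha (y - box_point L g))
  phi_inj _); last by move=> g; rewrite ltW// green_decay_gt0.
apply: (@le_trans _ _ (\sum_(e : {ffun 'I_n -> 'I_r.+1} * 'I_r.+1) r.+1%:R `^ (-
  beta))).
  rewrite sumr_const card_prod card_ffun !card_ord -expnSr -[leRHS]mulr_natl natrX.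
  rewrite -powR_mulrn// -powRD ?pnatr_eq0 ?implybT//.
  by rewrite opprB addrCA subrr addr0.
apply: ler_sum => e _; rewrite /green_decay !powRN lef_pV2 ?posrE ?powR_gt0//.
apply: ge0_ler_powR; rewrite ?nnegrE ?ler_nat// ?(le_trans ler01 (ltW beta1))//.
rewrite ltnS; apply: snorm_le => i; case: (unliftP ord_max i) => [j|] ->.
  by rewrite coordD coordN coord_box_lift ffunE/= opprB addrA -a1E; exact: refl_dist.
rewrite coordD coordN coord_box_max/= PoszD opprD addrA -a2E; exact: refl_dist.
Qed.

(** Inside its own box a uniform charge has potential of order r^alpha: the points
    at height difference at most r form a cube, and the remaining ones contribute
    like a line of charges of mass r^(d-1). *)
Lemma box_decay_le : exists2 C : R, 0 < C & forall L H r y, in_box L H r y ->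
  \sum_(g : box_index H r) green_decay alpha (y - box_point L g) <=
  C * r.+1%:R `^ alpha.
Proof.
have b1 := beta1; have bpos : 0 < beta by lra.
have d0 : 0 < d%:R :> R by rewrite ltr0n.
pose gam : R := beta / d%:R.
have gam01 : 0 <= gam < 1.
  rewrite /gam divr_ge0 ?(ltW bpos)//= ltr_pdivrMr// mul1r.
  by case/andP: ha => *; lra.
have gam1 : 0 < 1 - gam by case/andP: gam01 => *; lra.
pose q : R := beta - 1; have q0 : 0 < q by rewrite /q; lra.
pose C1 : R := 2 / (1 - gam) * 2 `^ (1 - gam).
have C10 : 0 < C1 by rewrite mulr_gt0 ?divr_gt0 ?powR_gt0.
pose C2 : R := 2 / q * 2 ^+ n.
have C20 : 0 < C2 by rewrite mulr_gt0 ?divr_gt0 ?exprn_gt0.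
exists (C1 ^+ d + C2); first by rewrite addr_gt0 ?exprn_gt0.
move=> L H r y /box_offsets[a1 [a2 [a1lt a2lt a1E a2E]]].
pose F (m : nat) : R := m.+1%:R `^ (- gam).
pose F1 m : R := if (m <= r)%N then F m else 0.
pose F2 (m : nat) : R := if (m <= r)%N then 0 else m.+1%:R `^ (- 1 - q).
have F0 m : 0 <= F m by exact: powR_ge0.
have F10 m : 0 <= F1 m by rewrite /F1; case: ifP.
have F20 m : 0 <= F2 m by rewrite /F2; case: ifP => // _; exact: powR_ge0.
have dist1 (g : box_index H r) j : absz (coord (y - box_point L g) (lift ord_max j)) =
    absz ((a1 j)%:Z - (g.1 j)%:Z) :> nat.
  by rewrite coordD coordN coord_box_lift opprB addrA -a1E.
have dist2 (g : box_index H r) : absz (coord (y - box_point L g) ord_max) = absz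
  (a2%:Z - g.2%:Z) :> nat.
  by rewrite coordD coordN coord_box_max PoszD opprD addrA -a2E.
(* in the cube the maximum norm is split evenly between the coordinates, which turns
   the sum into a product of one-dimensional sums with exponent beta / d < 1 *)
have pointwise (g : box_index H r) : green_decay alpha (y - box_point L g) <=
    (\prod_j F (absz ((a1 j)%:Z - (g.1 j)%:Z))) * F1 (absz (a2%:Z - g.2%:Z)) +
    F2 (absz (a2%:Z - g.2%:Z)).
  set N := snorm (y - box_point L g).
  have N1 j : (absz ((a1 j)%:Z - (g.1 j)%:Z) <= N)%N by rewrite -dist1;
    exact: coord_le_snorm.
  have N2 : (absz (a2%:Z - g.2%:Z) <= N)%N by rewrite -dist2; exact: coord_le_snorm.
  have le_pow (e : R) m m' : 0 <= e -> (m <= m')%N -> m'.+1%:R `^ (- e) <= m.+1%:R `^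
    (- e).
    move=> e0 mm; rewrite !powRN lef_pV2 ?posrE ?powR_gt0//.
    by apply: ge0_ler_powR; rewrite ?nnegrE ?ler_nat.
  rewrite /F1 /F2; case: ifP => _; last first.
    rewrite mulr0 add0r /green_decay -/N.
    have -> : - 1 - q = - beta by rewrite /q; lra.
    by apply: le_pow => //; exact: ltW.
  rewrite addr0; apply: (@le_trans _ _ (N.+1%:R `^ (- gam) ^+ d)).
    rewrite -powR_mulrn ?powR_ge0// -powRrM mulNr /gam divfK ?gt_eqF//.
  have g0 : 0 <= gam by case/andP: gam01.
  rewrite exprSr; apply: ler_pM; rewrite ?exprn_ge0 ?powR_ge0//; last exact: le_pow.
  rewrite -[X in _ ^+ X]card_ord -prodr_const; apply: ler_prod => j _.
  by rewrite powR_ge0/=; exact: le_pow.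
apply: le_trans (ler_sum _ (fun g _ => pointwise g)) _.
rewrite big_split/= mulrDl; apply: lerD.
  have -> : \sum_(g : box_index H r) (\prod_j F (absz ((a1 j)%:Z - (g.1 j)%:Z))) *
        F1 (absz (a2%:Z - g.2%:Z)) =
      (\prod_j \sum_(e < (2 * r).+1) F (absz ((a1 j)%:Z - e%:Z))) *
      \sum_(h < H) F1 (absz (a2%:Z - h%:Z)).
    rewrite (bigA_distr_bigA (fun j (e : 'I_(2 * r).+1) => F (absz ((a1 j)%:Z -
      e%:Z)))).
    rewrite mulr_suml -(pair_bigA _ (fun (e : {ffun 'I_n -> 'I_(2 * r).+1}) (h :
      'I_H) =>
      (\prod_j F (absz ((a1 j)%:Z - (e j)%:Z))) * F1 (absz (a2%:Z - h%:Z))))/=.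
    by apply: eq_bigr => e _; rewrite mulr_sumr.
  have -> : C1 ^+ d * r.+1%:R `^ alpha = (C1 * r.+1%:R `^ (1 - gam)) ^+ n *
      (C1 * r.+1%:R `^ (1 - gam)).
    rewrite -exprSr [RHS]exprMn; congr (_ * _).
    rewrite -powR_mulrn ?powR_ge0// -powRrM mulrBl mul1r /gam divfK ?gt_eqF//.
    congr (_ `^ _).
    by lra.
  have head m : (m <= (2 * r).+1)%N ->
      2 * \sum_(0 <= k < m) F k <= C1 * r.+1%:R `^ (1 - gam).
    move=> mr; apply: (@le_trans _ _ (2 * ((1 - gam)^-1 * m%:R `^ (1 - gam)))).
      by rewrite ler_wpM2l// sum_powR_head.
    rewrite [leLHS]mulrA /C1 -[leRHS]mulrA ler_wpM2l ?divr_ge0 ?(ltW gam1)// -powRM//.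
    apply: ge0_ler_powR; rewrite ?nnegrE ?(ltW gam1)// ?mulr_ge0//.
    by rewrite -natrM ler_nat; lia.
  have s0 (G : nat -> R) M a : (forall m, 0 <= G m) -> 0 <= \sum_(e < M) G
    (absz (a%:Z - e%:Z)).
    by move=> G0; exact: sumr_ge0.
  apply: ler_pM; [by apply: prodr_ge0 => j _; exact: s0|exact: s0| |].
    rewrite -[X in _ ^+ X]card_ord -prodr_const; apply: ler_prod => j _.
    rewrite s0//=; apply: le_trans (sum_distance_le F0 (a1lt j)) _.
    exact: head.
  apply: le_trans (sum_distance_le F10 a2lt) _; apply: le_trans (head r.+1 _);
    last by lia.
  rewrite ler_wpM2l// (@le_trans _ _ (\sum_(0 <= m < r.+1 + H) F1 m))//.
    by rewrite [leRHS](big_cat_nat _ (leq_addl r.+1 H))//= lerDl sumr_ge0.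
  rewrite (big_cat_nat _ (leq_addr H r.+1))//= [X in _ + X]big_nat [X in _ + X]big1
    ?addr0.
    by rewrite !big_nat; apply: ler_sum => m /andP[_ mr]; rewrite /F1 -ltnS mr.
  by move=> m /andP[rm _]; rewrite /F1 leqNgt rm.
rewrite -(pair_bigA _ (fun (e : {ffun 'I_n -> 'I_(2 * r).+1}) (h : 'I_H) =>
  F2 (absz (a2%:Z - h%:Z))))/= sumr_const card_ffun !card_ord -[leLHS]mulr_natl.
apply: (@le_trans _ _ ((2 * r.+1%:R) ^+ n * (2 * (q^-1 * r.+1%:R `^ (- q))))).
  apply: ler_pM => //; first exact: sumr_ge0.
    by rewrite natrX lerXn2r ?nnegrE ?mulr_ge0// -natrM ler_nat; lia.
  apply: le_trans (sum_distance_le F20 a2lt) _; rewrite ler_wpM2l//.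
  apply: (@le_trans _ _ (\sum_(0 <= m < r.+1 + H) F2 m)).
    by rewrite [leRHS](big_cat_nat _ (leq_addl r.+1 H))//= lerDl sumr_ge0.
  rewrite (big_cat_nat _ (leq_addr H r.+1))//= big_nat big1 ?add0r.
    apply: le_trans (sum_powR_tail H q0 (ltn0Sn r)); rewrite !big_nat.
    by apply: ler_sum => m /andP[rm _]; rewrite /F2 leqNgt rm.
  by move=> m /andP[_ mr]; rewrite /F2 -ltnS mr.
have -> : r.+1%:R `^ alpha = r.+1%:R ^+ n * r.+1%:R `^ (- q) :> R.
  rewrite -powR_mulrn// -powRD ?pnatr_eq0 ?implybT//; congr (_ `^ _).
  by rewrite /q -natr1; lra.
rewrite exprMn /C2 le_eqVlt; apply/orP; left; apply/eqP; ring.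
Qed.

End boxes.

(** * Tails and divergence of nonnegative series *)

Section nonneg_series.
Context {R : realType}.
Variables (u : nat -> R) (i0 : nat).
Hypothesis u0 : forall k, 0 <= u k.

Let S N := \sum_(i0 <= k < N) u k.

Let S_nondec : nondecreasing_seq S.
Proof.
move=> m n mn; rewrite /S; have [mi|im] := leqP m i0.
  by rewrite big_geq// sumr_ge0.
by rewrite [leRHS](big_cat_nat (ltnW im) mn)/= lerDl sumr_ge0.
Qed.

Lemma small_tails (e : R) : cvgn S -> 0 < e ->
  exists K0, forall K m, (K0 <= K)%N -> \sum_(K <= k < K + m) u k <= e.
Proof.
move=> cS e0; have /cvgrPdist_le/(_ e e0)[K1 _ near_lim] := cS.
exists (maxn K1 i0) => K m; rewrite geq_max => /andP[K1K i0K].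
have S_split : S (K + m) = S K + \sum_(K <= k < K + m) u k.
  by rewrite /S (big_cat_nat i0K (leq_addr m K)).
have := near_lim K K1K; have := nondecreasing_cvgn_le S_nondec cS (K + m).
by rewrite /= ler_norml => h /andP[_ h']; move: h h'; rewrite S_split; lra.
Qed.

Lemma large_sums (A : R) K : ~ cvgn S -> (i0 <= K)%N ->
  exists N, A <= \sum_(K <= k < N) u k.
Proof.
move=> dS i0K; apply: contrapT => /forallNP small; apply: dS.
apply: nondecreasing_is_cvgn => //; exists (S K + A) => _ [N _ <-].
have A0 : 0 <= A.
  by rewrite leNgt; apply/negP => /ltW A0; apply: (small 0%N); rewrite big_geq.
have [NK|KN] := leqP N K; first by rewrite (le_trans (S_nondec NK))// lerDl.
rewrite /S (big_cat_nat i0K (ltnW KN))/= lerD2l.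
by have /negP := small N; rewrite -ltNge => /ltW.
Qed.

End nonneg_series.

(** * Massive and non-massive thorns *)

Section thorns.
Context {R : realType} {n : nat}.
Local Notation d := n.+1.
Hypothesis d3 : (3 <= d)%N.
Variable alpha : R.
Hypothesis ha : 0 < alpha < 2.
Local Notation beta := (d%:R - alpha).
Local Notation p := (d%:R - alpha - 1).
Context {disp : measure_display} {Omega : measurableType disp}.
Variable P : probability Omega R.
Variable X : nat -> {RV P >-> lattice d}.
Hypothesis hX : iid_with_law X (stable_step alpha).
Implicit Types (x y : lattice d) (L H r k : nat).

Let p0 : 0 < p.
Proof.
have : 3 <= d%:R :> R by rewrite ler_nat.
by case/andP: ha => *; lra.
Qed.

Let beta1 : 1 <= beta. Proof. by have := p0; lra. Qed.

Let beta0 : 0 <= beta. Proof. by have := beta1; lra. Qed.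

Lemma hit_probS (B B' : set (lattice d)) x : B `<=` B' ->
  (hit_prob X B x <= hit_prob X B' x)%E.
Proof.
move=> BB'; apply: le_measure; rewrite ?inE; [exact: measurable_walk_event..|].
by move=> w [m Bm]; exists m; exact: BB'.
Qed.

Let decay_far x m : (m <= (snorm x).+1)%N -> (0 < m)%N ->
  green_decay alpha x <= m%:R `^ (- beta) :> R.
Proof.
move=> mx m0; rewrite /green_decay !powRN lef_pV2 ?posrE ?powR_gt0 ?ltr0n//.
by apply: ge0_ler_powR; rewrite ?nnegrE ?ler_nat.
Qed.

Let decay_near x m : ((snorm x).+1 <= m)%N -> m%:R `^ (- beta) <= green_decay alpha x
  :> R.
Proof.
move=> mx; rewrite /green_decay !powRN lef_pV2 ?posrE ?powR_gt0 ?ltr0n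
  ?(leq_trans _ mx)//.
by apply: ge0_ler_powR; rewrite ?nnegrE ?ler_nat.
Qed.

Let box_charge_ge0 L H r y : 0 <= box_charge L H r y :> R.
Proof. exact: charge_of_ge0. Qed.

Lemma green_box : exists c C : R, [/\ 0 < c, 0 < C & forall L H r x,
  let S := \sum_(g : box_index (n := n) H r) green_decay alpha (x - box_point L g) in
  ((c * S)%:E <= green alpha (box_charge L H r) x <= (C * S)%:E)%E].
Proof.
have [c [C [c0 C0 cC]]] := @green_bounds R d d3 alpha ha.
exists c, C; split => // L H r x /=; rewrite green_charge_of// !mulr_sumr -!sumEFin.
apply/andP; split; apply: lee_sum => g _.
  by have /andP[] := cC (x - box_point L g).
by have /andP[] := cC (x - box_point L g).
Qed.

(** The potential of the uniform charge is at least of order r^alpha on the box,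
    while at distance m each of its points contributes at most m^(-beta). *)
Lemma hit_prob_box_le : exists2 C : R, 0 < C & forall (B : set (lattice d)) L H r x m,
  B `<=` in_box L H r -> (2 * r <= H)%N -> (0 < H)%N -> (0 < m)%N ->
  (forall g : box_index (n := n) H r, (m <= (snorm (x - box_point L g)%R).+1)%N) ->
  (hit_prob X B x <=
    (C * (r.+1%:R `^ (n%:R - alpha) * H%:R * m%:R `^ (- beta)))%:E)%E.
Proof.
have [c [C [c0 C0 cC]]] := green_box.
exists (c^-1 * C * 2 ^+ n); first by rewrite !mulr_gt0 ?invr_gt0 ?exprn_gt0.
move=> B L H r x m BL rH H0 m0 far.
have r0 : 0 < r.+1%:R `^ alpha :> R by rewrite powR_gt0.
have cr0 : 0 < c * r.+1%:R `^ alpha by rewrite mulr_gt0.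
have low : ((c * r.+1%:R `^ alpha)%:E * hit_prob X B x <=
    green alpha (box_charge L H r) x)%E.
  apply: hit_prob_le_green => //; first exact: ltW.
  move=> y /BL yL; have /andP[+ _] := cC L H r y; apply: le_trans.
  by rewrite lee_fin ler_pM2l// box_decay_ge.
have up : (green alpha (box_charge L H r) x <=
    (C * (((2 * r).+1 ^ n * H)%:R * m%:R `^ (- beta)))%:E)%E.
  have /andP[_] := cC L H r x; move/le_trans; apply; rewrite lee_fin ler_pM2l//.
  rewrite -card_box_index mulr_natl -sumr_const; apply: ler_sum => g _.
  exact: decay_far.
have := le_trans low up; rewrite muleC -lee_pdivlMr// => /le_trans; apply.
rewrite -EFinM lee_fin invfM.
have -> : r.+1%:R `^ (n%:R - alpha) = r.+1%:R ^+ n / r.+1%:R `^ alpha :> R.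
  by rewrite powRB ?pnatr_eq0 ?implybT// powR_mulrn.
have hn : ((2 * r).+1 ^ n * H)%:R <= 2 ^+ n * r.+1%:R ^+ n * H%:R :> R.
  rewrite natrM ler_wpM2r// -exprMn natrX lerXn2r ?nnegrE ?mulr_ge0//.
  by rewrite -natrM ler_nat; clear; lia.
have e0 : 0 <= m%:R `^ (- beta) :> R by exact: powR_ge0.
have w0 : 0 <= (r.+1%:R `^ alpha)^-1 * c^-1 * C.
  by rewrite !mulr_ge0 ?invr_ge0 ?powR_ge0 ?(ltW c0) ?(ltW C0).
have := ler_wpM2l w0 (ler_wpM2r e0 hn).
set a := (r.+1%:R `^ alpha)^-1; set b := c^-1; set e := m%:R `^ _.
set N := (_ * _)%:R; set q := r.+1%:R ^+ n; set t := 2 ^+ n.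
move=> h; rewrite [leLHS](_ : _ = a * b * C * (N * e)); last by ring.
by rewrite [leRHS](_ : _ = a * b * C * (t * q * H%:R * e)); last by ring.
Qed.

Variable t : nat -> R.
Hypothesis t_pos : forall k, (1 <= k)%N -> 0 < t k.
Hypothesis t_mono : forall k m, (1 <= k)%N -> (k <= m)%N -> t k <= t m.
Hypothesis t_lim : t k / k%:R @[k --> \oo] --> (0 : R).

Let pow2_gt0 k : (0 < 2 ^ k)%N. Proof. by rewrite expn_gt0. Qed.

Lemma thorn_bounds x : thorn t x -> 1 <= coord x ord_max /\
  forall j : 'I_n, (absz (coord x (lift ord_max j)))%:R <= t (absz (coord x ord_max)).
Proof.
move=> [i id_ [x1 xt]]; have -> : ord_max = i.
  by apply: val_inj => /=; case: id_.
split => // j; apply: le_trans xt.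
have ji : lift i j != i by rewrite eq_sym neq_lift.
rewrite -[leLHS]ger0_norm// -sqrtr_sqr ler_sqrt; last first.
  by apply: sumr_ge0 => *; exact: sqr_ge0.
rewrite (bigD1 (lift i j))//=.
have -> : (absz (coord x (lift i j)))%:R ^+ 2 = (coord x (lift i j))%:~R ^+ 2 :> R.
  by rewrite natr_absz intr_norm real_normK ?num_real.
by rewrite lerDl sumr_ge0// => *; exact: sqr_ge0.
Qed.

(** The factor 1/d compares the maximum norm with the Euclidean one. *)
Lemma thorn_suff x : 1 <= coord x ord_max ->
  (forall j : 'I_n, (absz (coord x (lift ord_max j)))%:R <=
    t (absz (coord x ord_max)) / d%:R) -> thorn t x.
Proof.
move=> x1 h; exists ord_max => //; split => //.
set T := t _ in h *; have T0 : 0 <= T by apply/ltW/t_pos; lia.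
rewrite -[leRHS]ger0_norm// -sqrtr_sqr ler_sqrt ?sqr_ge0//.
apply: (@le_trans _ _ (\sum_(j < d) (T / d%:R) ^+ 2)); last first.
  rewrite sumr_const card_ord -[leLHS]mulr_natl expr2 mulrA [d%:R * _]mulrC.
  rewrite divfK ?pnatr_eq0// expr2 ler_wpM2l// ler_pdivrMr ?ltr0n//.
  by rewrite ler_peMr// ler1n.
rewrite [leRHS](bigID (fun j => j != ord_max))/=.
apply: (@le_trans _ _ (\sum_(j < d | j != ord_max) (T / d%:R) ^+ 2)); last first.
  by rewrite lerDl sumr_ge0// => *; exact: sqr_ge0.
apply: ler_sum => j; case: (unliftP ord_max j) => [k|] -> //; last by rewrite eqxx.
move=> _; rewrite -[leLHS]real_normK ?num_real// -intr_norm -natr_absz.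
by rewrite lerXn2r ?nnegrE ?divr_ge0.
Qed.

Lemma t_small (e : R) : 0 < e -> exists K0, forall k, (K0 <= k)%N ->
  t (2 ^ k) <= e * (2 ^ k)%:R.
Proof.
move=> e0; have /cvgrPdist_le/(_ e e0)[K0 _ h] := t_lim.
exists K0 => k Kk; have := h (2 ^ k)%N (leq_trans Kk (ltnW (ltn_expl k (ltnSn 1)))).
rewrite /= sub0r normrN ger0_norm ?divr_ge0 ?(ltW (t_pos _))//.
by rewrite ler_pdivrMr ?ltr0n.
Qed.

Let term k : R := (t (2 ^ k) / 2 ^+ k) `^ p.

Let term0 k : 0 <= term k. Proof. exact: powR_ge0. Qed.

Let tpow_ge0 k : 0 <= t (2 ^ k). Proof. exact/ltW/t_pos. Qed.

(** Starting points below the tip of the thorn: their distance to a point at height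
    h is at least h, and tends to infinity with M. *)
Let below M : lattice d :=
  (\row_j (if j == ord_max then - (M%:Z) else 0) : 'rV[int]_d).

Let below_far M L r H (g : box_index (n := n) H r) :
  (M + L <= snorm (below M - box_point L g)%R)%N.
Proof.
apply: (@snorm_coord _ _ ord_max);
  rewrite coordD coordN coord_box_max /below /coord mxE eqxx.
by lia.
Qed.

(** Cover the thorn by dyadic boxes. The box at height 2^k is hit with probability of
    the order of the k-th term of the series, so the boxes beyond some height are
    hit with probability at most 1/4; the remaining finite box is hit with
    probability at most 1/4 from far enough. *)
Lemma nonmassive_thorn : cvgn (fun N => \sum_(1 <= k < N) term k) ->
  exists x, (hit_prob X (thorn t) x < 1)%E.
Proof.
move=> cterm; have [C C0 box_le] := hit_prob_box_le.
have q1 : 0 < 1 / 4 :> R by rewrite divr_gt0.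
have [K1 t4] := t_small q1.
pose z : R := 2 `^ (- p).
have z0 : 0 <= z by exact: powR_ge0.
have z1 : z < 1.
  have h : 1 `^ p < 2 `^ p by apply: (gt0_ltr_powR p0); rewrite ?nnegrE// ltr1n.
  by rewrite /z powRN invf_lt1 ?powR_gt0//; rewrite powR1 in h.
pose e : R := (8 * C * 4 `^ p)^-1.
have e0 : 0 < e by rewrite invr_gt0 !mulr_gt0 ?powR_gt0.
have [K2 tail2] := small_tails term0 cterm e0.
have cgeom : cvgn (fun N => \sum_(0 <= k < N) z ^+ k).
  have := @is_cvg_geometric_series R 1 z; rewrite ger0_norm// => /(_ z1).
  by rewrite /series/=; under eq_fun do under eq_bigr do rewrite mul1r.
have [K3 tail3] := small_tails (fun k => exprn_ge0 k z0) cgeom e0.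
pose K := (maxn K1 (maxn K2 K3)).+1.
pose r k := Num.trunc (t (2 ^ k)).
have r_le k : (r k)%:R <= t (2 ^ k) by rewrite truncn_le.
have r_small k : (K <= k)%N -> (4 * r k <= 2 ^ k)%N.
  move=> Kk; rewrite -(ler_nat R) natrM -ler_pdivlMl// mulrC.
  by apply: le_trans (r_le k) _; rewrite mulrC -div1r; apply: t4; move: Kk; rewrite /K;
    clear; lia.
pose piece m : set (lattice d) := in_box (2 ^ m) (2 ^ m) (r m.+1).
have piece_le x M m : x = below M -> (K <= m)%N ->
    (hit_prob X (piece m) x <= (C * 4 `^ p * (term m.+1 + z ^+ m))%:E)%E.
  move=> -> Km.
  have r2 : (2 * r m.+1 <= 2 ^ m)%N.
    by have := r_small m.+1 (leqW Km); rewrite expnS; clear; lia.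
  apply: le_trans (box_le _ (2 ^ m)%N (2 ^ m)%N (r m.+1) _ (2 ^ m)%N _ r2 _ _ _) _ =>
    //.
    by move=> g; rewrite (leq_trans _ (leqW (below_far M _ g)))// leq_addl.
  rewrite lee_fin -[leRHS]mulrA (ler_pM2l C0).
  have -> : n%:R - alpha = p by rewrite -natr1; lra.
  have -> : (2 ^ m)%:R `^ (- beta) = (2 ^ m)%:R `^ (- p) / (2 ^ m)%:R :> R.
    rewrite -[X in _ / X](powRr1 (ler0n _ _)) -powRB ?pnatr_eq0 ?expn_eq0 ?implybT//.
    by congr (_ `^ _); lra.
  have m20 : 0 < (2 ^ m)%:R :> R by rewrite ltr0n.
  have rescale (a b c : R) : b != 0 -> a * b * (c / b) = a * c by move=> ?; field.
  have -> : (2 ^ m)%:R `^ (- p) = (2 ^ m)%:R^-1 `^ p :> R.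
    by rewrite -powR_inv1// -powRrM mulN1r.
  rewrite rescale ?gt_eqF// -powRM ?invr_ge0//.
  pose a : R := t (2 ^ m.+1) / 2 ^+ m.+1; pose b : R := 2 ^- m.
  have a0 : 0 <= a by rewrite divr_ge0 ?exprn_ge0.
  have bpos : 0 <= b by rewrite invr_ge0 exprn_ge0.
  have rab : (r m.+1).+1%:R / (2 ^ m)%:R <= 4 * Num.max a b.
    apply: (@le_trans _ _ (2 * a + b)); last first.
      by case: (leP a b) => *; lra.
    rewrite /a /b -[X in X / _ <= _]natr1 natrX mulrDl mul1r lerD2r.
    have two (u v : R) : v != 0 -> 2 * (u / (2 * v)) = u / v by move=> ?; field.
    by rewrite exprS two ?expf_neq0// ler_wpM2r ?invr_ge0 ?exprn_ge0.
  have max0 : 0 <= Num.max a b by rewrite le_max a0.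
  apply: (@le_trans _ _ ((4 * Num.max a b) `^ p)).
    by apply: ge0_ler_powR; rewrite ?nnegrE ?(ltW p0) ?divr_ge0 ?mulr_ge0.
  rewrite powRM// ler_wpM2l ?powR_ge0//.
  have -> : z ^+ m = b `^ p.
    by rewrite /z /b -powR_mulrn// -powRrM -exprVn -powR_mulrn ?invr_ge0// -powRrM
      -powR_inv1// -powRrM; congr (_ `^ _); ring.
  rewrite -/a; case: (leP a b) => _; first by rewrite lerDr powR_ge0.
  by rewrite lerDl powR_ge0.
pose rF := r K; pose F : set (lattice d) := in_box 1 (2 ^ K) rF.
pose Q : R := C * (rF.+1%:R `^ (n%:R - alpha) * (2 ^ K)%:R).
have Q0 : 0 <= Q by rewrite mulr_ge0 ?(ltW C0)// mulr_ge0 ?powR_ge0.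
pose M := Num.bound (4 * Q).
have F_le : (hit_prob X F (below M) <= (1 / 4)%:E)%E.
  have r2 : (2 * rF <= 2 ^ K)%N by have := r_small K (leqnn K); rewrite /rF; clear; lia.
  apply: le_trans (box_le _ 1 (2 ^ K)%N rF _ M.+1 _ r2 _ _ _) _ => //.
    by move=> g; rewrite ltnS (leq_trans _ (below_far M _ g))// leq_addr.
  rewrite lee_fin mulrA -/Q powRN.
  have MQ : 4 * Q <= M%:R by rewrite ltW// archi_boundP// mulr_ge0.
  have M1 : M.+1%:R <= M.+1%:R `^ beta :> R by rewrite le1r_powR// ler1n.
  rewrite ler_pdivrMr ?powR_gt0//; move: M1; rewrite -natr1; lra.
pose Bs m : set (lattice d) := if m is k.+1 then piece (K + k)%N else F.
exists (below M).
have cover : [set w | exists m, thorn t (walk X (below M) m w)] `<=`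
    \bigcup_k [set w | exists m, Bs k (walk X (below M) m w)].
  move=> w /= [m Tm]; have [x1 xt] := thorn_bounds Tm.
  move: x1 xt; set x := walk _ _ _ _ => x1 xt.
  pose h := absz (coord x ord_max).
  have hE : coord x ord_max = h%:Z by move: x1; rewrite /h; clear; lia.
  have h0 : (0 < h)%N by move: x1; rewrite /h; clear; lia.
  have [hK|Kh] := ltnP h (2 ^ K).
    exists 0%N => //; exists m; split => [j|]; last by rewrite hE; clear -h0 hK; lia.
    rewrite /rF /r truncn_ge_nat//; apply: le_trans (xt j) _.
    by apply: t_mono => //; exact: ltnW.
  pose k := trunc_log 2 h.
  have /andP[kh hk] : (2 ^ k <= h < 2 ^ k.+1)%N by rewrite trunc_logP// trunc_log_ltn.
  have Kk : (K <= k)%N by rewrite -ltnS -(ltn_exp2l _ _ (ltnSn 1)) (leq_ltn_trans Kh).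
  exists (k - K).+1 => //; exists m; rewrite /Bs subnKC//; split => [j|].
    rewrite truncn_ge_nat//; apply: le_trans (xt j) _.
    by apply: t_mono => //; exact: ltnW.
  by rewrite hE; move: kh hk; rewrite expnS; clear; lia.
have sub : (hit_prob X (thorn t) (below M) <=
    \sum_(0 <= k <oo) hit_prob X (Bs k) (below M))%E.
  apply: measure_sigma_subadditive => //; last exact: measurable_walk_event.
  by move=> k; exact: measurable_walk_event.
apply: le_lt_trans sub _; apply: (@le_lt_trans _ _ (1 / 2)%:E); last first.
  by rewrite lte_fin; lra.
have nn k : (0 <= hit_prob X (Bs k) (below M))%E by exact: hit_prob_ge0.
apply: lime_le; first exact: is_cvg_nneseries.
apply: nearW => N.
apply: (@le_trans _ _ (\sum_(0 <= k < N.+1) hit_prob X (Bs k) (below M))%E).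
  by rewrite big_nat_recr//= leeDl.
rewrite big_nat_recl//=.
have -> : (1 / 2)%:E = ((1 / 4)%:E + (1 / 4)%:E)%E :> \bar R by rewrite -EFinD;
  congr EFin; lra.
apply: leeD; first exact: F_le.
apply: (@le_trans _ _ (\sum_(0 <= k < N)
    (C * 4 `^ p * (term (K + k).+1 + z ^+ (K + k)))%:E)%E).
  by apply: lee_sum => k _; apply: piece_le => //; exact: leq_addr.
rewrite sumEFin lee_fin -mulr_sumr big_split/=.
have shift (u : nat -> R) i : \sum_(i <= k < i + N) u k = \sum_(0 <= k < N) u (i + k)%N.
  by rewrite -{1}[i]add0n big_addn addKn; apply: eq_bigr => k _; rewrite addnC.
have s1 : \sum_(0 <= k < N) term (K + k).+1 <= e.
  apply: le_trans (tail2 K.+1 N _); last by rewrite /K; clear; lia.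
  by rewrite shift.
have s2 : \sum_(0 <= k < N) z ^+ (K + k) <= e.
  apply: le_trans (tail3 K N _); last by rewrite /K; clear; lia.
  by rewrite shift.
have C4 : 0 < C * 4 `^ p by rewrite mulr_gt0 ?powR_gt0.
apply: le_trans (ler_wpM2l (ltW C4) (lerD s1 s2)) _.
rewrite /e le_eqVlt; apply/orP; left; apply/eqP; field.
by rewrite !gt_eqF ?powR_gt0.
Qed.

(** The part of the thorn used at height 2^k. The intervals of heights of these
    boxes are separated by gaps comparable to 2^k. *)
Let radius k : nat := Num.trunc (t (2 ^ k) / d%:R).
Let rung k : set (lattice d) := in_box (2 ^ k) (2 ^ k.-1) (radius k).
Let rung_charge k : lattice d -> R := box_charge (2 ^ k) (2 ^ k.-1) (radius k).
Let weight k : R := (radius k).+1%:R `^ (- alpha).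
Let size k : R := ((radius k).+1%:R / (2 ^ k)%:R) `^ p.

Let size_ge0 k : 0 <= size k. Proof. exact: powR_ge0. Qed.

Let weight_ge0 k : 0 <= weight k. Proof. exact: powR_ge0. Qed.

Let radius_le k : (radius k)%:R <= t (2 ^ k) / d%:R.
Proof. by rewrite truncn_le divr_ge0. Qed.

Let term_le_size k : term k <= d%:R `^ p * size k.
Proof.
rewrite /term /size -powRM ?divr_ge0//; apply: ge0_ler_powR.
- exact: ltW.
- by rewrite nnegrE divr_ge0 ?exprn_ge0.
- by rewrite nnegrE mulr_ge0 ?divr_ge0.
rewrite natrX mulrA ler_wpM2r ?invr_ge0 ?exprn_ge0//.
have := truncn_le_nat (t (2 ^ k) / d%:R) (radius k); rewrite leqnn => /esym/ltW.
by rewrite ler_pdivrMr ?ltr0n// mulrC.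
Qed.

Let rung_sub k : (0 < k)%N -> rung k `<=` thorn t.
Proof.
move=> k0 y [y1 /andP[y2 _]]; apply: thorn_suff.
  by apply: le_trans y2; have := pow2_gt0 k; clear; lia.
move=> j; apply: le_trans (_ : _ <= (radius k)%:R) _; first by rewrite ler_nat.
apply: le_trans (radius_le k) _; rewrite ler_wpM2r ?invr_ge0//.
by apply: t_mono => //; move: y2; clear; lia.
Qed.

Let rung_gap j k x : (0 < j)%N -> (0 < k)%N -> j != k -> rung j x ->
  forall g : box_index (n := n) (2 ^ k.-1) (radius k),
    (2 ^ k <= 4 * (snorm (x - box_point (2 ^ k) g)%R).+1)%N.
Proof.
move=> j0 k0 jk [_ xj] g.
have : (absz (coord x ord_max - (2 ^ k + g.2)%:Z) <= snorm (x - box_point (2 ^ k)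
  g)%R)%N.
  by apply: (@snorm_coord _ _ ord_max); rewrite coordD coordN coord_box_max.
have := ltn_ord g.2; move: (nat_of_ord g.2) (snorm _) (coord x ord_max) xj => h N c.
have pk : (2 ^ k = 2 * 2 ^ k.-1)%N by rewrite -expnS prednK.
have pj : (2 ^ j = 2 * 2 ^ j.-1)%N by rewrite -expnS prednK.
have : (2 * 2 ^ j <= 2 ^ k)%N \/ (2 * 2 ^ k <= 2 ^ j)%N.
  by rewrite -!expnS !leq_exp2l//; move: jk; clear; lia.
move: pk pj; move: (2 ^ k)%N (2 ^ k.-1)%N (2 ^ j)%N (2 ^ j.-1)%N.
clear; lia.
Qed.

Let decay_powers (R' T : R) : 0 < R' -> 0 < T ->
  R' `^ (- alpha) * (R' ^+ n * (T * T `^ (- beta))) = (R' / T) `^ p.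
Proof.
move=> R0 T0; have Rn : R' != 0 by rewrite gt_eqF.
have Tn : T != 0 by rewrite gt_eqF.
rewrite mulrA -powR_mulrn ?(ltW R0)// -powRD ?Rn ?implybT//.
rewrite -{1}[T]powRr1 ?(ltW T0)// -powRD ?Tn ?implybT//.
rewrite powRM ?invr_ge0 ?(ltW R0) ?(ltW T0)// -powR_inv1 ?(ltW T0)// -powRrM.
by congr (_ `^ _ * _ `^ _); rewrite -?natr1; ring.
Qed.

(** Give each rung its uniform charge, divided by r^alpha. The potential of rung k is
    then bounded on the rung itself and at most of the order of the k-th term of the
    series on the other rungs; at x it is of exactly that order once |x| <= 2^k. With
    A the sum of these terms over a long range of k, the potential of all rungs is
    at least c A at x and at most C (1 + A) on the rungs, so the hitting probability
    from x is bounded below by a constant that does not depend on x. *)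
Lemma massive_thorn : ~ cvgn (fun N => \sum_(1 <= k < N) term k) ->
  forall x, hit_prob X (thorn t) x = 1%E.
Proof.
move=> dterm.
have [c [C [c0 C0 green_box_le]]] := green_box.
have [D D0 own] := @box_decay_le R n d3 alpha ha.
pose c1 : R := c * (4 `^ (- beta) / 2).
pose C1 : R := C * D + C * (2 ^+ n * 4 `^ beta).
have c10 : 0 < c1 by rewrite mulr_gt0// divr_gt0 ?powR_gt0.
have C10 : 0 < C1 by rewrite addr_gt0 ?mulr_gt0 ?exprn_gt0 ?powR_gt0.
apply: (@hit_prob_eq1 _ _ alpha ha _ _ _ _ hX _ (c1 / C1)); first by rewrite divr_gt0.
move=> x.
have [K1 t1] := t_small (ltr01 : 0 < 1 :> R).
pose K := (maxn K1 (snorm x)).+1.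
have [N sumN] := large_sums term0 (d%:R `^ p) dterm
  (ltn0Sn (maxn K1 (snorm x)) : (1 <= K)%N).
pose m := (N - K)%N.
pose A : R := \sum_(i < m) size (K + i).
have A1 : 1 <= A.
  have dp : 0 < d%:R `^ p :> R by rewrite powR_gt0 ?ltr0n.
  rewrite -(ler_pM2l dp) mulr1; apply: le_trans sumN _.
  rewrite -{1}[K]add0n big_addn big_mkord /A mulr_sumr; apply: ler_sum => i _.
  by rewrite addnC; exact: term_le_size.
pose f y : R := \sum_(i < m) weight (K + i) * rung_charge (K + i) y.
have f0 y : 0 <= f y.
  by apply: sumr_ge0 => i _; rewrite mulr_ge0 ?weight_ge0// box_charge_ge0.
pose B y := exists i : 'I_m, rung (K + i) y.
have greenE y : green alpha f y =
    (\sum_(i < m) (weight (K + i))%:E * green alpha (rung_charge (K + i)) y)%E.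
  apply: (green_sum ha (a := fun i : 'I_m => weight (K + i))
    (f_ := fun i : 'I_m => rung_charge (K + i))) => //.
  by move=> i z; exact: box_charge_ge0.
pose U k y : R := \sum_(g : box_index (n := n) (2 ^ k.-1) (radius k))
  green_decay alpha (y - box_point (2 ^ k) g).
have upper (E : 'I_m -> R) y :
  (forall i : 'I_m, weight (K + i) * U (K + i)%N y <= E i) ->
    (green alpha f y <= (C * \sum_(i < m) E i)%:E)%E.
  move=> wE; rewrite greenE mulr_sumr -sumEFin; apply: lee_sum => i _.
  apply: (@le_trans _ _ ((weight (K + i))%:E * (C * U (K + i)%N y)%:E)%E).
    rewrite lee_wpmul2l ?lee_fin ?weight_ge0//.
    by have /andP[] := green_box_le (2 ^ (K + i))%N (2 ^ (K + i).-1)%N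
      (radius (K + i)) y.
  by rewrite -EFinM lee_fin mulrCA (ler_pM2l C0).
have radius1 k : (K <= k)%N -> (radius k <= 2 ^ k)%N.
  move=> Kk; rewrite -(ler_nat R); apply: le_trans (radius_le k) _.
  rewrite ler_pdivrMr ?ltr0n//; apply: (@le_trans _ _ (2 ^ k)%:R).
    by rewrite -[leRHS]mul1r; apply: t1; move: Kk; rewrite /K; clear; lia.
  by rewrite ler_peMr// ler1n.
have rpos k : 0 < (radius k).+1%:R :> R by [].
have pow2R k : 0 < (2 ^ k)%:R :> R by rewrite ltr0n.
have far j k y : (0 < j)%N -> (0 < k)%N -> j != k -> rung j y ->
    weight k * U k y <= 2 ^+ n * 4 `^ beta * size k.
  move=> j0 k0 jk yj.
  have U_le : U k y <= (2 ^+ n * (radius k).+1%:R ^+ n) * (2 ^ k)%:R *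
      (4 `^ beta * (2 ^ k)%:R `^ (- beta)).
    apply: (@le_trans _ _ (\sum_(g : box_index (n := n) (2 ^ k.-1) (radius k))
        (4 `^ beta * (2 ^ k)%:R `^ (- beta)))).
      apply: ler_sum => g _;
        rewrite /green_decay !powRN -invf_div lef_pV2 ?posrE ?divr_gt0 ?powR_gt0//.
      rewrite ler_pdivrMr ?powR_gt0// -powRM// mulrC.
      apply: ge0_ler_powR; rewrite ?nnegrE ?mulr_ge0//.
      by rewrite -natrM ler_nat; exact: (rung_gap j0 k0 jk yj g).
    rewrite sumr_const card_box_index -[leLHS]mulr_natl.
    apply: ler_wpM2r; first by rewrite mulr_ge0 ?powR_ge0.
    rewrite natrM; apply: ler_pM => //.
      by rewrite natrX -exprMn lerXn2r ?nnegrE ?mulr_ge0// -natrM ler_nat; clear; lia.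
    by rewrite ler_nat leq_exp2l// leq_pred.
  apply: le_trans (ler_wpM2l (weight_ge0 k) U_le) _.
  rewrite /size -(decay_powers (rpos k) (pow2R k)) -/(weight k).
  set w := weight k; set e := (2 ^ k)%:R `^ _; set q := (radius k).+1%:R ^+ n.
  by rewrite le_eqVlt; apply/orP; left; apply/eqP; ring.
have uB y : B y -> (green alpha f y <= (C1 * A)%:E)%E.
  move=> [j yj].
  pose E (i : 'I_m) : R := (if i == j then D else 0) + 2 ^+ n * 4 `^ beta * size
    (K + i).
  apply: le_trans (upper E y _) _.
    move=> i; rewrite /E; case: eqP => [->|/eqP ij].
      apply: (@le_trans _ _ D); last first.
        by rewrite lerDl !mulr_ge0 ?exprn_ge0 ?powR_ge0 ?size_ge0.
      rewrite /weight powRN mulrC ler_pdivrMr ?powR_gt0//.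
      exact: own.
    rewrite add0r; apply: (far (K + j)%N) => //.
    by rewrite eqn_add2l eq_sym.
  rewrite lee_fin /E big_split/= -big_mkcond/= big_pred1_eq -mulr_sumr -/A.
  have CD : 0 <= C * D by rewrite mulr_ge0 ?ltW.
  have := ler_wpM2l CD A1; rewrite /C1 mulr1.
  by move: (2 ^+ n * 4 `^ beta) => q; lra.
have low : ((c1 * A)%:E <= green alpha f x)%E.
  rewrite greenE /A mulr_sumr -sumEFin; apply: lee_sum => i _.
  have Ki : (K <= K + i)%N by exact: leq_addr.
  move: (K + i)%N Ki => k Kk.
  have k0 : (0 < k)%N by exact: leq_trans Kk.
  apply: (@le_trans _ _ ((weight k)%:E * (c * U k x)%:E)%E); last first.
    rewrite lee_wpmul2l ?lee_fin ?weight_ge0//.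
    by have /andP[] := green_box_le (2 ^ k)%N (2 ^ k.-1)%N (radius k) x.
  rewrite -EFinM lee_fin.
  have U_ge : (radius k).+1%:R ^+ n * ((2 ^ k)%:R / 2) *
    (4 `^ (- beta) * (2 ^ k)%:R `^ (- beta)) <= U k x.
    apply: (@le_trans _ _ (\sum_(g : box_index (n := n) (2 ^ k.-1) (radius k))
        (4 `^ (- beta) * (2 ^ k)%:R `^ (- beta)))); last first.
      apply: ler_sum => g _; rewrite -powRM// -natrM; apply: decay_near.
      have snx : (snorm x <= 2 ^ k)%N.
        by apply: leq_trans (ltnW (ltn_expl k (ltnSn 1))); move: Kk; rewrite /K; clear;
          lia.
      have : (snorm (x - box_point (2 ^ k) g)%R <= 3 * 2 ^ k)%N.
        apply: snorm_le => i'; rewrite coordD coordN.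
        have := leq_trans (coord_le_snorm x i') snx.
        have [b1 /andP[b2 b3]] := in_box_point (2 ^ k)%N g.
        have := radius1 k Kk.
        have : (2 ^ k.-1 <= 2 ^ k)%N by rewrite leq_exp2l// leq_pred.
        case: (unliftP ord_max i') => [l|] ->.
          by have := b1 l; clear; lia.
        by move: b2 b3; clear; lia.
      by have := pow2_gt0 k; clear; lia.
    rewrite sumr_const card_box_index -[leRHS]mulr_natl.
    apply: ler_wpM2r; first by rewrite mulr_ge0 ?powR_ge0.
    rewrite natrM; apply: ler_pM; rewrite ?exprn_ge0 ?divr_ge0//.
      by rewrite natrX lerXn2r ?nnegrE// ler_nat; clear; lia.
    by rewrite ler_pdivrMr// -natrM ler_nat -expnSr prednK.
  have cw0 : 0 <= c * weight k by apply: mulr_ge0; [exact: ltW|exact: weight_ge0].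
  have := ler_wpM2l cw0 U_ge.
  rewrite /size -(decay_powers (rpos k) (pow2R k)) -/(weight k) /c1.
  set w := weight k; set e := (2 ^ k)%:R `^ _; set q := (radius k).+1%:R ^+ n.
  set e4 := 4 `^ _; set T := (2 ^ k)%:R => h.
  rewrite [leLHS](_ : _ = c * w * (q * (T / 2) * (e4 * e))); last by field.
  by rewrite [leRHS](_ : _ = c * w * U k x)//; ring.
have fin : (green alpha f x < +oo)%E.
  apply: le_lt_trans (upper (fun i : 'I_m => weight (K + i) * U (K + i)%N x) x _) _
    => //.
  exact: ltry.
have CA0 : 0 < C1 * A by rewrite mulr_gt0// (lt_le_trans ltr01 A1).
have f_off y : ~ B y -> f y = 0.
  move=> nB; apply: big1 => i _; rewrite [rung_charge _ _]box_charge0 ?mulr0//.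
  by move=> yi; apply: nB; exists i.
have := le_trans low (green_le_hit_prob ha hX f0 f_off (ltW CA0) uB fin).
rewrite muleC -lee_pdivrMr// => h.
apply: le_trans (hit_probS x (_ : B `<=` thorn t)); last first.
  by move=> y [i]; apply: rung_sub.
apply: le_trans h; rewrite -EFinM lee_fin.
have An : A != 0 by rewrite gt_eqF// (lt_le_trans ltr01 A1).
by rewrite le_eqVlt; apply/orP; left; apply/eqP; field; rewrite An gt_eqF.
Qed.

End thorns.

Theorem theorem4p4 (R : realType) (d : nat) (alpha : R) (t : nat -> R)
  (disp : measure_display) (Omega : measurableType disp)
  (P : probability Omega R) (X : nat -> {RV P >-> lattice d})
  (hd : (3 <= d)%N) (halpha0 : 0 < alpha) (halpha2 : alpha < 2)
  (ht_pos : forall n, (1 <= n)%N -> 0 < t n)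
  (ht_mono : forall m n, (1 <= m)%N -> (m <= n)%N -> t m <= t n)
  (ht_lim : t n / n%:R @[n --> \oo] --> (0 : R))
  (hX : iid_with_law X (stable_step alpha)) :
  massive X (thorn t) <->
  ~ cvgn (fun N => \sum_(1 <= n < N)
            (t (2 ^ n)%N / 2 ^+ n) `^ (d%:R - alpha - 1)).
Proof.
have ha : 0 < alpha < 2 by rewrite halpha0.
case: d X hd hX => [//|n] X hd hX; split => [[_ hit1] cterm|dterm].
  have [x] := nonmassive_thorn hd ha hX ht_pos ht_mono ht_lim cterm.
  by rewrite /hit_prob hit1 ltxx.
split; last exact: (massive_thorn hd ha hX ht_pos ht_mono ht_lim dterm).
split; first by [].
move=> /(_ 0 I) [i _ [+ _]].
by rewrite /coord mxE.
Qed.
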